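(* Let $(A,M,L)$ be a locally compact quantum metric space with $A$ separable, and let $\rho:A\to\mathbb{B}(H)$ be a faithful nondegenerate representation on a Hilbert space $H$. For $R\ge 0$ let $B^*_R\subset\mathbb{B}(H)$ be the set of operators of spectral propagation less than or equal to $R$. Then the family $(B^*_R)_{R\ge 0}$ defines a W*-quantum metric on the von Neumann algebra $\rho(A)''$. Furthermore, this W*-quantum metric is reflexive.
   Context: Locally compact quantum metric spaces. Let $A$ be a C*-algebra, $\mathfrak{u}A$ its unitization ($\mathfrak{u}A=A$ if $A$ is unital), $\mathfrak{sa}(\cdot)$ the self-adjoint part, $\mathcal{S}(A)$ the state space. A Lipschitz pair $(A,L)$ consists of $A$ and a seminorm $L$ defined on a dense subspace $\mathrm{dom}(L)$ of $\mathfrak{sa}(\mathfrak{u}A)$ with $\{a:L(a)=0\}=\mathbb{R}1$; set $L(a)=\infty$ off $\mathrm{dom}(L)$. Put $\mathrm{mk}_L(\mu,\nu)=\sup\{|\mu(a)-\nu(a)|: a\in\mathfrak{sa}(\mathfrak{u}A), L(a)\le 1\}$ for $\mu,\nu\in\mathcal{S}(A)$. A Lipschitz triple $(A,M,L)$ is a Lipschitz pair $(A,L)$ with an abelian C*-subalgebra $M\subset A$ (the topography) containing an approximate unit for $A$; $\sigma(M)$ is its Gelfand spectrum. For $K\subset\sigma(M)$ compact, $\chi_K$ is the indicator function of $K$, viewed as a projection in $M^{**}\subset A^{**}$; states are extended normally to $A^{**}$. A state $\mu$ is local if $\mu(\chi_K)=1$ for some compact $K\subset\sigma(M)$. A set $\mathcal{S}\subset\mathcal{S}(A)$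 is tame if for some (hence any) local state $\mu$, $\lim_{K}\sup\{|\varphi(a-\chi_Ka\chi_K)|:\varphi\in\mathcal{S},a\in\mathfrak{sa}(A),L(a)\le 1,\mu(a)=0\}=0$, the limit being along the directed set of compact $K\subset\sigma(M)$. $(A,M,L)$ is a locally compact quantum metric space if $\mathrm{mk}_L$ metrizes the weak* topology on every tame subset of $\mathcal{S}(A)$. Spectral propagation. Write $a$ for $\rho(a)$ (extended unitally to $\mathfrak{u}A$) and use Borel functional calculus in $\mathbb{B}(H)$. $T\in\mathbb{B}(H)$ has spectral propagation $\le R$ if $\chi_{(-\infty,0]}(a)\,T\,\chi_{(R,+\infty)}(a)=0$ for all $a\in\mathfrak{sa}(\mathfrak{u}A)$ with $L(a)\le 1$. W*-metrics. A W*-filtration of $\mathbb{B}(H)$ is a family $(\mathcal{V}_r)_{r\ge0}$ of weak* closed self-adjoint unital subspaces of $\mathbb{B}(H)$ with $\mathcal{V}_r\mathcal{V}_s\subset\mathcal{V}_{r+s}$ and $\mathcal{V}_r=\bigcap_{s>r}\mathcal{V}_s$ for all $r,s\ge 0$. It defines a W*-quantum metric on a von Neumann algebra $N\subset\mathbb{B}(H)$ if $\mathcal{V}_0=N'$. It is reflexive if for all $r\ge0$, $\mathcal{V}_r=\{B\in\mathbb{B}(H): \text{for all projections }P,Q\in N,\ P\mathcal{V}_rQ=\{0\}\Rightarrow PBQ=0\}$. *)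

(* Defs.v *)
From HB Require Import structures.
From mathcomp Require Import all_boot all_order all_algebra.
From mathcomp Require Import sesquilinear.
From mathcomp Require Import complex.
From mathcomp Require Import all_classical all_reals all_analysis.

Set Implicit Arguments.
Unset Strict Implicit.
Unset Printing Implicit Defensive.

Import Order.TTheory GRing.Theory Num.Theory.
Import numFieldNormedType.Exports.

Local Open Scope classical_set_scope.
Local Open Scope ring_scope.
Local Open Scope complex_scope.

(* The library gives every numFieldType [K] its topology through the sort of
   [K]; this makes it available on the bare type [R[i]]. *)
HB.instance Definition _ (R : realType) :=
  NormedModule.copy R[i] ((R[i] : numFieldType)^o).

(* Norms over [R[i]] take their values in [R[i]]; [rnorm x] is the same number
   as an element of [R]. *)
Definition rnorm (R : realType) (V : normedModType R[i]) (x : V) : R :=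
  complex.Re `|x|.

(* C*-algebras, not necessarily unital *)
HB.mixin Record isCStarAlgebra (R : realType) A
    & CompleteNormedModule R[i] A := {
  cmul : A -> A -> A;
  star : A -> A;
  cmulA : associative cmul;
  cmulDl : left_distributive cmul +%R;
  cmulDr : right_distributive cmul +%R;
  cmulZl : forall (l : R[i]) (a b : A), cmul (l *: a) b = l *: cmul a b;
  cmulZr : forall (l : R[i]) (a b : A), cmul a (l *: b) = l *: cmul a b;
  starK : involutive star;
  starD : {morph star : a b / a + b};
  starZ : forall (l : R[i]) (a : A), star (l *: a) = l^* *: star a;
  starM : forall a b : A, star (cmul a b) = cmul (star b) (star a);
  norm_cmul : forall a b : A, `|cmul a b| <= `|a| * `|b|;
  norm_cstar : forall a : A, `|cmul (star a) a| = `|a| ^+ 2;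
}.

#[short(type="cstarAlgType")]
HB.structure Definition CStarAlgebra (R : realType) :=
  {A of CompleteNormedModule R[i] A & isCStarAlgebra R A}.

Section cstar_algebra.
Variable R : realType.

Definition self_adjoint (A : cstarAlgType R) : set A := [set a | star a = a].

Definition cpositive (A : cstarAlgType R) (a : A) : Prop :=
  exists b : A, a = cmul (star b) b.

Definition is_unit_elt (A : cstarAlgType R) (e : A) : Prop :=
  forall a : A, cmul e a = a /\ cmul a e = a.

Definition star_hom (A B : cstarAlgType R) (f : A -> B) : Prop :=
  [/\ linear f,
      forall a b, f (cmul a b) = cmul (f a) (f b) &
      forall a, f (star a) = star (f a)].

(* [U], with unit [one] and inclusion [iota], is the unitization of [A]:
   [A + C 1], which has to be [A] itself when [A] is unital. *)
Definition is_unitization (A U : cstarAlgType R) (iota : A -> U) (one : U) :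
    Prop :=
  [/\ star_hom iota, injective iota, is_unit_elt one,
      forall u, exists (a : A) (l : R[i]), u = iota a + l *: one &
      forall e : A, is_unit_elt e -> forall u, exists a : A, u = iota a].

(* The value at [u = iota a + l *: one] of the extension of [f] to the
   unitization that maps [one] to [v1]. If [A] has a unit [e] the decomposition
   of [u] is not unique, but the value does not depend on it provided that
   [f e = v1], as for states and for nondegenerate representations. *)
Definition unital_ext (A U : cstarAlgType R) (iota : A -> U) (one : U)
    (V : lmodType R[i]) (f : A -> V) (v1 : V) (u : U) : V :=
  xget 0 [set v | exists (a : A) (l : R[i]),
    u = iota a + l *: one /\ v = f a + l *: v1].

Section dual.
Variable A : cstarAlgType R.

Definition dual_norm (f : A -> R[i]) : \bar R :=
  ereal_sup [set (rnorm (f a))%:E | a in [set a : A | rnorm a <= 1]].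

Definition cdual : set (A -> R[i]) :=
  [set f | scalar f /\ (dual_norm f < +oo)%E].

Definition state : set (A -> R[i]) :=
  [set f | [/\ scalar f, forall a, 0 <= f (cmul (star a) a) &
               dual_norm f = 1%E]].

(* The elements of the bidual are total functions on [A -> R[i]]; only their
   values on [cdual] matter. *)
Definition bidual : set ((A -> R[i]) -> R[i]) :=
  [set p | (forall (l : R[i]) f g, cdual f -> cdual g ->
              p (fun a => l * f a + g a) = l * p f + p g) /\
           exists k : R, forall f, cdual f ->
              ((rnorm (p f))%:E <= k%:E * dual_norm f)%E].

Definition bidual_of (a : A) : (A -> R[i]) -> R[i] := fun f => f a.

(* The (first) Arens product, which makes the bidual of [A] into its enveloping
   von Neumann algebra. The evaluation [p |-> p f] is the normal extension of a
   functional [f]. *)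
Definition arens (p q : (A -> R[i]) -> R[i]) : (A -> R[i]) -> R[i] :=
  fun f => p (fun a => q (fun b => f (cmul a b))).

Definition character (x : A -> R[i]) : Prop :=
  [/\ scalar x, forall a b, x (cmul a b) = x a * x b & exists a, x a != 0].

(* The Gelfand spectrum of a commutative [A]; its topology is induced by the
   topology of pointwise convergence. *)
Definition spectrum : set {ptws A -> R[i]} := [set x | character x].

Definition compact_spectrum (K : set {ptws A -> R[i]}) : Prop :=
  K `<=` spectrum /\ compact K.

(* Finite Radon measures on the spectrum, as Borel measures on the ambient
   space that are concentrated on the spectrum. *)
Definition borel_ptws := g_sigma_algebraType (@open {ptws A -> R[i]}).

Definition radon (m : {finite_measure set borel_ptws -> \bar R}) : Prop :=
  m (~` spectrum) = 0%E /\
  forall E : set borel_ptws, measurable E ->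
    m E = ereal_sup [set m K | K in
            [set K | compact_spectrum K /\ K `<=` E]].

Definition represents (m : {finite_measure set borel_ptws -> \bar R})
    (f : A -> R[i]) : Prop :=
  forall a : A,
    f a = (\int[m]_(x in spectrum) complex.Re (x a))%R
       +i* (\int[m]_(x in spectrum) complex.Im (x a))%R.

(* The indicator function of [K] as an element of the bidual of a commutative
   [A]: the bounded functional that integrates it against the finite Radon
   measures, which span the dual by the Riesz theorem. *)
Definition chi (K : set {ptws A -> R[i]}) : (A -> R[i]) -> R[i] :=
  xget (fun=> 0) [set p | bidual p /\
    forall f m, radon m -> represents m f -> p f = (fine (m K))%:C].

End dual.

Definition bidual_map (M A : cstarAlgType R) (j : M -> A)
    (p : (M -> R[i]) -> R[i]) : (A -> R[i]) -> R[i] :=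
  fun f => p (f \o j).

Definition approximate_unit (A : cstarAlgType R) (I : Type)
    (le : I -> I -> Prop) (u : I -> A) : Prop :=
  [/\ [/\ exists i : I, True, forall i, le i i,
          forall i j k, le i j -> le j k -> le i k &
          forall i j, exists k, le i k /\ le j k],
      forall i, cpositive (u i) /\ rnorm (u i) <= 1,
      forall i j, le i j -> cpositive (u j - u i) &
      forall (a : A) (e : R), 0 < e -> exists i, forall k, le i k ->
        rnorm (a - cmul (u k) a) < e /\ rnorm (a - cmul a (u k)) < e].

End cstar_algebra.

Section quantum_metric_space.
Variables (R : realType) (A U M : cstarAlgType R).
Variables (iota : A -> U) (one : U) (j : M -> A) (L : U -> \bar R).

(* [dom L] is the set where [L] is finite. *)
Definition lipschitz_pair : Prop :=
  let dom := [set u | (L u < +oo)%E] in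
  [/\ is_unitization iota one,
      dom `<=` @self_adjoint R U /\ @self_adjoint R U `<=` closure dom,
      forall u, (0 <= L u)%E,
      (forall (t : R) u, dom u -> L (t%:C *: u) = (`|t|%:E * L u)%E) /\
      (forall u v, dom u -> dom v -> (L (u + v)%R <= L u + L v)%E) &
      [set u | L u = 0%E] = [set t%:C *: one | t in [set: R]]].

(* The topography is the abelian C*-subalgebra [j M]. *)
Definition lipschitz_triple : Prop :=
  [/\ lipschitz_pair,
      star_hom j /\ injective j,
      forall f g : M, cmul f g = cmul g f &
      exists (I : Type) (le : I -> I -> Prop) (u : I -> M),
        approximate_unit le (j \o u)].

Definition state_ext (mu : A -> R[i]) : U -> R[i] :=
  unital_ext iota one (mu : A -> (R[i] : lmodType R[i])) 1.

Definition mk (mu nu : A -> R[i]) : \bar R :=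
  ereal_sup [set (rnorm (state_ext mu a - state_ext nu a))%:E
            | a in [set a | self_adjoint a /\ (L a <= 1)%E]].

Definition chiA (K : set {ptws M -> R[i]}) : (A -> R[i]) -> R[i] :=
  bidual_map j (chi K).

Definition compress (K : set {ptws M -> R[i]}) (a : A) :
    (A -> R[i]) -> R[i] :=
  arens (arens (chiA K) (bidual_of a)) (chiA K).

Definition local_state (mu : A -> R[i]) : Prop :=
  state mu /\ exists K, compact_spectrum K /\ chiA K mu = 1.

Definition tail_bound (S : set (A -> R[i])) (mu : A -> R[i])
    (K : set {ptws M -> R[i]}) : \bar R :=
  ereal_sup [set x | exists phi a,
    [/\ S phi, self_adjoint a, (L (iota a) <= 1)%E, mu a = 0 &
        x = (rnorm (phi a - compress K a phi))%:E]].

(* [tail_bound S mu K] tends to 0 along the compact sets [K] *)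
Definition tame (S : set (A -> R[i])) : Prop :=
  exists2 mu, local_state mu &
    forall e : R, 0 < e -> exists2 K0, compact_spectrum K0 &
      forall K, compact_spectrum K -> K0 `<=` K ->
        (tail_bound S mu K <= e%:E)%E.

(* [d] induces on [S] the weak* topology, i.e. that of pointwise convergence *)
Definition metrizes_weak_star (d : (A -> R[i]) -> (A -> R[i]) -> \bar R)
    (S : set (A -> R[i])) : Prop :=
  forall V : set (A -> R[i]), V `<=` S ->
    (exists2 O : set {ptws A -> R[i]}, open O & V = S `&` O) <->
    (forall phi, V phi -> exists2 e : R, 0 < e &
       forall psi, S psi -> (d phi psi < e%:E)%E -> V psi).

Definition locally_compact_qms : Prop :=
  lipschitz_triple /\
  forall S, S `<=` @state R A -> tame S -> metrizes_weak_star mk S.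

End quantum_metric_space.

Definition separable_space (T : topologicalType) : Prop :=
  exists2 D : set T, countable D & dense D.

Section operators.
Variables (R : realType) (H : completeNormedModType R[i]).
Variable ip : {dot H for @Num.conj R[i]}.

(* [ip] is linear in its first argument; with this [H] is a Hilbert space. *)
Definition hilbert_norm : Prop := forall x : H, `|x| ^+ 2 = ip x x.

Definition bounded_op : set (H -> H) :=
  [set T : H -> H | linear T /\ continuous T].

Definition is_adjoint (T T' : H -> H) : Prop :=
  forall x y, ip (T x) y = ip x (T' y).

Definition projection (P : H -> H) : Prop :=
  [/\ bounded_op P, is_adjoint P P & P \o P = P].

Definition square_summable (x : nat -> H) : Prop :=
  cvgn (series (fun n => rnorm (x n) ^+ 2)).

Definition predual : set ((H -> H) -> R[i]) :=
  [set w | exists x y : nat -> H,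
     [/\ square_summable x, square_summable y &
         w = fun T => limn (series (fun n => ip (T (x n)) (y n)))]].

Definition weak_star_closed (V : set (H -> H)) : Prop :=
  V `<=` bounded_op /\
  forall T, bounded_op T ->
    (forall (n : nat) (w : 'I_n -> (H -> H) -> R[i]) (e : R),
       (forall i, predual (w i)) -> 0 < e ->
       exists2 S, V S & forall i, rnorm (w i T - w i S) < e) ->
    V T.

Definition op_subspace (V : set (H -> H)) : Prop :=
  V 0 /\ forall (l : R[i]) S T, V S -> V T -> V (l *: S + T).

Definition op_self_adjoint (V : set (H -> H)) : Prop :=
  forall T T', V T -> bounded_op T' -> is_adjoint T T' -> V T'.

Definition commutant (V : set (H -> H)) : set (H -> H) :=
  [set T | bounded_op T /\ forall S, V S -> T \o S = S \o T].

Definition von_neumann_algebra (N : set (H -> H)) : Prop :=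
  [/\ op_subspace N, op_self_adjoint N, N idfun,
      forall S T, N S -> N T -> N (S \o T) & weak_star_closed N].

(* [m] is the spectral measure of the self-adjoint operator [a] at [x]: the
   compactly supported Borel measure with [ip (p(a) x) x = \int p dm] for all
   polynomials [p]. *)
Definition spectral_measure (a : H -> H) (x : H)
    (m : {finite_measure set R -> \bar R}) : Prop :=
  (exists c : R, m (~` `[- c, c]%classic) = 0%E) /\
  forall n : nat, ip (iter n a x) x = (\int[m]_t (t ^+ n))%R%:C.

(* Borel functional calculus: [f(a)] for [a] self-adjoint and [f] a bounded
   Borel function *)
Definition borel_calculus (f : R -> R) (a : H -> H) : H -> H :=
  xget 0 [set T | bounded_op T /\
    forall x, exists2 m, spectral_measure a x m &
      ip (T x) x = (\int[m]_t f t)%R%:C].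

Definition spectral_projection (E : set R) (a : H -> H) : H -> H :=
  borel_calculus \1_E a.

(* A family [V] indexed by [r >= 0]; its values at negative [r] are ignored. *)
Definition wstar_filtration (V : R -> set (H -> H)) : Prop :=
  [/\ forall r, 0 <= r ->
        [/\ weak_star_closed (V r), op_self_adjoint (V r),
            V r idfun & op_subspace (V r)],
      forall r s S T, 0 <= r -> 0 <= s -> V r S -> V s T ->
        V (r + s) (S \o T) &
      forall r, 0 <= r -> V r = \bigcap_(s in [set s | r < s]) V s].

Definition wstar_quantum_metric (N : set (H -> H)) (V : R -> set (H -> H)) :
    Prop :=
  [/\ von_neumann_algebra N, wstar_filtration V & V 0 = commutant N].

Definition reflexive_filtration (N : set (H -> H)) (V : R -> set (H -> H)) :
    Prop :=
  forall r, 0 <= r ->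
    V r = [set B | bounded_op B /\
      forall P Q, N P -> N Q -> projection P -> projection Q ->
        (forall T, V r T -> P \o T \o Q = 0) -> P \o B \o Q = 0].

Definition representation (A : cstarAlgType R) (rho : A -> H -> H) : Prop :=
  [/\ forall a, bounded_op (rho a),
      linear rho,
      forall a b, rho (cmul a b) = rho a \o rho b &
      forall a, is_adjoint (rho a) (rho (star a))].

Definition nondegenerate_rep (A : cstarAlgType R) (rho : A -> H -> H) : Prop :=
  dense [set z | exists n (a : 'I_n -> A) (x : 'I_n -> H),
                   z = \sum_(i < n) rho (a i) (x i)].

Definition spectral_propagation_le (A U : cstarAlgType R) (iota : A -> U)
    (one : U) (L : U -> \bar R) (rho : A -> H -> H) (T : H -> H) (r : R) :
    Prop :=
  forall u : U, self_adjoint u -> (L u <= 1)%E ->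
    let a := unital_ext iota one rho idfun u in
    spectral_projection `]-oo, 0]%classic a \o T \o
      spectral_projection `]r, +oo[%classic a = 0.

Definition Bstar (A U : cstarAlgType R) (iota : A -> U) (one : U)
    (L : U -> \bar R) (rho : A -> H -> H) (r : R) : set (H -> H) :=
  [set T | bounded_op T /\ spectral_propagation_le iota one L rho T r].

End operators.

(* Main.v *)
(* For a bounded self-adjoint [a], the functionals [p |-> <p(a) x, x>] on real
   polynomials are nonnegative on the products [(c + X)^k (c - X)^l], hence they
   are integrals against measures on an interval (the Hausdorff moment problem,
   solved with Bernstein sums). This makes bounded pointwise limits of
   polynomials, in particular indicators of half-lines, applicable to [a].

   Write [E_t] for the spectral projection of [a] for ]-oo, t]. The Lipschitz
   unit ball is stable under [u |-> u - s] and [u |-> s - u], so propagation at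
   most [r] amounts to [E_s T (1 - E_(s + r)) = 0] for all [s] and all [a] in the
   ball. Products are treated by inserting [E_r + (1 - E_r)] between the factors,
   adjoints by the reflection [s - a] and the right continuity of [t |-> E_t].
   For [r = 0], [T] and its adjoint leave all ranges of the [E_t] invariant, so
   [T] commutes with the [E_t] and therefore with [a]; as Lipschitz elements are
   dense and representations are contractive on self-adjoint elements, [T]
   commutes with [rho A]. The metric is reflexive because the projections that
   define it belong to [rho(A)'']. *)

Require Import Defs.
From HB Require Import structures.
From mathcomp Require Import all_boot all_order all_algebra.
From mathcomp Require Import sesquilinear.
From mathcomp Require Import complex.
From mathcomp Require Import all_classical all_reals all_analysis.
From mathcomp Require Import measurable_realfun pi_irrational.
From mathcomp Require Import ring lra zify.

Set Implicit Arguments.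
Unset Strict Implicit.
Unset Printing Implicit Defensive.

Import Order.TTheory GRing.Theory Num.Theory.
Import numFieldNormedType.Exports.

Local Open Scope classical_set_scope.
Local Open Scope ring_scope.

(** * Positive functionals on polynomials as measures *)

(** Spectral projections are selected by [xget] from a specification through measures, so every use
    of them needs existence and uniqueness. Existence comes from the moment problem, whose solution
    begins with a functional on all bounded functions: an ultralimit, because Bernstein sums of an
    indicator need not converge. Uniqueness comes from polarization, since the moments determine the
    integrals of bounded limits of polynomials. From then on, identities and norm bounds for [f(a)]
    are read off pointwise, as [|f(a) x|^2] is the integral of [f^2].

    No operator-valued integral occurs. Where [a = \int t dE_t] would be invoked, and also where the
    functional is compared with its measure, a function with increments at most
    [C (t - s) (G t - G s)] is shown to be constant by refining a partition.

    Of the half-lines []-oo, 0]] and []r, +oo[] one is closed and one is open. Reflection exchanges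
    the two types, so the reflected relation holds only with a margin [s > r], which right
    continuity removes; the intersection axiom rests on the same limit. *)

Section bernstein.
Context {R : realType}.
Implicit Types (n k j : nat).

(** A factorial moment of the binomial law: ['C(n, k) * 'C(k, j) = 'C(n, j) * 'C(n - j, k - j)], and
    what remains is the expansion of [((1 - Y) + Y) ^+ (n - j)]. *)
Lemma sum_bin_falling (A : comNzRingType) (Y : A) n j : (j <= n)%N ->
  \sum_(k < n.+1) ('C(n, k) * 'C(k, j))%:R * (Y ^+ k * (1 - Y) ^+ (n - k)) =
  'C(n, j)%:R * Y ^+ j.
Proof.
move=> jn.
rewrite -(big_mkord xpredT
  (fun k => ('C(n, k) * 'C(k, j))%:R * (Y ^+ k * (1 - Y) ^+ (n - k)))).
rewrite (big_cat_nat (n := j)) //=; last exact: leqW.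
rewrite big_nat big1 ?add0r; last first.
  by move=> k /andP[_ kj]; rewrite (bin_small kj) muln0 mul0r.
rewrite -{1}[j]add0n big_addn subSn// big_mkord.
have -> : Y ^+ j = Y ^+ j * ((1 - Y) + Y) ^+ (n - j).
  by rewrite subrK expr1n mulr1.
rewrite exprDn mulr_sumr mulr_sumr; apply: eq_bigr => i _.
have ij : (i <= n - j)%N by rewrite -ltnS.
have -> : ('C(n, i + j) * 'C(i + j, j) = 'C(n, j) * 'C(n - j, i))%N.
  have e : (i + j <= n)%N by move: ij jn; lia.
  apply/eqP; rewrite -(eqn_pmul2r (fact_gt0 j)) -(eqn_pmul2r (fact_gt0 i)).
  rewrite -(eqn_pmul2r (fact_gt0 (n - (i + j)))); apply/eqP.
  transitivity n`!.
    rewrite -(bin_fact e) -(bin_fact (leq_addl i j)) addnK.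
    by rewrite -!mulnA; congr (_ * _)%N; ring.
  rewrite -(bin_fact jn) -(bin_fact ij).
  by rewrite -!mulnA subnDA subnAC; ring.
rewrite natrM (addnC i j) exprD subnDA -[in RHS]mulr_natr; ring.
Qed.

(** The ratio is the product of the factors [(k - i) / (n - i)] for [i < j]. Each is within
    [i / (n - i)] of [k / n] and all lie in [[0, 1]], so the errors add. *)
Lemma bin_ratio_approx n k j : (j < n)%N -> (k <= n)%N ->
  `|'C(k, j)%:R / 'C(n, j)%:R - (k%:R / n%:R) ^+ j| <=
    (j ^ 2)%:R / (n - j)%:R :> R.
Proof.
elim: j => [|j IH] jn kn; first by rewrite !bin0 divr1 subrr normr0 mul0r.
have {}IH := IH (ltnW jn) kn.
have Cn : 0 < 'C(n, j)%:R :> R by rewrite ltr0n bin_gt0 ltnW// ltnW.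
have nj : 0 < (n - j)%:R :> R by rewrite ltr0n subn_gt0 ltnW.
have n0 : 0 < n%:R :> R by rewrite ltr0n (leq_trans _ jn).
have nj1 : 0 < (n - j.+1)%:R :> R by rewrite ltr0n subn_gt0.
pose u : R := 'C(k, j)%:R / 'C(n, j)%:R; pose v : R := (k%:R / n%:R) ^+ j.
rewrite -/u -/v in IH.
have u01 : 0 <= u <= 1.
  by rewrite divr_ge0//= ler_pdivrMr// mul1r ler_nat leq_bin2l.
pose w : R := (k - j)%:R / (n - j)%:R.
have Cn1 : 0 < 'C(n, j.+1)%:R :> R by rewrite ltr0n bin_gt0 ltnW.
have j1 : 0 < j.+1%:R :> R by rewrite ltr0n.
have -> : 'C(k, j.+1)%:R / 'C(n, j.+1)%:R = u * w.
  rewrite /u /w mulf_div -!natrM mulnC -mul_bin_left (mulnC 'C(n, j)).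
  by rewrite -mul_bin_left !natrM -mulf_div divff ?mul1r// gt_eqF.
pose x : R := k%:R / n%:R.
have x01 : 0 <= x <= 1 by rewrite divr_ge0//= ler_pdivrMr// mul1r ler_nat.
rewrite exprS -/v -/x.
have -> : u * w - x * v = u * (w - x) + (u - v) * x by ring.
have uwx : `|u * (w - x)| <= j%:R / (n - j)%:R.
  (* For [k < j] the difference in [w] is truncated, but then [u = 0]. *)
  case: (ltnP k j) => kj.
    by rewrite /u bin_small// !mul0r normr0 divr_ge0.
  have wx : `|w - x| <= j%:R / (n - j)%:R.
    rewrite distrC ger0_norm; last first.
      rewrite subr_ge0 /w /x ler_pdivrMr// mulrAC ler_pdivlMr// -!natrM ler_nat.
      by rewrite mulnBl mulnBr leq_sub2l// mulnC leq_mul2l kn orbT.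
    rewrite /w /x !natrB//; last by rewrite ltnW// ltnW.
    have nj' : 0 < n%:R - j%:R :> R by rewrite -natrB// ltnW// ltnW.
    have -> : k%:R / n%:R - (k%:R - j%:R) / (n%:R - j%:R) =
      j%:R / (n%:R - j%:R) * (1 - k%:R / n%:R) :> R.
      by field; rewrite !gt_eqF.
    by rewrite ler_piMr ?divr_ge0 ?(ltW nj')// gerBl divr_ge0.
  rewrite normrM ger0_norm; last by case/andP: u01.
  by apply: le_trans wx; rewrite ler_piMl//; case/andP: u01.
apply: (le_trans (ler_normD _ _)).
have uvx : `|(u - v) * x| <= (j ^ 2)%:R / (n - j)%:R.
  rewrite normrM (ger0_norm (proj1 (andP x01))); apply: le_trans IH.
  by rewrite ler_piMr//; case/andP: x01.
apply: (le_trans (lerD uwx uvx)).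
rewrite -mulrDl -natrD ler_pM ?invr_ge0//.
  by rewrite ler_nat -!mulnn mulSn mulnS leq_addl.
by rewrite lef_pV2 ?posrE// ler_nat leq_sub2l.
Qed.

Variables (phi : {scalar {poly R}}) (Y : {poly R}).
Hypothesis phi_ge0 : forall k l, 0 <= phi (Y ^+ k * (1 - Y) ^+ l).

(** The functional applied to a Bernstein basis polynomial in [Y]: the mass put on the node
    [k / n]. *)
Definition bernstein_weight n k : R :=
  'C(n, k)%:R * phi (Y ^+ k * (1 - Y) ^+ (n - k)).

Lemma bernstein_weight_ge0 n k : 0 <= bernstein_weight n k.
Proof. by rewrite mulr_ge0. Qed.

Lemma bernstein_falling n j : (j <= n)%N ->
  \sum_(k < n.+1) 'C(k, j)%:R / 'C(n, j)%:R * bernstein_weight n k =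
  phi (Y ^+ j).
Proof.
move=> jn; have Cn : 'C(n, j)%:R != 0 :> R by rewrite pnatr_eq0 -lt0n bin_gt0.
apply: (mulfI Cn); rewrite mulr_sumr.
have -> : 'C(n, j)%:R * phi (Y ^+ j) = phi ('C(n, j)%:R * Y ^+ j).
  by rewrite mulr_natl mulr_natl linearMn.
rewrite -(sum_bin_falling Y jn) linear_sum; apply: eq_bigr => k _.
rewrite [RHS](_ : _ = ('C(n, k) * 'C(k, j))%:R *
   phi (Y ^+ k * (1 - Y) ^+ (n - k))); last first.
  by rewrite mulr_natl mulr_natl linearMn.
by rewrite /bernstein_weight natrM; field.
Qed.

Lemma bernstein_weight_sum n : \sum_(k < n.+1) bernstein_weight n k = phi 1.
Proof.
rewrite -(expr0 Y) -(bernstein_falling (leq0n n)); apply: eq_bigr => k _.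
by rewrite !bin0 divr1 mul1r.
Qed.

(** Factorial moments of the weights are exact; for a monomial, the ordinary moment differs from
    them by [O(1 / n)] times the total mass [phi 1]. *)
Lemma cvg_bernstein (r : {poly R}) :
  \sum_(k < n.+1) r.[k%:R / n%:R] * bernstein_weight n k @[n --> \oo] -->
  phi (r \Po Y).
Proof.
suff H j : \sum_(k < n.+1) (k%:R / n%:R) ^+ j * bernstein_weight n k
    @[n --> \oo] --> phi (Y ^+ j).
  rewrite comp_polyE linear_sum.
  rewrite (_ : (fun n => _) = (fun n => \sum_(j < size r) r`_j *
      \sum_(k < n.+1) (k%:R / n%:R) ^+ j * bernstein_weight n k)).
    apply: cvg_big => //= [|j _]; first exact: add_continuous.
    by rewrite linearZ /=; exact: cvgMr.
  apply/funext => n; under eq_bigr do rewrite horner_coef mulr_suml.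
  rewrite exchange_big/=; apply: eq_bigr => j _; rewrite mulr_sumr.
  by apply: eq_bigr => k _; rewrite -mulrA.
have phi1 : 0 <= phi 1 by have := phi_ge0 0 0; rewrite !expr0 mulr1.
apply/cvgrPdist_le => e e0; near=> n.
have jn : (j < n)%N by near: n; exists j.+1.
rewrite -(bernstein_falling (ltnW jn)) -sumrB.
apply: (le_trans (ler_norm_sum _ _ _)).
apply: (@le_trans _ _ (\sum_(k < n.+1)
    (j ^ 2)%:R / (n - j)%:R * bernstein_weight n k)).
  apply: ler_sum => k _; rewrite -mulrBl normrM.
  rewrite (ger0_norm (bernstein_weight_ge0 _ _)) ler_wpM2r //.
    exact: bernstein_weight_ge0.
  by apply: bin_ratio_approx => //; rewrite -ltnS.
rewrite -mulr_sumr bernstein_weight_sum.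
have nj : 0 < (n - j)%:R :> R by rewrite ltr0n subn_gt0.
rewrite mulrAC ler_pdivrMr//.
have : (j ^ 2)%:R * phi 1 / e <= (n - j)%:R.
  rewrite natrB ?(ltnW jn)// lerBrDr.
  by near: n; exact: nbhs_infty_ger.
by rewrite ler_pdivrMr// (mulrC e).
Unshelve. all: by end_near.
Qed.

End bernstein.

(** * Limits of bounded real sequences along an ultrafilter *)

Section ultralimit.
Context {R : realType}.

Lemma ultra_fmap {S T : Type} (f : S -> T) (F : set_system S) :
  UltraFilter F -> UltraFilter (f @ F).
Proof.
move=> FU; split; first exact: fmap_proper_filter.
move=> G GF sFG; apply/seteqP; split=> A; last exact: sFG.
move=> GA; have [//|FA] := in_ultra_setVsetC (f @^-1` A) FU.
have /filter_ex [? []] : G (A `&` ~` A) by apply: filterI => //; exact: sFG.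
by [].
Qed.

Variable U : set_system nat.
Hypotheses (U_ultra : UltraFilter U) (U_oo : \oo `<=` U).

(** Along an ultrafilter finer than [\oo] every bounded sequence converges, and the limit stays
    linear and positive. *)
Definition ulim (u : nat -> R) : R := lim (u @ U).

Lemma cvg_ulim (u : nat -> R) (K : R) : (forall n, `|u n| <= K) -> u @ U --> ulim u.
Proof.
move=> uK; have Uu := ultra_fmap u U_ultra.
have : compact `[- K, K]%classic by exact: segment_compact.
rewrite compact_ultra => /(_ _ Uu) [].
  apply: (@filterE _ U) => n /=; rewrite in_itv/= -ler_norml; exact: uK.
by move=> l [_ ul]; apply/cvg_ex; exists l.
Qed.

Lemma ulim_unique (u : nat -> R) (l : R) : u @ U --> l -> ulim u = l.
Proof. by move/cvg_lim; apply; exact: Rhausdorff. Qed.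

Lemma ulim_cvg (u : nat -> R) (l : R) : u @ \oo --> l -> ulim u = l.
Proof. by move=> ul; apply: ulim_unique => A /ul; exact: U_oo. Qed.

Lemma ulim_ge0 (u : nat -> R) (K : R) : (forall n, `|u n| <= K) ->
  (forall n, 0 <= u n) -> 0 <= ulim u.
Proof.
move=> uK u0; apply: (@closed_cvg _ _ U _ u (fun x => 0 <= x) _ _ _ (cvg_ulim uK)).
  exact: closed_ge.
exact: filterE.
Qed.

Lemma ulim_lin (u v : nat -> R) (K K' k : R) : (forall n, `|u n| <= K) ->
  (forall n, `|v n| <= K') -> ulim (fun n => u n + k * v n) = ulim u + k * ulim v.
Proof.
move=> /cvg_ulim uu /cvg_ulim vv; apply: ulim_unique.
by apply: cvgD => //; exact: cvgMr.
Qed.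

Lemma ler_norm_ulim (u : nat -> R) (K : R) : (forall n, `|u n| <= K) ->
  `|ulim u| <= K.
Proof.
move=> uK.
apply: (@closed_cvg _ _ U _ u (fun x => `|x| <= K) _ _ _ (cvg_ulim uK)); last first.
  exact: filterE.
have -> : (fun x : R => `|x| <= K : Prop) = `[- K, K]%classic.
  by apply/funext => x /=; rewrite in_itv/= -ler_norml.
exact: itv_closed.
Qed.

End ultralimit.

(** One constant is both a bound and a Lipschitz constant, so that the induction on [p * 'X + a]
    closes. *)
Lemma poly_lipschitz {R : realType} (p : {poly R}) (c : R) :
  exists2 C : R, 0 <= C & forall s t : R, `|s| <= c -> `|t| <= c ->
    `|p.[s]| <= C /\ `|p.[s] - p.[t]| <= C * `|s - t|.
Proof.
elim/poly_ind: p => [|p a [C C0 IH]].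
  by exists 0 => // s t _ _; rewrite !horner0 subr0 normr0 mul0r.
exists (C * `|c| + C + `|a|); first by rewrite !addr_ge0// mulr_ge0.
move=> s t sc tc; rewrite !hornerE; have [Cs Cst] := IH s t sc tc.
have sc' : `|s| <= `|c| by rewrite (le_trans sc)// ler_norm.
have tc' : `|t| <= `|c| by rewrite (le_trans tc)// ler_norm.
split.
  rewrite (le_trans (ler_normD _ _))// lerD2r normrM.
  by rewrite (le_trans (ler_pM _ _ Cs sc'))// lerDl.
have -> : p.[s] * s + a - (p.[t] * t + a) = p.[s] * (s - t) + (p.[s] - p.[t]) * t.
  by ring.
rewrite (le_trans (ler_normD _ _))// !normrM.
have h1 : `|p.[s]| * `|s - t| <= C * `|s - t| by rewrite ler_wpM2r.
have h2 : `|p.[s] - p.[t]| * `|t| <= C * `|s - t| * `|c| by rewrite ler_pM.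
apply: (le_trans (lerD h1 h2)); rewrite !mulrDl.
have h3 : 0 <= `|a| * `|s - t| by rewrite mulr_ge0.
by rewrite (mulrAC C `|s - t|); lra.
Qed.

(** * Positive functionals extended from polynomials to bounded functions *)

Section positive_extension.
Context {R : realType}.
Variables (c : R) (phi : {scalar {poly R}}).
Hypothesis c_gt0 : 0 < c.
Hypothesis phi_ge0 :
  forall k l, 0 <= phi ((c%:P + 'X) ^+ k * (c%:P - 'X) ^+ l).
Variable U : set_system nat.
Hypotheses (U_ultra : UltraFilter U) (U_oo : \oo `<=` U).

(** The affine map from [[- c, c]] onto [[0, 1]]; [node n k] is the point where it equals
    [k / n]. *)
Let Y : {poly R} := (2 * c)^-1 *: (c%:P + 'X).

Let Y_ge0 k l : 0 <= phi (Y ^+ k * (1 - Y) ^+ l).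
Proof.
have c2 : 2 * c != 0 by rewrite mulf_neq0// gt_eqF.
have -> : 1 - Y = (2 * c)^-1 *: (c%:P - 'X).
  apply: (scalerI c2); rewrite scalerBr /Y !scalerA mulfV// !scale1r.
  by rewrite alg_polyC mulrDl mul1r polyCD opprD addrA addrK.
rewrite /Y !exprZn -scalerAl -scalerAr !linearZ/= !mulr_ge0// exprn_ge0//;
  by rewrite invr_ge0 mulr_ge0// ltW.
Qed.

Let node n k : R := 2 * c * (k%:R / n%:R) - c.
Let w n k := bernstein_weight phi Y n k.

Let node_itv n k : (k <= n)%N -> `|node n k| <= c.
Proof.
move=> kn; have [] : 0 <= k%:R / n%:R :> R /\ k%:R / n%:R <= 1 :> R.
  split; first by rewrite divr_ge0.
  case: n kn => [|n] kn; first by rewrite invr0 mulr0.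
  by rewrite ler_pdivrMr ?ltr0n// mul1r ler_nat.
move=> h0 h1; rewrite ler_norml /node.
have := mulr_ge0 (ltW c_gt0) h0.
have : c * (k%:R / n%:R) <= c by rewrite ler_piMr// ltW.
by rewrite -mulrA; lra.
Qed.

Let sum n (f : R -> R) := \sum_(k < n.+1) f (node n k) * w n k.

Let w_ge0 n k : 0 <= w n k. Proof. exact: (bernstein_weight_ge0 Y_ge0). Qed.

Let sumB n (f : R -> R) (K : R) : (forall t, `|t| <= c -> `|f t| <= K) ->
  `|sum n f| <= K * phi 1.
Proof.
move=> fK; rewrite (le_trans (ler_norm_sum _ _ _))//.
rewrite -(bernstein_weight_sum phi Y n) mulr_sumr ler_sum// => k _.
rewrite normrM (ger0_norm (w_ge0 _ _)).
apply: ler_wpM2r; first exact: w_ge0.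
by apply: fK; apply: node_itv; rewrite -ltnS.
Qed.

Let L0 (f : R -> R) := ulim U (sum ^~ f).

Let L0_lin (f g : R -> R) (K K' k : R) : (forall t, `|t| <= c -> `|f t| <= K) ->
  (forall t, `|t| <= c -> `|g t| <= K') ->
  L0 (fun t => f t + k * g t) = L0 f + k * L0 g.
Proof.
move=> fK gK; rewrite -(ulim_lin U_ultra _ (K := K * phi 1) (K' := K' * phi 1)).
- congr ulim; apply/funext => n; rewrite mulr_sumr -big_split; apply: eq_bigr.
  by move=> i _ /=; rewrite mulrDl mulrA.
- by move=> n; exact: sumB.
- by move=> n; exact: sumB.
Qed.

Let L0_ge0 (f : R -> R) (K : R) : (forall t, `|t| <= c -> `|f t| <= K) ->
  (forall t, `|t| <= c -> 0 <= f t) -> 0 <= L0 f.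
Proof.
move=> fK f0; apply: (@ulim_ge0 _ _ U_ultra _ (K * phi 1)).
  by move=> n; exact: sumB.
move=> n; apply: sumr_ge0 => k _; rewrite mulr_ge0// f0// node_itv//.
by rewrite -ltnS.
Qed.

Let L0B (f : R -> R) (K : R) : (forall t, `|t| <= c -> `|f t| <= K) ->
  `|L0 f| <= K * phi 1.
Proof. by move=> fK; apply: (ler_norm_ulim U_ultra) => n; exact: sumB. Qed.

Let L0_poly (p : {poly R}) : L0 (horner p) = phi p.
Proof.
apply: ulim_cvg => //.
(* The inverse of [Y]: the value of [p \Po Z] at [k / n] is that of [p] at the node. *)
pose Z : {poly R} := (2 * c) *: 'X - c%:P.
have ZY : Z \Po Y = 'X.
  rewrite /Z comp_polyB comp_polyZ comp_polyX comp_polyC /Y scalerA mulfV.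
    by rewrite scale1r addrC addKr.
  by rewrite mulf_neq0// gt_eqF.
have := @cvg_bernstein _ phi _ Y_ge0 (p \Po Z).
rewrite -comp_polyA ZY comp_polyXr.
set u := fun n => _; suff -> : sum ^~ (horner p) = u by [].
apply/funext => n; apply: eq_bigr => k _; congr (_ * _).
by rewrite horner_comp /Z /node !hornerE.
Qed.

Let delta j : R := j.+1%:R^-1.

Let delta01 j : 0 < delta j <= 1.
Proof. by rewrite invr_gt0 ltr0n/= invf_le1// ler1n. Qed.

Let shift_itv j t : `|t| <= c -> `|t - delta j| <= c + 1.
Proof.
by have := delta01 j => /andP[? ?]; rewrite !ler_norml => /andP[? ?]; lra.
Qed.

(* The shift makes [t |-> L (\1_(<= t))] right-continuous without changing [L]
   on polynomials. *)
Let L (f : R -> R) := ulim U (fun j => L0 (fun t => f (t - delta j))).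

Let L_lin (f g : R -> R) (K K' k : R) : (forall t, `|t| <= c + 1 -> `|f t| <= K) ->
  (forall t, `|t| <= c + 1 -> `|g t| <= K') ->
  L (fun t => f t + k * g t) = L f + k * L g.
Proof.
move=> fK gK; rewrite -(ulim_lin U_ultra _ (K := K * phi 1) (K' := K' * phi 1)).
- congr ulim; apply/funext => n; apply: (L0_lin (K := K) (K' := K')) => t tc.
    exact/fK/shift_itv.
  exact/gK/shift_itv.
- by move=> n; apply: L0B => t tc; exact/fK/shift_itv.
- by move=> n; apply: L0B => t tc; exact/gK/shift_itv.
Qed.

Let L_ge0 (f : R -> R) (K : R) : (forall t, `|t| <= c + 1 -> `|f t| <= K) ->
  (forall t, `|t| <= c + 1 -> 0 <= f t) -> 0 <= L f.
Proof.
move=> fK f0; apply: (@ulim_ge0 _ _ U_ultra _ (K * phi 1)).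
  by move=> n; apply: L0B => t tc; exact/fK/shift_itv.
move=> n; apply: (@L0_ge0 _ K) => t tc; first exact/fK/shift_itv.
exact/f0/shift_itv.
Qed.

Let L_poly (p : {poly R}) : L (horner p) = phi p.
Proof.
apply: ulim_cvg => //.
have [C C0 pC] := poly_lipschitz p (c + 1).
have cc (t : R) : `|t| <= c -> `|t| <= c + 1 by move=> /le_trans; apply; rewrite lerDl.
have h j : `|L0 (fun t => p.[t - delta j]) - phi p| <= C * delta j * phi 1.
  rewrite -L0_poly -[X in _ + X]mulN1r -(L0_lin (K := C) (K' := C)); last 2 first.
  - by move=> t tc; have [] := pC _ (t - delta j) (shift_itv j tc) (shift_itv j tc).
  - by move=> t tc; have [] := pC t t (cc t tc) (cc t tc).
  apply: L0B => t tc; rewrite mulN1r.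
  have [_] := pC _ t (shift_itv j tc) (cc _ tc).
  rewrite (_ : t - delta j - t = - delta j); last by ring.
  by have /andP[d0 _] := delta01 j; rewrite normrN (gtr0_norm d0).
have phi1 : 0 <= phi 1 by have := phi_ge0 0 0; rewrite !expr0 mulr1.
apply/cvgrPdist_le => e e0; near=> j; rewrite distrC (le_trans (h j))//.
rewrite mulrAC /delta ler_pdivrMr ?ltr0n// (mulrC e) -ler_pdivrMr//.
near: j; exists (Num.truncn (C * phi 1 / e)) => //= j nj.
by rewrite ltW// (lt_le_trans (truncnS_gt _))// ler_nat ltnS.
Unshelve. all: by end_near.
Qed.

Let ind t : R -> R := \1_`]-oo, t]%classic.

Let ind_le1 t s : `|ind t s| <= 1.
Proof. by rewrite ger0_norm// /ind indicE; case: (_ \in _). Qed.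

Let ind_le s t u : s <= t -> ind s u <= ind t u.
Proof.
move=> st; rewrite /ind !indicE !mem_setE !in_itv/=.
by case: (leP u s) => us; rewrite ?ler01 // (le_trans us st).
Qed.

Let L0_ind_le s t : s <= t -> L0 (ind s) <= L0 (ind t).
Proof.
move=> st; rewrite -subr_ge0 -[X in _ + X]mulN1r.
rewrite -(L0_lin (K := 1) (K' := 1))//.
apply: (@L0_ge0 _ 2) => u _; rewrite mulN1r.
  rewrite (le_trans (ler_normB _ _))//.
  by rewrite (le_trans (lerD (ind_le1 _ _) (ind_le1 _ _))).
by rewrite subr_ge0 ind_le.
Qed.

Let L_ind t : L (ind t) = ulim U (fun j => L0 (ind (t + delta j))).
Proof.
congr ulim; apply/funext => j; congr L0; apply/funext => s.
by rewrite /ind !indicE !mem_setE !in_itv/= lerBlDr.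
Qed.

(** [L (ind t)] is the limit of the monotone values [L0 (ind (t + delta j))]. Once one of them is
    within [e], every [s < t + delta j] has [s + delta i <= t + delta j] for large [i]. *)
Let L_ind_right_cont (t e : R) : 0 < e ->
  exists2 d, 0 < d & forall s, t < s < t + d -> L (ind s) <= L (ind t) + e.
Proof.
move=> e0.
have ub s j : `|L0 (ind (s + delta j))| <= 1 * phi 1.
  by apply: L0B => u _; exact: ind_le1.
have := cvg_ulim U_ultra (ub t); rewrite -L_ind.
move=> /cvgrPdist_le/(_ _ e0)/filter_ex[j tj].
exists (delta j); first by case/andP: (delta01 j).
move=> s /andP[ts st]; apply: (@le_trans _ _ (L0 (ind (t + delta j)))); last first.
  by move: tj; rewrite distrC => /ler_normlP[_]; rewrite lerBlDl addrC.
rewrite L_ind; apply: (@closed_cvg _ _ U _ _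
  (fun x => x <= L0 (ind (t + delta j))) _ _ _ (cvg_ulim U_ultra (ub s))).
  exact: closed_le.
apply: U_oo; near=> i; apply: L0_ind_le; rewrite -lerBrDl.
have p : 0 < t + delta j - s by rewrite subr_gt0.
rewrite -[leRHS]invrK /delta lef_pV2 ?posrE ?invr_gt0 ?ltr0n//.
near: i; exists (Num.truncn (t + delta j - s)^-1) => //= i ni.
by rewrite ltW// (lt_le_trans (truncnS_gt _))// ler_nat ltnS.
Unshelve. all: by end_near.
Qed.

Lemma positive_extension_ultra : exists L : (R -> R) -> R,
  [/\ forall (f g : R -> R) (K K' k : R), (forall t, `|t| <= c + 1 -> `|f t| <= K) ->
        (forall t, `|t| <= c + 1 -> `|g t| <= K') ->
        L (fun t => f t + k * g t) = L f + k * L g,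
      forall (f : R -> R) (K : R), (forall t, `|t| <= c + 1 -> `|f t| <= K) ->
        (forall t, `|t| <= c + 1 -> 0 <= f t) -> 0 <= L f,
      forall p : {poly R}, L (horner p) = phi p &
      forall t e : R, 0 < e -> exists2 d, 0 < d & forall s, t < s < t + d ->
        L \1_`]-oo, s]%classic <= L \1_`]-oo, t]%classic + e].
Proof.
exists L; split; [exact: L_lin|exact: L_ge0|exact: L_poly|].
exact: L_ind_right_cont.
Qed.

End positive_extension.

Lemma positive_extension {R : realType} (c : R) (phi : {scalar {poly R}}) :
  0 < c ->
  (forall k l, 0 <= phi ((c%:P + 'X) ^+ k * (c%:P - 'X) ^+ l)) ->
  exists L : (R -> R) -> R,
  [/\ forall (f g : R -> R) (K K' k : R), (forall t, `|t| <= c + 1 -> `|f t| <= K) ->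
        (forall t, `|t| <= c + 1 -> `|g t| <= K') ->
        L (fun t => f t + k * g t) = L f + k * L g,
      forall (f : R -> R) (K : R), (forall t, `|t| <= c + 1 -> `|f t| <= K) ->
        (forall t, `|t| <= c + 1 -> 0 <= f t) -> 0 <= L f,
      forall p : {poly R}, L (horner p) = phi p &
      forall t e : R, 0 < e -> exists2 d, 0 < d & forall s, t < s < t + d ->
        L \1_`]-oo, s]%classic <= L \1_`]-oo, t]%classic + e].
Proof.
move=> c0 phi0; have [U [UU ooU]] := ultraFilterLemma eventually_filter.
exact: positive_extension_ultra.
Qed.

Lemma eq_of_le_div {R : realType} (x M : R) :
  0 <= x -> (forall n : nat, x <= M / n.+1%:R) -> x = 0.
Proof.
move=> x0 xM; apply/eqP; rewrite eq_le x0 andbT leNgt; apply/negP => xp.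
have := xM (Num.truncn (M / x)); rewrite ler_pdivlMr ?ltr0n// mulrC.
by rewrite -ler_pdivlMr// leNgt truncnS_gt.
Qed.

(** On [n + 1] equal pieces the bounds add up to [C * (b - a) * (G b - G a) / (n + 1)]. This serves
    to compare a functional with its measure, and again for commutators; [G] is built from
    distribution functions. *)
Lemma increment_le_const {R : realType} (D G : R -> R) (C a b : R) : a <= b ->
  (forall s t, a <= s -> s <= t -> t <= b ->
    `|D t - D s| <= C * (t - s) * (G t - G s)) -> D b = D a.
Proof.
move=> ab H; apply/eqP; rewrite -subr_eq0 -normr_eq0; apply/eqP.
apply: (@eq_of_le_div _ _ (C * (b - a) * (G b - G a))) => // n.
pose h := (b - a) / n.+1%:R; pose u i := a + h * i%:R.
have h0 : 0 <= h by rewrite divr_ge0// subr_ge0.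
have u0 : u 0 = a by rewrite /u mulr0 addr0.
have un : u n.+1 = b by rewrite /u /h divfK ?pnatr_eq0// addrC subrK.
have uS i : u i.+1 - u i = h by rewrite /u -natr1; ring.
rewrite -{1}un -{1}u0.
have -> : D (u n.+1) - D (u 0%N) = \sum_(0 <= i < n.+1) (D (u i.+1) - D (u i)).
  by rewrite (telescope_sumr (D \o u)).
rewrite (le_trans (ler_norm_sum _ _ _))//.
have -> : C * (b - a) * (G b - G a) / n.+1%:R =
    \sum_(0 <= i < n.+1) C * h * (G (u i.+1) - G (u i)).
  by rewrite -mulr_sumr (telescope_sumr (G \o u))//= un u0 /h; ring.
rewrite !big_nat ler_sum// => i /andP[_ ni]; rewrite -(uS i); apply: H.
- by rewrite /u lerDl mulr_ge0.
- by rewrite -subr_ge0 uS.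
- by rewrite -un /u lerD2l ler_wpM2l// ler_nat.
Qed.

(** * Measures with a given distribution function *)

Section cdf_measure.
Context {R : realType}.
Implicit Types G : R -> R.

Section normalized.
Variables (F : R -> R) (d : R).
Hypothesis F_nd : nondecreasing F.
Hypothesis F_rc : forall x, F y @[y --> x^'+] --> F x.
Hypothesis F0 : forall t : R, t < - d -> F t = 0.
Hypothesis F1 : forall t : R, d <= t -> F t = 1.

Let F_Ny : F @ -oo --> (0 : R).
Proof.
apply: cvg_near_cst; near=> t; apply: F0.
by near: t; apply: nbhs_ninfty_lt; exact: num_real.
Unshelve. all: by end_near.
Qed.

Let F_y : F @ +oo --> (1 : R).
Proof.
apply: cvg_near_cst; near=> t; apply: F1.
by near: t; apply: nbhs_pinfty_ge; exact: num_real.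
Unshelve. all: by end_near.
Qed.

HB.instance Definition _ := isCumulative.Build R _ R F F_nd F_rc.
HB.instance Definition _ := isCumulativeBounded.Build R 0 1 F F_Ny F_y.

(** The law of this identity is the Lebesgue-Stieltjes measure of [F], typed as a finite measure on
    [R]. *)
Let idTR : measurableTypeR R -> R := idfun.

HB.instance Definition _ :=
  @isMeasurableFun.Build _ _ _ _ idTR (@measurable_id _ _ setT).

Lemma normalized_cdf_measure : exists m : {finite_measure set R -> \bar R},
  forall t, m `]-oo, t]%classic = (F t)%:E.
Proof.
exists (distribution (lebesgue_stieltjes_measure F)
  (idTR : {RV (lebesgue_stieltjes_measure F) >-> R})).
exact: cdf_lebesgue_stieltjes_id.
Qed.

End normalized.

Lemma cdf_measure (G : R -> R) (K d : R) : nondecreasing G ->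
  (forall t e : R, 0 < e ->
    exists2 r, 0 < r & forall s, t < s < t + r -> G s <= G t + e) ->
  (forall t : R, t < - d -> G t = 0) -> (forall t : R, d <= t -> G t = K) ->
  0 <= K ->
  exists m : {finite_measure set R -> \bar R},
    forall t, m `]-oo, t]%classic = (G t)%:E.
Proof.
move=> G_nd G_rc G0 GK; rewrite le_eqVlt => /predU1P[K0|K0].
  (* Without mass, monotonicity squeezes [G] between its zero values far to the left and far to the
     right; otherwise [G] is divided by [K]. *)
  exists mzero => t; congr EFin; apply/eqP; rewrite eq_le.
  have h1 : G (Num.min t (- d) - 1) <= G t.
    by apply: G_nd; rewrite lerBlDr ge_min lerDl ler01.
  have h2 : G t <= G (Num.max t d) by apply: G_nd; rewrite le_max lexx.
  move: h1 h2; rewrite G0; last by rewrite ltrBlDr gt_min ltrDl ltr01 orbT.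
  by rewrite (GK (Num.max t d)) -?K0 ?le_max ?lexx ?orbT// => -> ->.
pose F t := G t / K.
have [m mF] : exists m : {finite_measure set R -> \bar R},
  forall t, m `]-oo, t]%classic = (F t)%:E.
  apply: (@normalized_cdf_measure _ d).
  - by move=> s t st; rewrite ler_pM2r ?invr_gt0// G_nd.
  - move=> t; apply/cvgrPdist_le => e e0.
    have [r r0 rG] := G_rc t (e * K) (mulr_gt0 e0 K0).
    near=> s; have ts : t < s by near: s; exact: nbhs_right_gt.
    have sr : s < t + r by near: s; apply: nbhs_right_lt; rewrite ltrDl.
    rewrite distrC /F -mulrBl ger0_norm; last first.
      by rewrite divr_ge0 ?(ltW K0)// subr_ge0 G_nd// ltW.
    by rewrite ler_pdivrMr// lerBlDl rG// ts sr.
  - by move=> t td; rewrite /F G0// mul0r.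
  - by move=> t td; rewrite /F GK// divff// gt_eqF.
exists (mscale (NngNum (ltW K0)) m) => t.
rewrite -[LHS]/(K%:E * m `]-oo, t]%classic)%E mF -EFinM /F.
by rewrite mulrC divfK// gt_eqF.
Unshelve. all: by end_near.
Qed.

End cdf_measure.

Lemma bounded_integrable {R : realType} (m : {finite_measure set R -> \bar R})
    (A : set R) (f : R -> R) (K : R) : measurable A -> measurable_fun setT f ->
  (forall x, A x -> `|f x| <= K) -> m.-integrable A (EFin \o f).
Proof.
move=> mA mf fK; apply: measurable_bounded_integrable => //.
- by rewrite -ge0_fin_numE ?fin_num_measure.
- exact: measurable_funTS.
- exists K; split; first exact: num_real.
  by move=> M KM x Ax; apply: (le_trans (fK _ Ax)); exact: ltW.
Qed.

Lemma Rintegral_support {R : realType} (m : {finite_measure set R -> \bar R})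
    (A : set R) (f : R -> R) : measurable A -> measurable_fun setT f ->
  m (~` A) = 0%E -> \int[m]_x f x = \int[m]_(x in A) f x.
Proof.
move=> mA mf mA0; rewrite [RHS]Rintegral_mkcond; congr fine.
apply: ae_eq_integral => //; first exact/measurable_EFinP.
  apply/measurable_EFinP; apply/(measurable_restrictT f mA).
  exact: measurable_funTS.
exists (~` A); split => //; first exact: measurableC.
move=> x /= + Ax; apply=> _; rewrite /patch mem_set//.
Qed.

(** On []s, t]] the function stays within [C * (t - s)] of [f s]; this is the first-order estimate
    on the side of the measure. *)
Lemma integral_itv_approx {R : realType} (m : {finite_measure set R -> \bar R})
    (f : R -> R) (C s t : R) : s <= t -> measurable_fun setT f -> 0 <= C ->
  (forall x, s <= x <= t -> `|f x - f s| <= C * (x - s)) ->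
  `| \int[m]_(x in `]s, t]) f x - f s * fine (m `]s, t]%classic)| <=
    C * (t - s) * fine (m `]s, t]%classic).
Proof.
move=> st mf C0 fC.
have fB x : `]s, t]%classic x -> `|f x - f s| <= C * (t - s).
  rewrite /= in_itv/= => /andP[sx xt].
  rewrite (le_trans (fC _ _)) ?(ltW sx)//.
  by rewrite ler_wpM2l// lerB.
rewrite -!Rintegral_cst// -RintegralB//; last 2 first.
- apply: (@bounded_integrable _ _ _ _ (`|f s| + C * (t - s))) => // x /fB fx.
  by rewrite -[f x](subrK (f s)) (le_trans (ler_normD _ _))// addrC lerD2l.
- exact: (@bounded_integrable _ _ _ _ `|f s|).
have mB : measurable_fun setT (fun x => f x - f s).
  by apply: measurable_funD => //; exact: measurable_cst.
rewrite (le_trans (le_normr_Rintegral _ _))//.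
  exact: (@bounded_integrable _ _ _ _ (C * (t - s))).
apply: le_Rintegral => //.
  apply: (@bounded_integrable _ _ _ _ (C * (t - s))) => //.
    exact: measurableT_comp.
  by move=> x; rewrite normr_id; exact: fB.
exact: (@bounded_integrable _ _ _ _ `|C * (t - s)|).
Qed.

(* [L \1_(<= t)] is the distribution function of the measure; both functionals
   agree to first order in the mesh of a partition, hence are equal. *)
Lemma hausdorff_moment {R : realType} (c : R) (phi : {scalar {poly R}}) :
  0 < c ->
  (forall k l, 0 <= phi ((c%:P + 'X) ^+ k * (c%:P - 'X) ^+ l)) ->
  exists2 m : {finite_measure set R -> \bar R},
    m (~` `[- (c + 2), c + 2]%classic) = 0%E &
    forall p : {poly R}, phi p = \int[m]_t p.[t].
Proof.
move=> c0 phi0; have [L [Llin Lge0 Lpoly Lrc]] := positive_extension c0 phi0.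
pose bnd (f : R -> R) := exists K : R, forall t : R, `|t| <= c + 1 -> `|f t| <= K.
have bndB f g : bnd f -> bnd g -> bnd (fun t => f t - g t).
  move=> [K fK] [K' gK]; exists (K + K') => t tc.
  by rewrite (le_trans (ler_normB _ _))// lerD ?fK ?gK.
have bndM f g : bnd f -> bnd g -> bnd (fun t => f t * g t).
  by move=> [K fK] [K' gK]; exists (K * K') => t tc; rewrite normrM ler_pM ?fK ?gK.
have bndC r : bnd (fun=> r) by exists `|r|.
have LB f g : bnd f -> bnd g -> L (fun t => f t - g t) = L f - L g.
  move=> [K fK] [K' gK]; rewrite -mulN1r -(Llin _ _ K K')//.
  by congr L; apply/funext => t; rewrite mulN1r.
have Lle f g : bnd f -> bnd g -> (forall t : R, `|t| <= c + 1 -> f t <= g t) ->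
    L f <= L g.
  move=> fb gb fg; rewrite -subr_ge0 -LB//; have [K fgK] := bndB _ _ gb fb.
  by apply: (Lge0 _ K) => // t tc; rewrite subr_ge0 fg.
have LZ r f : bnd f -> L (fun t => r * f t) = r * L f.
  have [K K0] := bndC 0; move=> [K' fK]; have := Llin _ _ _ _ r K0 fK.
  have -> : L (fun=> 0) = 0.
    transitivity (L (horner 0)); last by rewrite Lpoly linear0.
    by congr L; apply/funext => t; rewrite horner0.
  by rewrite add0r => <-; congr L; apply/funext => t; rewrite add0r.
pose ind (t s : R) : R := \1_`]-oo, t]%classic s.
have indE (t s : R) : ind t s = (s <= t)%R%:R by rewrite /ind indicE mem_setE in_itv.
have bndi t : bnd (ind t).
  by exists 1 => s _; rewrite indE ger0_norm ?ler0n// lern1 leq_b1.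
have bndp (p : {poly R}) : bnd (horner p).
  have [K _ pK] := poly_lipschitz p (c + 1).
  by exists K => t tc; have [] := pK t t tc tc.
have L0 f : (forall t : R, `|t| <= c + 1 -> f t = 0) -> L f = 0.
  move=> f0; have fb : bnd f by exists 0 => t /f0 ->; rewrite normr0.
  have f0b := bndM _ _ (bndC 0) fb.
  rewrite -[RHS](mul0r (L f)) -LZ//; apply/eqP; rewrite eq_le.
  by rewrite !Lle// => t tc; rewrite f0 ?mulr0.
have LT f g : (forall t : R, `|t| <= c + 1 -> f t = g t) -> bnd f -> L f = L g.
  move=> fg [K fK]; have gb : bnd g by exists K => t tc; rewrite -fg// fK.
  by apply/eqP; rewrite eq_le !Lle//; try (by exists K); move=> t tc; rewrite fg.
(* [L] only sees [[- (c + 1), c + 1]]; the margin beyond it makes [G] vanish at [- d] itself, so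
   that this end point has no mass. *)
pose G t := L (ind t); pose d := c + 2.
have [m mG] : exists m : {finite_measure set R -> \bar R},
    forall t, m `]-oo, t]%classic = (G t)%:E.
  apply: (@cdf_measure _ G (phi 1) d).
  - move=> s t st; apply: Lle => // u _; rewrite !indE.
    by case: (leP u s) => us; rewrite ?(le_trans us st).
  - exact: Lrc.
  - move=> t td; apply: L0 => s sc; rewrite indE leNgt (lt_le_trans td)//.
    by move: sc; rewrite ler_norml /d => /andP[sc _]; lra.
  - move=> t td; rewrite /G -Lpoly; apply: LT => // s sc.
    rewrite indE hornerE (le_trans _ td)//.
    by move: sc; rewrite ler_norml /d => /andP[_ sc]; lra.
  - by have := phi0 0 0; rewrite !expr0 mulr1.
have mitv (s t : R) : s <= t -> fine (m `]s, t]%classic) = G t - G s.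
  move=> st; have -> : `]s, t]%classic = `]-oo, t]%classic `\` `]-oo, s]%classic.
    apply/seteqP; split=> x /=; rewrite !in_itv/=.
      by move=> /andP[sx xt]; split => //; apply/negP; rewrite -ltNge.
    by move=> [-> /negP]; rewrite -ltNge => ->.
  rewrite measureD//.
  - rewrite setIidr; first by rewrite -[RHS]/(fine ((G t)%:E - (G s)%:E)) -!mG.
    by move=> x /=; rewrite !in_itv/= => /le_trans; apply.
  - by rewrite -ge0_fin_numE ?fin_num_measure.
have Gd : G (- d) = 0.
  apply: L0 => s; rewrite ler_norml indE => /andP[sc _].
  by rewrite leNgt (lt_le_trans _ sc)// /d; lra.
have GK (t : R) : d <= t -> G t = phi 1.
  move=> td; rewrite /G -Lpoly; apply: LT => // s sc.
  rewrite indE hornerE (le_trans _ td)//.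
  by move: sc; rewrite ler_norml /d => /andP[_ sc]; lra.
have mNd : m.-negligible (`]-oo, (- d)]%classic : set R).
  by apply/negligibleP => //; apply: etrans (mG _) _; rewrite Gd.
have mI : m (~` `[- d, d]%classic) = 0%E.
  have mdn (n : nat) : m.-negligible (`]d, d + n%:R]%classic : set R).
    apply/negligibleP => //; rewrite -[LHS]fineK ?fin_num_measure// mitv ?lerDl//.
    by rewrite !GK ?lerDl// subrr.
  apply/negligibleP; first exact: measurableC.
  apply: negligibleS (negligibleU mNd (negligible_bigcup mdn)) => x /=.
  rewrite in_itv/= => /negP; rewrite negb_and -!ltNge => /orP[xd|dx].
    by left; rewrite /= in_itv/= ltW.
  right; exists (Num.truncn (x - d)).+1 => //=; rewrite in_itv/= dx /=.
  by rewrite -lerBlDl ltW// truncnS_gt.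
exists m => // p; have [C C0 pC] := poly_lipschitz p d.
have cd (t : R) : `|t| <= c + 1 -> `|t| <= d.
  by move=> /le_trans; apply; rewrite /d; lra.
have dd : - d <= d by rewrite /d; lra.
have itv_le (s t x : R) : - d <= s -> t <= d -> s <= x <= t -> `|x| <= d.
  by move=> ds td /andP[sx xt]; rewrite ler_norml (le_trans ds)//= (le_trans xt).
have mp A : measurable_fun A (horner p) by exact: measurable_poly.
have pint A : measurable A -> A `<=` `[- d, d]%classic ->
    m.-integrable A (EFin \o horner p).
  move=> mA AI; apply: (@bounded_integrable _ _ _ _ C) => // x /AI/=.
  by rewrite in_itv/= -ler_norml => xd; have [] := pC x x xd xd.
(* Both terms have increment [p.[s] * (G t - G s)] up to [C * (t - s) * (G t - G s)], whence the
   constant [2 * C]. *)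
pose D t := L (fun x => p.[x] * ind t x) - \int[m]_(x in `[- d, t]) p.[x].
have : D d = D (- d).
  apply: (@increment_le_const _ D G (2 * C)) => // s t ds st td.
  have LD : `|L (fun x => p.[x] * ind t x) - L (fun x => p.[x] * ind s x) -
      p.[s] * (G t - G s)| <= C * (t - s) * (G t - G s).
    have bi : bnd (fun x => ind t x - ind s x) by exact: bndB.
    have bpi u : bnd (fun x => p.[x] * ind u x) by exact: bndM.
    rewrite -!LB// -!LZ//.
    have bs := bndM _ _ (bndC p.[s]) bi.
    have bC := bndM _ _ (bndC (C * (t - s))) bi.
    have bpB := bndB _ _ (bpi t) (bpi s).
    rewrite -LB//; set f := fun x => _ - _; set g := fun x => _ * _.
    have fb : bnd f by exact: bndB.
    have fg (x : R) : `|x| <= c + 1 -> `|f x| <= g x.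
      move=> xc; have xd := cd x xc.
      have sd : `|s| <= d by apply: (itv_le s s); rewrite ?lexx// (le_trans st).
      have [_] := pC x s xd sd; rewrite /f /g !indE.
      case: (leP x s) => xs; first by rewrite (le_trans xs st) !(subrr, mulr0) normr0.
      case: (leP x t) => xt; last by rewrite !(subrr, mulr0) normr0.
      rewrite /= !mulr1 mulr0 !subr0 mulr1 => /le_trans; apply.
      by rewrite mulr1 ler_wpM2l// ger0_norm ?lerD2r// subr_ge0 ltW.
    rewrite ler_norml; apply/andP; split; last first.
      by apply: Lle => // x /fg; exact: le_trans (ler_norm _).
    rewrite -mulN1r -LZ//; apply: Lle => //; first exact: bndM.
    by move=> x /fg; rewrite mulN1r lerNl; apply: le_trans; rewrite -normrN ler_norm.
  have mD : `| \int[m]_(x in `[- d, t]) p.[x] - \int[m]_(x in `[- d, s]) p.[x] -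
      p.[s] * (G t - G s)| <= C * (t - s) * (G t - G s).
    have -> : `[- d, t]%classic = `[- d, s]%classic `|` `]s, t]%classic.
      by apply: itv_bndbnd_setU; rewrite bnd_simp.
    rewrite Rintegral_setU//; last 2 first.
    - apply: pint; first exact: measurableU.
      move=> x [] /=; rewrite !in_itv/= => /andP[h1 h2].
        by rewrite h1 (le_trans h2)// (le_trans st).
      by rewrite (le_trans ds (ltW h1)) (le_trans h2).
    - apply/disj_setPS => x [] /=; rewrite !in_itv/= => /andP[_ h1] /andP[h2 _].
      by move: h1; rewrite leNgt h2.
    have addK' (x y : R) : x + y - x = y by ring.
    rewrite addK' -mitv//; apply: integral_itv_approx => // x sxt.
    have /andP[sx xt] := sxt.
    have [_] := pC x s (itv_le _ _ _ ds td sxt)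
      (itv_le s t s ds td (introT andP (conj (lexx s) st))).
    by rewrite (ger0_norm (_ : 0 <= x - s))// subr_ge0.
  rewrite /D.
  set a := L _ in LD *; set b := L _ in LD *.
  set a' := \int[m]_(x in _) _ in mD *; set b' := \int[m]_(x in _) _ in mD *.
  rewrite (_ : a - a' - (b - b') = (a - b - p.[s] * (G t - G s)) -
    (a' - b' - p.[s] * (G t - G s))); last by ring.
  rewrite (le_trans (ler_normB _ _))// (le_trans (lerD LD mD))//.
  by rewrite le_eqVlt; apply/orP; left; apply/eqP; ring.
have -> : D (- d) = 0.
  rewrite /D L0; last first.
    move=> x xc; rewrite indE leNgt (_ : - d < x) ?mulr0//.
    by move: xc; rewrite ler_norml /d => /andP[xc _]; lra.
  rewrite /Rintegral null_set_integral ?subr0//.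
    exact/measurable_EFinP.
  apply/negligibleP => //; apply: negligibleS mNd => x /=.
  by rewrite !in_itv/= => /andP[].
move/eqP; rewrite subr_eq0 => /eqP Ld.
rewrite -Lpoly (_ : L _ = L (fun x => p.[x] * ind d x)).
  by rewrite Ld; apply/esym/Rintegral_support.
apply: LT => // x xc; rewrite indE (_ : x <= d) ?mulr1//.
by have := cd x xc; rewrite ler_norml => /andP[].
Qed.

(** * Bounded pointwise limits of polynomials *)

Section step_polynomials.
Context {R : realType}.

Lemma bernoulli_one_sub (y : R) (n : nat) : 0 <= y <= 1 ->
  1 - n%:R * y <= (1 - y) ^+ n.
Proof.
move=> /andP[y0 y1]; elim: n => [|n IH]; first by rewrite mul0r subr0 expr0.
rewrite exprS; apply: (@le_trans _ _ ((1 - y) * (1 - n%:R * y))); last first.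
  by rewrite ler_wpM2l// subr_ge0.
rewrite -natr1; have : 0 <= n%:R * y * y by rewrite !mulr_ge0.
by nra.
Qed.

Lemma bernoulli_one_add (y : R) (n : nat) : 0 <= y ->
  1 + n%:R * y <= (1 + y) ^+ n.
Proof.
move=> y0; elim: n => [|n IH]; first by rewrite mul0r addr0 expr0.
rewrite exprS; apply: (@le_trans _ _ ((1 + y) * (1 + n%:R * y))); last first.
  by rewrite ler_wpM2l// addr_ge0.
rewrite -natr1; have : 0 <= n%:R * y * y by rewrite !mulr_ge0.
by nra.
Qed.

(** [(1 - y) ^+ n * (1 + y) ^+ n <= 1], and Bernoulli's inequality bounds the second factor below by
    [n%:R * y]. *)
Lemma one_sub_exp_le (y : R) (n : nat) : 0 <= y <= 1 ->
  (1 - y) ^+ n * (n%:R * y) <= 1.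
Proof.
move=> /andP[y0 y1]; apply: (@le_trans _ _ ((1 - y) ^+ n * (1 + y) ^+ n)).
  rewrite ler_wpM2l ?exprn_ge0 ?subr_ge0//.
  by rewrite (le_trans _ (bernoulli_one_add n y0))// lerDr.
rewrite -exprMn exprn_ile1//; last by nra.
by rewrite mulr_ge0 ?subr_ge0// addr_ge0.
Qed.

(* On [[0, 1]] the limit is the indicator of [[0, 1/2]], by Bernoulli's inequality:
   [2^(n^2) x^(n(n+1)) = ((2x)^n x)^n] tends to 0 for [x <= 1/2], also at [1/2]. *)
Definition step_poly (n : nat) : {poly R} :=
  (1 - 'X ^+ (n * n.+1)) ^+ (2 ^ (n * n)).

Lemma step_polyE n x :
  (step_poly n).[x] = (1 - x ^+ (n * n.+1)) ^+ (2 ^ (n * n)).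
Proof. by rewrite /step_poly !hornerE. Qed.

Lemma step_poly01 n x : 0 <= x <= 1 -> 0 <= (step_poly n).[x] <= 1.
Proof.
move=> /andP[x0 x1]; rewrite step_polyE.
have h : 0 <= 1 - x ^+ (n * n.+1) <= 1.
  by rewrite subr_ge0 exprn_ile1//= gerBl exprn_ge0.
by case/andP: h => h1 h2; rewrite exprn_ge0// exprn_ile1.
Qed.

Lemma step_poly_weight n (x : R) :
  (2 ^ (n * n))%:R * x ^+ (n * n.+1) = ((2 * x) ^+ n * x) ^+ n.
Proof.
by rewrite natrX !exprMn -!exprM mulnS exprD; ring.
Qed.

(** Put [N = 2 ^ (n * n)] and [y = x ^+ (n * n.+1)]. For [x <= 1/2], [N y] is at most [2^-n] and
    Bernoulli's inequality applies; for [x > 1/2], [N y] is eventually at least [2 ^ n], while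
    [(1 - y) ^+ N * (N y) <= 1]. *)
Lemma cvg_step_poly (x : R) : 0 <= x <= 1 ->
  (step_poly n).[x] @[n --> \oo] --> ((x <= 2^-1)%R%:R : R).
Proof.
move=> x01; have /andP[x0 x1] := x01.
have y01 n : 0 <= x ^+ (n * n.+1) <= 1 by rewrite exprn_ge0//= exprn_ile1.
have c0 : (2^-1 : R) ^+ n @[n --> \oo] --> (0 : R).
  by apply: cvg_expr; rewrite ger0_norm ?invf_lt1 ?ltr1n.
case: leP => xh /=.
  apply: (@squeeze_cvgr _ _ _ _ (fun n => 1 - 2^-1 ^+ n) (fun=> 1)).
  - near=> n; apply/andP; split; last by have /andP[] := step_poly01 n x01.
    rewrite step_polyE (le_trans _ (bernoulli_one_sub _ (y01 n)))//.
    rewrite lerD2l lerN2 step_poly_weight lerXn2r ?nnegrE//.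
    + by rewrite mulr_ge0// exprn_ge0// mulr_ge0.
    + rewrite -[leRHS]mul1r ler_pM// ?exprn_ge0 ?mulr_ge0//.
      by rewrite exprn_ile1 ?mulr_ge0//; lra.
  - by rewrite -[X in _ --> X]subr0; apply: cvgB => //; exact: cvg_cst.
  - exact: cvg_cst.
apply: (@squeeze_cvgr _ _ _ _ (fun=> 0) (fun n => 2^-1 ^+ n)).
- near=> n; apply/andP; split; first by have /andP[] := step_poly01 n x01.
  have h2 : 2 <= (2 * x) ^+ n * x.
    have x2 : 0 <= 2 * x - 1 by lra.
    have := bernoulli_one_add n x2; rewrite addrCA subrr addr0.
    (* Then [(2 * x) ^+ n >= 1 + n * (2 * x - 1) >= 4], and the factor [x] costs at most one
       half. *)
    have : 3 / (2 * x - 1) <= n%:R by near: n; exact: nbhs_infty_ger.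
    by rewrite ler_pdivrMr; [|lra] => h3 h4; nra.
  have := one_sub_exp_le (2 ^ (n * n)) (y01 n).
  rewrite -step_polyE step_poly_weight => h3.
  have h4 : 2 ^+ n <= ((2 * x) ^+ n * x) ^+ n.
    by rewrite lerXn2r ?nnegrE// (le_trans _ h2).
  rewrite exprVn -[_^-1]mul1r ler_pdivlMr ?exprn_gt0//.
  apply: le_trans h3; rewrite ler_wpM2l//.
  by have /andP[] := step_poly01 n x01.
- exact: cvg_cst.
- exact: c0.
Unshelve. all: by end_near.
Qed.

End step_polynomials.

(** Convergence at every point, with no exceptional set, serves all spectral measures at once; the
    uniform bound is what dominated convergence needs. *)
Definition poly_limit {R : realType} (d : R) (f : R -> R) (q : nat -> {poly R}) :=
  (exists K : R, forall n (t : R), `|t| <= d -> `|(q n).[t]| <= K) /\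
  forall t : R, `|t| <= d -> (q n).[t] @[n --> \oo] --> f t.

Lemma poly_limit_step {R : realType} (d s : R) :
  exists q, poly_limit d \1_`]-oo, s]%classic q.
Proof.
(* [D] is at least twice the distance from [s] to any point of [[- d, d]], so [A] maps this interval
   into [[0, 1]], and [s] to [1/2]; the summand 1 keeps [D] positive. *)
pose D := 2 * (`|d| + `|s| + 1).
have D0 : 0 < D by rewrite mulr_gt0// ltr_wpDl// addr_ge0.
pose A : {poly R} := 2^-1%:P + D^-1 *: ('X - s%:P).
have AE t : A.[t] = 2^-1 + (t - s) / D by rewrite /A !hornerE mulrC.
have A01 (t : R) : `|t| <= d -> 0 <= A.[t] <= 1.
  move=> td; rewrite AE.
  have h : `|(t - s) / D| <= 2^-1.
    rewrite normrM normfV (gtr0_norm D0) ler_pdivrMr// /D mulrA mulVf// mul1r.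
    rewrite (le_trans (ler_normB _ _))// -addrA lerD ?(le_trans td) ?ler_norm//.
    by rewrite lerDl.
  by move: h; rewrite ler_norml => /andP[h1 h2]; apply/andP; lra.
exists (fun n => step_poly n \Po A); split.
  exists 1 => n t /A01 h; rewrite horner_comp ger0_norm.
    by have /andP[] := step_poly01 n h.
  by have /andP[] := step_poly01 n h.
move=> t td; rewrite indicE mem_setE in_itv/=.
have -> : (t <= s) = (A.[t] <= 2^-1).
  by rewrite AE gerDl pmulr_lle0 ?invr_gt0// subr_le0.
by under eq_fun do rewrite horner_comp; exact/cvg_step_poly/A01.
Qed.

Lemma poly_limitC {R : realType} (d : R) (f : R -> R) q : poly_limit d f q ->
  poly_limit d (fun t => 1 - f t) (fun n => 1 - q n).
Proof.
move=> [[K qK] qf]; split.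
  exists (1 + K) => n t td; rewrite !hornerE (le_trans (ler_normB _ _))//.
  by rewrite normr1 lerD2l qK.
move=> t td; under eq_fun do rewrite !hornerE.
by apply: cvgB; [exact: cvg_cst|exact: qf].
Qed.

Lemma poly_limitM {R : realType} (d : R) (f g : R -> R) q r :
  poly_limit d f q -> poly_limit d g r ->
  poly_limit d (fun t => f t * g t) (fun n => q n * r n).
Proof.
move=> [[K qK] qf] [[K' rK] rg]; split.
  by exists (K * K') => n t td; rewrite hornerM normrM ler_pM ?qK ?rK.
by move=> t td; under eq_fun do rewrite hornerM; apply: cvgM; [exact: qf|exact: rg].
Qed.

Lemma poly_limit_cst {R : realType} (d : R) (p : {poly R}) :
  poly_limit d (horner p) (fun=> p).
Proof.
split; last by move=> t td; exact: cvg_cst.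
by have [K _ pK] := poly_lipschitz p d; exists K => n t td; have [] := pK t t td td.
Qed.

Lemma normr_itv {R : realType} (d t : R) : `[- d, d]%classic t -> `|t| <= d.
Proof. by rewrite /= in_itv/= -ler_norml. Qed.

Lemma bounded_convergence {R : realType} (m : {finite_measure set R -> \bar R})
    (d : R) (f_ : nat -> R -> R) (f : R -> R) (K : R) :
  (forall n, measurable_fun `[- d, d]%classic (f_ n)) ->
  (forall n (t : R), `|t| <= d -> `|f_ n t| <= K) ->
  (forall t : R, `|t| <= d -> f_ n t @[n --> \oo] --> f t) ->
  m.-integrable `[- d, d]%classic (EFin \o f) /\
  \int[m]_(t in `[- d, d]) f_ n t @[n --> \oo] --> \int[m]_(t in `[- d, d]) f t.
Proof.
move=> mf fK ff; have mI := @measurable_itv R `[- d, d].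
have mff : measurable_fun `[- d, d]%classic f.
  by apply: (measurable_fun_cvg mf) => t /normr_itv td; exact: ff.
have fB (t : R) : `[- d, d]%classic t -> `|f t| <= K.
  move=> /normr_itv td; apply: cvgr_to_le (cvg_norm (ff t td)) _.
  by apply: filterE => n; exact: fK.
have finI : (m `[(- d)%R, d]%classic < +oo)%E by rewrite -ge0_fin_numE ?fin_num_measure.
have fint : m.-integrable `[- d, d]%classic (EFin \o f).
  apply: measurable_bounded_integrable => //; exists K; split; first exact: num_real.
  by move=> M KM t It; apply: (le_trans (fB _ It)); exact: ltW.
split => //; apply: fine_cvg; rewrite /Rintegral fineK; last first.
  exact: integrable_fin_num.
apply: (@dominated_cvg _ _ _ m _ mI _ _ (fun=> K%:E)) => //.
- by move=> n; exact/measurable_EFinP.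
- by move=> t /normr_itv td; apply: cvg_EFin; [exact: nearW|exact: ff].
- exact: finite_measure_integrable_cst.
- by move=> n t /normr_itv td; rewrite /= lee_fin fK.
Qed.

Lemma poly_limit_integrable {R : realType} (m : {finite_measure set R -> \bar R})
    (d : R) (f : R -> R) q : poly_limit d f q ->
  m.-integrable `[- d, d]%classic (EFin \o f) /\
  \int[m]_(t in `[- d, d]) (q n).[t] @[n --> \oo] -->
    \int[m]_(t in `[- d, d]) f t.
Proof.
move=> [[K qK] qf]; apply: (@bounded_convergence _ m d _ _ K) => //.
by move=> n; exact: measurable_poly.
Qed.

(** The polynomials are Cauchy in [L^2(m)]: [(x - y) ^+ 2 <= 2 * ((x - f) ^+ 2 + (y - f) ^+ 2)],
    where each square integrates to at most [e / 4]. For the measure of a vector [x], this makes the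
    vectors [pop a (q n) x] Cauchy. *)
Lemma poly_limit_integral_sqr {R : realType}
    (m : {finite_measure set R -> \bar R}) (d : R) (f : R -> R) q (e : R) :
  poly_limit d f q -> 0 < e -> exists N, forall n k, (N <= n)%N -> (N <= k)%N ->
    \int[m]_(t in `[- d, d]) ((q n - q k) ^+ 2).[t] <= e.
Proof.
move=> qf e0; have mI := @measurable_itv R `[- d, d].
have [[K qK] qt] := qf.
have [fint _] := poly_limit_integrable m qf.
have mf : measurable_fun `[- d, d]%classic f.
  by apply/measurable_EFinP; exact: measurable_int fint.
have fB (t : R) : `|t| <= d -> `|f t| <= K.
  move=> td; apply: cvgr_to_le (cvg_norm (qt t td)) _.
  by apply: filterE => n; exact: qK.
pose g n (t : R) := ((q n).[t] - f t) ^+ 2.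
have mg n : measurable_fun `[- d, d]%classic (g n).
  apply: (@measurable_funX _ _ _ _ (fun t => (q n).[t] - f t)).
  by apply: measurable_funB => //; exact: measurable_poly.
have gB n (t : R) : `|t| <= d -> `|g n t| <= (K + K) ^+ 2.
  move=> td; rewrite /g normrX lerXn2r ?nnegrE//.
    by rewrite addr_ge0// (le_trans _ (fB t td)).
  by rewrite (le_trans (ler_normB _ _))// lerD ?qK ?fB.
have gint n : m.-integrable `[- d, d]%classic (EFin \o g n).
  apply: measurable_bounded_integrable => //.
    by rewrite -ge0_fin_numE ?fin_num_measure.
  exists ((K + K) ^+ 2); split; first exact: num_real.
  by move=> M KM t /normr_itv It; apply: (le_trans (gB _ _ It)); exact: ltW.
have [_ gcvg] : m.-integrable `[- d, d]%classic (EFin \o fun=> 0) /\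
    \int[m]_(t in `[- d, d]) g n t @[n --> \oo] --> \int[m]_(t in `[- d, d]) (0 : R).
  apply: (@bounded_convergence _ m d _ _ ((K + K) ^+ 2)) => // t td.
  have h : (q n).[t] - f t @[n --> \oo] --> (0 : R).
    by rewrite -(subrr (f t)); apply: cvgB; [exact: qt|exact: cvg_cst].
  rewrite (_ : g ^~ t = fun n => ((q n).[t] - f t) * ((q n).[t] - f t)).
    by rewrite -[X in _ --> X](mul0r (0 : R)); exact: cvgM.
  by apply/funext => n; rewrite /g expr2.
have {gcvg} : \int[m]_(t in `[- d, d]) g n t @[n --> \oo] --> (0 : R).
  by move: gcvg; rewrite Rintegral_cst// mul0r.
have e4 : 0 < e / 4 by rewrite divr_gt0.
move=> /cvgrPdist_le/(_ _ e4)[N _ gN]; exists N => n k Nn Nk.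
have := lerD (gN _ Nn) (gN _ Nk); rewrite !sub0r !normrN.
rewrite !ger0_norm ?Rintegral_ge0//; try by move=> *; exact: sqr_ge0.
move=> h; apply: (@le_trans _ _ (2 * \int[m]_(t in `[- d, d]) (g n t + g k t))); last first.
  by rewrite RintegralD//; move: h; lra.
rewrite -RintegralZl//; last first.
  have -> : EFin \o (fun t => g n t + g k t) = (EFin \o g n) \+ (EFin \o g k).
    by apply/funext.
  exact: integrableD.
apply: le_Rintegral => //.
- have [] // := poly_limit_integrable m (poly_limit_cst d ((q n - q k) ^+ 2)).
- have -> : EFin \o (fun t => 2 * (g n t + g k t)) =
    (fun t => 2%:E * ((EFin \o g n) \+ (EFin \o g k)) t)%E by apply/funext.
  by apply: integrableZl => //; exact: integrableD.
- move=> t _; rewrite !hornerE /g -subr_ge0.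
  set x := (q n).[t]; set y := (q k).[t].
  rewrite (_ : _ - _ = (x + y - 2 * f t) ^+ 2); first exact: sqr_ge0.
  by ring.
Qed.

Local Open Scope complex_scope.

(** * Norms and inner products with values in the real field *)

Section normed.
Context {R : realType}.

Section normed_module.
Variable V : normedModType R[i].
Implicit Types x y : V.

Lemma rnormE x : `|x| = (rnorm x)%:C.
Proof. by rewrite /rnorm RRe_real// ger0_real. Qed.

Lemma rnorm_ge0 x : 0 <= rnorm x.
Proof. by rewrite -ler0c -rnormE. Qed.

Lemma rnormD x y : rnorm (x + y) <= rnorm x + rnorm y.
Proof. by rewrite -lecR rmorphD /= -!rnormE ler_normD. Qed.

Lemma rnormN x : rnorm (- x) = rnorm x.
Proof. by rewrite /rnorm normrN. Qed.

Lemma rnormB x y : rnorm (x - y) <= rnorm x + rnorm y.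
Proof. by rewrite -(rnormN y) rnormD. Qed.

Lemma rnorm_distC x y : rnorm (x - y) = rnorm (y - x).
Proof. by rewrite /rnorm distrC. Qed.

Lemma rnormZ (k : R[i]) x : rnorm (k *: x) = rnorm k * rnorm x.
Proof.
by apply: complexI; rewrite rmorphM /= -!rnormE normrZ.
Qed.

Lemma rnorm0 : rnorm (0 : V) = 0. Proof. by rewrite /rnorm normr0. Qed.

Lemma rnorm_eq0 x : rnorm x = 0 -> x = 0.
Proof. by move=> x0; apply/normr0_eq0; rewrite rnormE x0. Qed.

Lemma rnormC (k : R) : rnorm k%:C = `|k|.
Proof. by rewrite /rnorm normc_def /= expr0n addr0 sqrtr_sqr. Qed.

Lemma rnormCZ (k : R) x : rnorm (k%:C *: x) = `|k| * rnorm x.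
Proof. by rewrite rnormZ rnormC. Qed.

Lemma rnorm_small_eq0 x (M : R) :
  (forall e : R, 0 < e -> rnorm x <= M * e) -> x = 0.
Proof.
move=> h; apply: rnorm_eq0; apply: (@eq_of_le_div _ _ M); first exact: rnorm_ge0.
by move=> n; apply: h; rewrite invr_gt0.
Qed.

(** Norm convergence expressed by a real sequence, which makes the limit theorems over [R]
    applicable. *)
Definition hcvg (u : nat -> V) (l : V) :=
  rnorm (u n - l) @[n --> \oo] --> (0 : R).

Lemma hcvgP (u : nat -> V) l : hcvg u l <->
  forall e : R, 0 < e -> exists N, forall n, (N <= n)%N -> rnorm (u n - l) <= e.
Proof.
split=> [/cvgrPdist_le h e e0|h].
  have [N _ hN] := h _ e0; exists N => n Nn.
  by have := hN n Nn; rewrite sub0r normrN ger0_norm// rnorm_ge0.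
apply/cvgrPdist_le => e e0; have [N hN] := h _ e0; exists N => //= n /hN.
by rewrite sub0r normrN ger0_norm// rnorm_ge0.
Qed.

Lemma hcvg_le (u : nat -> V) l (v : nat -> R) : v @ \oo --> (0 : R) ->
  (forall n, rnorm (u n - l) <= v n) -> hcvg u l.
Proof.
move=> v0 uv; apply: (@squeeze_cvgr _ _ _ _ (fun=> 0) v) => //.
  by apply: filterE => n; rewrite rnorm_ge0 uv.
exact: cvg_cst.
Qed.

Lemma hcvg_cst l : hcvg (fun=> l) l.
Proof. by rewrite /hcvg subrr rnorm0; exact: cvg_cst. Qed.

Lemma hcvgD (u v : nat -> V) l k : hcvg u l -> hcvg v k ->
  hcvg (fun n => u n + v n) (l + k).
Proof.
move=> ul vk; apply: (@hcvg_le _ _ (fun n => rnorm (u n - l) + rnorm (v n - k))).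
  by rewrite -[X in _ --> X]addr0; exact: cvgD.
by move=> n; rewrite opprD addrACA rnormD.
Qed.

Lemma hcvgZ (a : R[i]) (u : nat -> V) l : hcvg u l ->
  hcvg (fun n => a *: u n) (a *: l).
Proof.
move=> ul; apply: (@hcvg_le _ _ (fun n => rnorm a * rnorm (u n - l))).
  by rewrite -[X in _ --> X](mulr0 (rnorm a)); exact: cvgMr.
by move=> n; rewrite -scalerBr rnormZ.
Qed.

Lemma hcvgB (u v : nat -> V) l k : hcvg u l -> hcvg v k ->
  hcvg (fun n => u n - v n) (l - k).
Proof.
move=> ul vk; have := hcvgD ul (hcvgZ (-1) vk); rewrite scaleN1r.
by congr hcvg; apply/funext => n; rewrite scaleN1r.
Qed.

Lemma hcvg_unique (u : nat -> V) l k : hcvg u l -> hcvg u k -> l = k.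
Proof.
move=> ul uk; have := hcvgB ul uk; rewrite /hcvg => h.
have {}h : rnorm (l - k) @[_ --> \oo] --> (0 : R).
  apply: cvg_trans h; apply: near_eq_cvg; apply: nearW => n.
  by rewrite subrr sub0r rnormN.
apply/eqP; rewrite -subr_eq0; apply/eqP/rnorm_eq0.
by apply: cvg_unique h => //; exact: cvg_cst.
Qed.

Lemma hcvg_rnorm (u : nat -> V) l : hcvg u l ->
  rnorm (u n) @[n --> \oo] --> rnorm l.
Proof.
move=> /hcvgP h; apply/cvgrPdist_le => e e0; have [N hN] := h _ e0.
exists N => //= n Nn; rewrite (le_trans _ (hN _ Nn))//.
have := rnormD (u n - l) l; have := rnormD (l - u n) (u n).
by rewrite !subrK (rnorm_distC l) => ? ?; rewrite ler_norml; apply/andP; lra.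
Qed.

Lemma hcvg_shift (u : nat -> V) l N : hcvg u l -> hcvg (fun n => u (n + N)%N) l.
Proof.
move=> /hcvgP h; apply/hcvgP => e e0; have [K hK] := h _ e0.
by exists K => n Kn; apply: hK; rewrite (leq_trans Kn)// leq_addr.
Qed.

End normed_module.

Lemma hcomplete (V : completeNormedModType R[i]) (u : nat -> V) :
  (forall e : R, 0 < e -> exists N, forall n k, (N <= n)%N -> (N <= k)%N ->
    rnorm (u n - u k) <= e) -> exists l, hcvg u l.
Proof.
move=> h; have : cvg (u @ \oo).
  apply/cauchy_cvgP/cauchy_ballP => e e0.
  have [e' e'0 ->] : exists2 e' : R, 0 < e' & e = e'%:C.
    exists (complex.Re e); last by rewrite RRe_real// gtr0_real.
    by rewrite -ltcR RRe_real// gtr0_real.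
  have e2 : 0 < e' / 2 by rewrite divr_gt0.
  have [N hN] := h _ e2.
  pose W := [set x : V | exists2 n, (N <= n)%N & x = u n].
  exists (W, W) => /=; first by split; exists N => // n Nn; exists n.
  move=> [x y] /= [[n Nn ->] [k Nk ->]]; rewrite -ball_normE /= rnormE ltcR.
  by rewrite (le_lt_trans (hN _ _ Nn Nk))// ltr_pdivrMr// ltr_pMr// ltr1n.
move=> /cvg_ex[l ul]; exists l; apply/hcvgP => e e0.
have e0' : 0 < e%:C :> R[i] by rewrite ltcR.
move/cvgrPdist_le: ul => /(_ _ e0')[N _ hN].
by exists N => n /hN; rewrite distrC rnormE lecR.
Qed.

End normed.

Section operator_norm.
Context {R : realType} {H K : normedModType R[i]}.
Implicit Types T S : H -> K.

Definition op_bound T (C : R) := 0 <= C /\ forall x, rnorm (T x) <= C * rnorm x.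

Lemma linear0_fun T : linear T -> T 0 = 0.
Proof.
move=> lT; have := lT 1 0 0; rewrite !scale1r addr0 => /(canLR (addrK _)) <-.
by rewrite subrr.
Qed.

Lemma linearD_fun T : linear T -> {morph T : x y / x + y}.
Proof. by move=> lT x y; have := lT 1 x y; rewrite !scale1r. Qed.

Lemma linearZ_fun T (k : R[i]) x : linear T -> T (k *: x) = k *: T x.
Proof. by move=> lT; have := lT k x 0; rewrite !addr0 linear0_fun// addr0. Qed.

Lemma linearB_fun T : linear T -> {morph T : x y / x - y}.
Proof.
move=> lT x y; rewrite -scaleN1r linearD_fun// linearZ_fun//.
by rewrite scaleN1r.
Qed.

Lemma linear_continuous_bounded T : linear T ->
  continuous T <-> exists C, op_bound T C.
Proof.
move=> lT; split.
  move=> /(_ 0); rewrite /continuous_at linear0_fun// => /cvgr_dist_lt /(_ _ ltr01).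
  rewrite near_simpl /= => /nbhs_ballP[e /= e0 he].
  have [d d0 de] : exists2 d : R, 0 < d & e = d%:C.
    exists (complex.Re e); last by rewrite RRe_real// gtr0_real.
    by rewrite -ltcR RRe_real// gtr0_real.
  exists (2 / d); split; first by rewrite divr_ge0// ltW.
  move=> x; have [->|x0] := eqVneq x 0.
    by rewrite linear0_fun// !rnorm0 mulr0.
  have nx : 0 < rnorm x.
    by rewrite lt_def rnorm_ge0 andbT; apply: contra_neq x0; exact: rnorm_eq0.
  (* Scales [x] to norm [d / 2], inside the ball on which the values of [T] have norm less than
     1. *)
  pose k := d / 2 / rnorm x.
  have k0 : 0 < k by rewrite !divr_gt0.
  have : ball 0 e (k%:C *: x).
    rewrite -ball_normE /= sub0r normrN rnormE de ltcR rnormCZ gtr0_norm//.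
    by rewrite /k divfK ?gt_eqF// ltr_pdivrMr// ltr_pMr// ltr1n.
  move=> /he; rewrite /= sub0r normrN linearZ_fun// rnormE rnormCZ gtr0_norm//.
  rewrite (_ : 1 = 1%:C) // ltcR => /ltW.
  rewrite -ler_pdivlMl// => /le_trans; apply.
  by rewrite mulr1 /k !invf_div mulrC.
move=> [C [C0 TC]] x; apply/cvgrPdist_lt => e e0.
have [d d0 de] : exists2 d : R, 0 < d & e = d%:C.
  exists (complex.Re e); last by rewrite RRe_real// gtr0_real.
  by rewrite -ltcR RRe_real// gtr0_real.
rewrite de; apply/nbhs_ballP; exists (d / (C + 1))%:C => /=.
  by rewrite ltcR divr_gt0// ltr_wpDl.
move=> y; rewrite -ball_normE /= rnormE ltcR => xy.
rewrite -linearB_fun// rnormE ltcR (le_lt_trans (TC _))//.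
have C1 : 0 < C + 1 by rewrite ltr_wpDl.
rewrite ltr_pdivlMr// in xy; apply: le_lt_trans xy.
by rewrite mulrC ler_wpM2l ?rnorm_ge0// lerDl.
Qed.

End operator_norm.

Section hilbert.
Context {R : realType} {H : completeNormedModType R[i]}.
Variable ip : {dot H for @Num.conj R[i]}.
Implicit Types (x y z : H) (T S : H -> H).

Lemma ipDl x y z : ip (x + y) z = ip x z + ip y z.
Proof. exact: linearDl. Qed.
Lemma ipDr x y z : ip x (y + z) = ip x y + ip x z.
Proof. exact: linearD. Qed.
Lemma ipZl (k : R[i]) x y : ip (k *: x) y = k * ip x y.
Proof. exact: linearZl_LR. Qed.
Lemma ipZr (k : R[i]) x y : ip x (k *: y) = k^* * ip x y.
Proof. exact: linearZr_LR. Qed.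
Lemma ipC x y : ip x y = (ip y x)^*.
Proof. by have := hermC ip x y; rewrite expr0 mul1r. Qed.

(** Estimates are made with the real inner product; [ip_re] recovers [ip] through multiplication by
    ['i]. *)
Definition re x y : R := complex.Re (ip x y).

Lemma reDl x y z : re (x + y) z = re x z + re y z.
Proof. by rewrite /re ipDl raddfD. Qed.
Lemma reDr x y z : re x (y + z) = re x y + re x z.
Proof. by rewrite /re ipDr raddfD. Qed.
Lemma reC x y : re x y = re y x.
Proof. by rewrite /re ipC; case: (ip y x). Qed.
Lemma reZl (k : R) x y : re (k%:C *: x) y = k * re x y.
Proof. by rewrite /re ipZl; case: (ip x y) => a b /=; rewrite mul0r subr0. Qed.
Lemma reZr (k : R) x y : re x (k%:C *: y) = k * re x y.
Proof. by rewrite reC reZl reC. Qed.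
Lemma reNl x y : re (- x) y = - re x y.
Proof. by rewrite -mulN1r -reZl rmorphN1 scaleN1r. Qed.
Lemma reNr x y : re x (- y) = - re x y.
Proof. by rewrite reC reNl reC. Qed.
Lemma reBl x y z : re (x - y) z = re x z - re y z.
Proof. by rewrite reDl reNl. Qed.
Lemma reBr x y z : re x (y - z) = re x y - re x z.
Proof. by rewrite reDr reNr. Qed.
Lemma re0l x : re 0 x = 0.
Proof. by rewrite -(subrr x) reBl subrr. Qed.
Lemma re_i x y : re ('i *: x) y = - re x ('i *: y).
Proof. by rewrite /re ipZl ipZr; case: (ip x y) => a b /=; ring. Qed.
Lemma ip_re x y : ip x y = re x y +i* re x ('i *: y).
Proof.
by rewrite /re ipZr; case: (ip x y) => a b /=; congr (_ +i* _); ring.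
Qed.

Hypothesis hn : hilbert_norm ip.

Lemma re_sqr x : re x x = rnorm x ^+ 2.
Proof. by rewrite /re -hn rnormE -rmorphXn. Qed.

Lemma re_eq0 x : (forall y, re x y = 0) -> x = 0.
Proof.
move=> /(_ x); rewrite re_sqr => /eqP; rewrite sqrf_eq0 => /eqP; exact: rnorm_eq0.
Qed.

Lemma re_inj x y : (forall z, re x z = re y z) -> x = y.
Proof.
by move=> h; apply/eqP; rewrite -subr_eq0; apply/eqP/re_eq0 => z; rewrite reBl h subrr.
Qed.

(** Cauchy-Schwarz, from the squared norm of [(rnorm y)%:C *: x - (rnorm x)%:C *: y]. *)
Lemma re_le x y : re x y <= rnorm x * rnorm y.
Proof.
have [->|x0] := eqVneq x 0; first by rewrite re0l mulr_ge0 ?rnorm_ge0.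
have [->|y0] := eqVneq y 0; first by rewrite reC re0l mulr_ge0 ?rnorm_ge0.
have pos z : z != 0 -> 0 < rnorm z.
  by move=> z0; rewrite lt_def rnorm_ge0 andbT; apply: contra_neq z0; exact: rnorm_eq0.
have ab : 0 < rnorm x * rnorm y by rewrite mulr_gt0 ?pos.
have := sqr_ge0 (rnorm ((rnorm y)%:C *: x - (rnorm x)%:C *: y)).
rewrite -re_sqr !(reBl, reBr, reZl, reZr) !re_sqr (reC y x) => h.
rewrite -(ler_pM2l ab); move: h.
by set u := rnorm x; set v := rnorm y; set w := re x y; nra.
Qed.

Lemma re_norm_le x y : `|re x y| <= rnorm x * rnorm y.
Proof. by rewrite ler_norml re_le andbT lerNl -reNl -(rnormN x) re_le. Qed.

Lemma hcvg_re (u : nat -> H) l y : hcvg u l -> re (u n) y @[n --> \oo] --> re l y.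
Proof.
move=> ul; apply/cvgrPdist_le => e e0.
have e1 : 0 < e / (rnorm y + 1) by rewrite divr_gt0// ltr_wpDl// rnorm_ge0.
have [N hN] := (hcvgP _ _).1 ul _ e1; exists N => //= n Nn.
rewrite -reBl (le_trans (re_norm_le _ _))// rnorm_distC.
have y1 : 0 < rnorm y + 1 by rewrite ltr_wpDl// rnorm_ge0.
apply: (@le_trans _ _ (e / (rnorm y + 1) * (rnorm y + 1))).
  by rewrite ler_pM ?rnorm_ge0 ?hN// lerDl.
by rewrite divfK// gt_eqF.
Qed.

Definition sym T := forall x y, re (T x) y = re x (T y).

Lemma sym_adjoint T : linear T -> sym T <-> is_adjoint ip T T.
Proof.
move=> lT; split=> [sT x y|aT x y]; last by rewrite /re aT.
by rewrite !ip_re !sT (linearZ_fun _ _ lT).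
Qed.

Lemma sym_real T x : linear T -> sym T -> ip (T x) x = (re (T x) x)%:C.
Proof.
move=> lT sT; rewrite ip_re; congr (_ +i* _).
have : re (T x) ('i *: x) = - re (T x) ('i *: x).
  by rewrite {1}sT (linearZ_fun _ _ lT) (reC x) re_i.
by lra.
Qed.

(** Polarizing at [T x] and at ['i *: T x] shows that the sum and the difference of [<T x, T x>] and
    [<T (T x), x>] vanish. This is what makes [borel_calculus] single-valued. *)
Lemma polarization T : linear T -> (forall x, ip (T x) x = 0) -> T = 0.
Proof.
move=> lT h; apply/funext => x.
suff : ip (T x) (T x) = 0 by rewrite -hn => /eqP; rewrite sqrf_eq0 => /eqP/normr0_eq0.
have pol u v : ip (T u) v + ip (T v) u = 0.
  by have := h (u + v); rewrite (linearD_fun lT) ipDl !ipDr !h add0r addr0.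
have h1 := pol x (T x); have := pol x ('i *: T x).
rewrite (linearZ_fun _ _ lT) ipZl ipZr => h2; move: h1 h2.
case: (ip (T x) _) => a b; case: (ip (T (T x)) x) => c d /eqP.
rewrite eq_complex /= => /andP[/eqP h1 /eqP h2] /eqP.
rewrite eq_complex /= => /andP[/eqP h3 /eqP h4].
by congr (_ +i* _); lra.
Qed.

End hilbert.

(** * Functional calculus of self-adjoint operators *)

Section polynomial_of_operator.
Context {R : realType} {H : completeNormedModType R[i]}.
Variable a : H -> H.
Hypothesis la : linear a.
Implicit Types (p q : {poly R}) (x y : H).

(** The coefficients are real, so that [p(a)] is again symmetric when [a] is. *)
Definition pop p x : H := \sum_(i < size p) (p`_i)%:C *: iter i a x.

Lemma pop_widen n p x : (size p <= n)%N ->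
  pop p x = \sum_(i < n) (p`_i)%:C *: iter i a x.
Proof.
move=> pn; rewrite /pop (big_ord_widen _ (fun i => (p`_i)%:C *: iter i a x) pn).
rewrite big_mkcond; apply: eq_bigr => i _; case: ltnP => // pi.
by rewrite nth_default// scale0r.
Qed.

Lemma popD p q x : pop (p + q) x = pop p x + pop q x.
Proof.
set n := maxn (size p) (size q).
rewrite !(@pop_widen n) ?leq_maxl ?leq_maxr ?size_polyD// -big_split.
by apply: eq_bigr => i _ /=; rewrite coefD rmorphD scalerDl.
Qed.

Lemma popZ (k : R) p x : pop (k *: p) x = k%:C *: pop p x.
Proof.
rewrite (@pop_widen (size p)) ?size_scale_leq// scaler_sumr.
by apply: eq_bigr => i _; rewrite coefZ rmorphM scalerA.
Qed.

Lemma popC (k : R) x : pop k%:P x = k%:C *: x.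
Proof.
rewrite (@pop_widen 1) ?size_polyC ?leq_b1// big_ord1 coefC eqxx.
by [].
Qed.

Lemma popMX p x : pop (p * 'X) x = a (pop p x).
Proof.
rewrite (@pop_widen (size p).+1); last first.
  by rewrite (leq_trans (size_polyMleq _ _))// size_polyX addn2.
rewrite big_ord_recl coefMX /= scale0r add0r /pop.
elim/big_rec2: _ => [|i y z _ ->]; first by rewrite linear0_fun.
by rewrite la coefMX.
Qed.

Lemma pop0 x : pop 0 x = 0.
Proof. by rewrite /pop size_poly0 big_ord0. Qed.

Lemma pop1 x : pop 1 x = x.
Proof. by rewrite popC scale1r. Qed.

Lemma popX x : pop 'X x = a x.
Proof. by rewrite -['X]mul1r popMX pop1. Qed.

Lemma popB p q x : pop (p - q) x = pop p x - pop q x.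
Proof. by rewrite popD -scaleN1r popZ rmorphN1 scaleN1r. Qed.

Lemma popMXD p (k : R) x : pop (p * 'X + k%:P) x = a (pop p x) + k%:C *: x.
Proof. by rewrite popD popMX popC. Qed.

Lemma popM p q x : pop (p * q) x = pop p (pop q x).
Proof.
elim/poly_ind: p => [|p k IH]; first by rewrite mul0r !pop0.
by rewrite popMXD -IH mulrDl mulrAC popD popMX mul_polyC popZ.
Qed.

Lemma pop_linear p : linear (pop p).
Proof.
elim/poly_ind: p => [|p k IH] l x y; first by rewrite !pop0 scaler0 addr0.
rewrite !popMXD IH la !scalerDr addrACA; congr (_ + (_ + _)).
by rewrite !scalerA mulrC.
Qed.

Lemma pop_commute (T : H -> H) p x : linear T -> (forall y, T (a y) = a (T y)) ->
  T (pop p x) = pop p (T x).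
Proof.
move=> lT Ta; elim/poly_ind: p => [|p k IH]; first by rewrite !pop0 linear0_fun.
by rewrite !popMXD linearD_fun// linearZ_fun// Ta IH.
Qed.

Lemma popXn n x : pop 'X^n x = iter n a x.
Proof.
elim: n => [|n IH]; first by rewrite expr0 pop1.
by rewrite exprSr popMX IH.
Qed.

End polynomial_of_operator.

Lemma pop_comp {R : realType} {H : completeNormedModType R[i]} (a : H -> H)
    (p q : {poly R}) x : linear a -> pop (pop a q) p x = pop a (p \Po q) x.
Proof.
move=> la; have lq := pop_linear la q.
elim/poly_ind: p => [|p k IH]; first by rewrite comp_poly0 !pop0.
rewrite popMXD// IH comp_polyD comp_polyM comp_polyX comp_polyC.
by rewrite popD// popC mulrC popM.
Qed.

Lemma pop_sym {R : realType} {H : completeNormedModType R[i]}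
    (ip : {dot H for @Num.conj R[i]}) (a : H -> H) (p : {poly R}) :
  linear a -> sym ip a -> sym ip (pop a p).
Proof.
move=> la sa; elim/poly_ind: p => [|p k IH] x y.
  by rewrite !pop0 re0l reC re0l.
rewrite !popMXD// reDl reDr reZl reZr sa IH; congr (re _ _ _ + _).
by apply: (esym (pop_commute la _ _ la _)).
Qed.

Lemma real_cvg_unique {R : realType} (u : nat -> R) (l k : R) :
  u @ \oo --> l -> u @ \oo --> k -> l = k.
Proof.
by move=> /(cvg_lim (@Rhausdorff R)) <- /(cvg_lim (@Rhausdorff R)) <-.
Qed.

Lemma even_odd_split (k : nat) : k = (k./2 + k./2 + odd k)%N.
Proof. by rewrite addnn addnC odd_double_half. Qed.

(** The even powers form a square [W * W], one factor of which moves across by symmetry. There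
    remain exponents 0 and 1: [c + a], [c - a] and their product are positive because [a] is bounded
    by [c]. *)
Lemma pop_bernstein_ge0 {R : realType} {H : completeNormedModType R[i]}
    (ip : {dot H for @Num.conj R[i]}) (hn : hilbert_norm ip) (a : H -> H)
    (c : R) (x : H) (k l : nat) :
  linear a -> sym ip a -> op_bound a c ->
  0 <= re ip (pop a ((c%:P + 'X) ^+ k * (c%:P - 'X) ^+ l) x) x.
Proof.
move=> la sa [c0 ac].
pose W : {poly R} := (c%:P + 'X) ^+ k./2 * (c%:P - 'X) ^+ l./2.
pose V : {poly R} := (c%:P + 'X) ^+ odd k * (c%:P - 'X) ^+ odd l.
have -> : (c%:P + 'X) ^+ k * (c%:P - 'X) ^+ l = W * (V * W).
  rewrite {1}(even_odd_split k) {1}(even_odd_split l) !exprD /W /V; ring.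
rewrite (popM la W) (popM la V) (pop_sym _ la sa); set y := pop a W x.
have aB : `|re ip (a y) y| <= c * rnorm y ^+ 2.
  rewrite (le_trans (re_norm_le hn _ _))// expr2 mulrA ler_wpM2r ?rnorm_ge0//.
move: aB; rewrite ler_norml => /andP[h1 h2].
have plus : pop a (c%:P + 'X) y = c%:C *: y + a y by rewrite popD popC popX.
have minus : pop a (c%:P - 'X) y = c%:C *: y - a y by rewrite popB popC popX.
rewrite /V; case: (odd k); case: (odd l); rewrite ?expr0 ?expr1 ?mulr1 ?mul1r.
- rewrite popM// minus (linearB_fun (pop_linear la _)).
  rewrite (linearZ_fun _ _ (pop_linear la _)) plus popD popC popX//.
  rewrite !(reBl, reDl, reZl) (sa (a y)) !(re_sqr hn).
  have : rnorm (a y) ^+ 2 <= (c * rnorm y) ^+ 2.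
    by rewrite lerXn2r ?nnegrE ?mulr_ge0 ?rnorm_ge0.
  by rewrite exprMn; nra.
- by rewrite plus reDl reZl (re_sqr hn); lra.
- by rewrite minus reBl reZl (re_sqr hn); lra.
- by rewrite pop1 (re_sqr hn) sqr_ge0.
Qed.

(** * Functions of an operator as strong limits of polynomials *)

Section calculus.
Context {R : realType} {H : completeNormedModType R[i]}.
Variable ip : {dot H for @Num.conj R[i]}.
Hypothesis hn : hilbert_norm ip.
Implicit Types (a T S : H -> H) (x y : H) (f g : R -> R) (q r : nat -> {poly R}).

(** In contrast to [spectral_measure], the interval is a parameter and all polynomials are tested;
    [spectral_bound] asks for one interval for all vectors. *)
Definition scalar_measure a (d : R) x (m : {finite_measure set R -> \bar R}) :=
  m (~` `[- d, d]%classic) = 0%E /\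
  forall p : {poly R}, re ip (pop a p x) x = \int[m]_(t in `[- d, d]) p.[t].

Definition spectral_bound a (d : R) :=
  [/\ linear a, sym ip a & forall x, exists m, scalar_measure a d x m].

(** [p |-> re ip (pop a p x) x] is nonnegative on the Bernstein products; the 2 comes from the
    support found in [hausdorff_moment]. *)
Lemma spectral_bound_of_op_bound a c : 0 < c ->
  linear a -> sym ip a -> op_bound a c -> spectral_bound a (c + 2).
Proof.
move=> c0 la sa ac; split=> // x.
pose phi (p : {poly R}) : R := re ip (pop a p x) x.
have phi_lin : scalar phi.
  by move=> k p q; rewrite /phi popD popZ reDl reZl.
pose phiL : {scalar {poly R}} :=
  HB.pack phi (GRing.isLinear.Build R {poly R} R *%R phi phi_lin).
have [||m m0 mp] := @hausdorff_moment _ c phiL; first by [].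
  by move=> k l; exact: pop_bernstein_ge0.
exists m; split => // p; rewrite -[LHS]/(phiL p) mp.
by apply: Rintegral_support => //; exact: measurable_poly.
Qed.

Variables (a : H -> H) (d : R).
Hypothesis ad : spectral_bound a d.

Let la : linear a. Proof. by case: ad. Qed.
Let sa : sym ip a. Proof. by case: ad. Qed.

Lemma rnorm_pop_sqr p x m : scalar_measure a d x m ->
  rnorm (pop a p x) ^+ 2 = \int[m]_(t in `[- d, d]) (p ^+ 2).[t].
Proof.
move=> [_ <-]; rewrite -(re_sqr hn) -(pop_sym _ la sa).
by rewrite -popM// expr2.
Qed.

Lemma rnorm_sqr_measure x m : scalar_measure a d x m ->
  rnorm x ^+ 2 = fine (m `[- d, d]%classic).
Proof.
move=> [_ h]; have := h 1; rewrite pop1 (re_sqr hn) => ->.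
rewrite (@eq_Rintegral _ _ _ m _ (fun=> 1)); last by move=> t _; rewrite hornerE.
by rewrite Rintegral_cst// mul1r.
Qed.

(** [|p(a) x|^2] is the integral of [p ^+ 2] against the measure of [x], whose mass is [|x|^2]. *)
Lemma rnorm_pop_le p (K : R) x : 0 <= K ->
  (forall t : R, `|t| <= d -> `|p.[t]| <= K) -> rnorm (pop a p x) <= K * rnorm x.
Proof.
move=> K0 pK; have [_ _ /(_ x)[m xm]] := ad.
have Kx : 0 <= K * rnorm x by rewrite mulr_ge0 ?rnorm_ge0.
rewrite -(@ler_pXn2r _ 2) ?nnegrE ?rnorm_ge0// exprMn.
rewrite (rnorm_pop_sqr _ xm) (rnorm_sqr_measure xm) -Rintegral_cst//.
apply: le_Rintegral => //.
- by have [] := poly_limit_integrable m (poly_limit_cst d (p ^+ 2)).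
- have [] := poly_limit_integrable m (poly_limit_cst d (K ^+ 2)%:P).
  by move=> h _; move: h; congr (_.-integrable _ _); apply/funext => t /=; rewrite hornerC.
- move=> t /normr_itv td; rewrite hornerE -(real_normK (num_real p.[t])).
  by rewrite lerXn2r ?nnegrE// pK.
Qed.

(* [T = f(a)], for functions that are bounded limits of polynomials. *)
Definition calc f T := exists q, poly_limit d f q /\
  forall x, hcvg (fun n => pop a (q n) x) (T x).

Lemma calc_exists f q : poly_limit d f q -> exists T, calc f T.
Proof.
move=> qf; suff : forall x, exists y, hcvg (fun n => pop a (q n) x) y.
  by move=> /choice[T hT]; exists T, q.
move=> x; apply: hcomplete => e e0.
have [_ _ /(_ x)[m xm]] := ad.
have [N hN] := poly_limit_integral_sqr m qf (exprn_gt0 2 e0).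
exists N => n k Nn Nk; rewrite -popB.
rewrite -(@ler_pXn2r _ 2) ?nnegrE ?rnorm_ge0 ?(ltW e0)//.
by rewrite (rnorm_pop_sqr _ xm) hN.
Qed.

Lemma calc_poly (p : {poly R}) : calc (horner p) (pop a p).
Proof.
by exists (fun=> p); split; [exact: poly_limit_cst|move=> x; exact: hcvg_cst].
Qed.

Lemma calc_linear f T : calc f T -> linear T.
Proof.
move=> [q [_ qT]] k x y; apply: hcvg_unique (qT _) _.
rewrite (_ : (fun n => _) = fun n => k *: pop a (q n) x + pop a (q n) y).
  by apply: hcvgD => //; exact: hcvgZ.
by apply/funext => n; rewrite pop_linear.
Qed.

Lemma calc_sym f T : calc f T -> sym ip T.
Proof.
move=> [q [_ qT]] x y.
have h1 := hcvg_re hn (y := y) (qT x).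
suff h2 : re ip (pop a (q n) x) y @[n --> \oo] --> re ip x (T y).
  exact: real_cvg_unique h1 h2.
rewrite reC; apply: cvg_trans (hcvg_re hn (y := x) (qT y)).
by apply: near_eq_cvg; apply: nearW => n; rewrite (pop_sym _ la sa) reC.
Qed.

Lemma calc_bound f T : calc f T -> exists C, op_bound T C.
Proof.
move=> [q [[[K qK] _] qT]]; exists `|K|; split => // x.
apply: cvgr_to_le (hcvg_rnorm (qT x)) _; apply: nearW => n.
apply: rnorm_pop_le => // t td; rewrite (le_trans (qK n t td))//.
exact: ler_norm.
Qed.

Lemma calc_bounded_op f T : calc f T -> bounded_op T.
Proof.
move=> fT; have lT := calc_linear fT; split=> //.
by apply/(linear_continuous_bounded lT); exact: calc_bound fT.
Qed.

Lemma calc_integral f T x m : calc f T -> scalar_measure a d x m ->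
  re ip (T x) x = \int[m]_(t in `[- d, d]) f t.
Proof.
move=> [q [qf qT]] xm.
have h1 := hcvg_re hn (y := x) (qT x).
have [_ h2] := poly_limit_integrable m qf.
suff h3 : re ip (pop a (q n) x) x @[n --> \oo] --> \int[m]_(t in `[- d, d]) f t.
  exact: real_cvg_unique h1 h3.
apply: cvg_trans h2.
by apply: near_eq_cvg; apply: nearW => n; rewrite xm.2.
Qed.

(** The error is [q_n(a) (r_n(a) x - S x) + (q_n(a) - T) (S x)]; the first term is small because the
    [q_n(a)] are bounded uniformly in [n]. *)
Lemma calcM f g T S : calc f T -> calc g S -> calc (fun t => f t * g t) (T \o S).
Proof.
move=> [q [qf qT]] [r [rg rS]]; exists (fun n => q n * r n); split.
  exact: poly_limitM.
move=> x; have [[K qK] _] := qf.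
apply: (@hcvg_le _ _ _ _ (fun n => `|K| * rnorm (pop a (r n) x - S x) +
  rnorm (pop a (q n) (S x) - T (S x)))).
  rewrite -[X in _ --> X]addr0; apply: cvgD; last exact: qT.
  by rewrite -[X in _ --> X](mulr0 `|K|); apply: cvgMr; exact: rS.
move=> n; rewrite popM//.
rewrite -[_ - _](subrKA (pop a (q n) (S x))) (le_trans (rnormD _ _))// lerD2r.
rewrite -(linearB_fun (pop_linear la _)) rnorm_pop_le// => t td.
by rewrite (le_trans (qK n t td))// ler_norm.
Qed.

Lemma calcB f g T S : calc f T -> calc g S ->
  calc (fun t => f t - g t) (fun x => T x - S x).
Proof.
move=> [q [[[K qK] qf] qT]] [r [[[K' rK] rg] rS]]; exists (fun n => q n - r n).
split; first split.
- exists (K + K') => n t td; rewrite !hornerE (le_trans (ler_normB _ _))//.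
  by rewrite lerD ?qK ?rK.
- move=> t td; under eq_fun do rewrite !hornerE.
  by apply: cvgB; [exact: qf|exact: rg].
- move=> x; under eq_fun do rewrite popB.
  exact: hcvgB.
Qed.

(** Squared norms are integrals of squares, so pointwise inequalities on [[- d, d]] become norm
    inequalities. The identities between spectral projections come from this through [calc_eq]. *)
Lemma calc_le f g T S (k : R) : calc f T -> calc g S -> 0 <= k ->
  (forall t : R, `|t| <= d -> `|f t| <= k * `|g t|) ->
  forall x, rnorm (T x) <= k * rnorm (S x).
Proof.
move=> fT gS k0 fg x; have [_ _ /(_ x)[m xm]] := ad.
rewrite -(@ler_pXn2r _ 2) ?nnegrE ?mulr_ge0 ?rnorm_ge0// exprMn.
have sq h Q : calc h Q -> rnorm (Q x) ^+ 2 = \int[m]_(t in `[- d, d]) (h t * h t) /\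
    m.-integrable `[- d, d]%classic (EFin \o (fun t => h t * h t)).
  move=> hQ; have hh := calcM hQ hQ.
  rewrite -(calc_integral hh xm) /= -(re_sqr hn) (calc_sym hQ) reC; split => //.
  by have [q [qf _]] := hh; have [] := poly_limit_integrable m qf.
have [-> fi] := sq _ _ fT; have [-> gi] := sq _ _ gS.
rewrite -RintegralZl//; apply: le_Rintegral => //.
  have -> : EFin \o (fun t => k ^+ 2 * (g t * g t)) =
    (fun t => (k ^+ 2)%:E * (EFin \o (fun t => (g t * g t)%R)) t)%E by apply/funext.
  exact: integrableZl.
move=> t /normr_itv td; rewrite -!expr2 -exprMn -(real_normK (num_real (f t))).
rewrite -[leRHS](real_normK (num_real _)) lerXn2r ?nnegrE// normrM (ger0_norm k0).
exact: fg.
Qed.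

(** The case [k = 0] applied to [T - S]; in particular [f(a)] does not depend on the approximating
    polynomials. *)
Lemma calc_eq f g T S : calc f T -> calc g S ->
  (forall t : R, `|t| <= d -> f t = g t) -> T = S.
Proof.
move=> fT gS fg; apply/funext => x; apply/eqP; rewrite -subr_eq0; apply/eqP.
apply: rnorm_eq0; apply/eqP; rewrite eq_le rnorm_ge0 andbT.
rewrite -(mul0r (rnorm (S x))).
apply: (calc_le (calcB fT gS) gS) => // t td.
by rewrite fg// subrr normr0 mul0r.
Qed.

Lemma calc_commute f T S : calc f T -> bounded_op S ->
  (forall x, S (a x) = a (S x)) -> forall x, S (T x) = T (S x).
Proof.
move=> [q [_ qT]] [lS /(linear_continuous_bounded lS)[C [C0 SC]]] Sa x.
apply: (@hcvg_unique _ _ (fun n => S (pop a (q n) x))).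
  apply: (@hcvg_le _ _ _ _ (fun n => C * rnorm (pop a (q n) x - T x))).
    by rewrite -[X in _ --> X](mulr0 C); apply: cvgMr; exact: qT.
  by move=> n; rewrite -(linearB_fun lS).
by under eq_fun do rewrite (pop_commute la _ _ lS Sa); exact: qT.
Qed.

End calculus.

(** * Spectral projections of half-lines *)

Section spectral_projections.
Context {R : realType} {H : completeNormedModType R[i]}.
Variable ip : {dot H for @Num.conj R[i]}.
Hypothesis hn : hilbert_norm ip.
Implicit Types (a T S : H -> H) (x y : H) (f g : R -> R).

Lemma scalar_measure_widen a d D x m : linear a -> d <= D ->
  scalar_measure ip a d x m -> scalar_measure ip a D x m.
Proof.
move=> la dD [m0 mp]; have mD : m (~` `[- D, D]%classic) = 0%E.
  apply/negligibleP; first exact: measurableC.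
  apply: (@negligibleS _ _ _ _ (~` `[- d, d]%classic)); last first.
    by apply/negligibleP => //; exact: measurableC.
  apply: subsetC => t /=; rewrite !in_itv/= => /andP[h1 h2].
  by rewrite (le_trans _ h1) ?lerN2//= (le_trans h2).
split => // p; rewrite mp -!(@Rintegral_support _ m)//; exact: measurable_poly.
Qed.

Lemma scalar_measure_spectral a d x m : linear a -> sym ip a ->
  scalar_measure ip a d x m -> spectral_measure ip a x m.
Proof.
move=> la sa [m0 mp]; split; first by exists d.
move=> n; rewrite -popXn// sym_real//; last 2 first.
- exact: pop_linear.
- exact: pop_sym.
rewrite mp -(Rintegral_support _ _ m0)//; last exact: measurable_poly.
by congr (_%:C); apply: eq_Rintegral => t _; rewrite hornerXn.
Qed.

Lemma spectral_measure_scalar a x m : linear a -> spectral_measure ip a x m ->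
  exists d, scalar_measure ip a d x m.
Proof.
move=> la [[c mc] mn]; exists c; split => // p.
pose P p := re ip (pop a p x) x = \int[m]_(t in `[- c, c]) p.[t].
have pint q : m.-integrable `[- c, c]%classic (EFin \o horner q).
  by have [] := poly_limit_integrable m (poly_limit_cst c q).
rewrite -/(P p) -(coefK p) poly_def; elim/big_rec: _ => [|i q _ Pq].
  rewrite /P pop0 re0l (@eq_Rintegral _ _ _ m _ (fun=> 0)).
    by rewrite Rintegral_cst// mul0r.
  by move=> t _; rewrite horner0.
rewrite /P popD popZ reDl reZl Pq popXn// /re mn /=.
under [RHS]eq_Rintegral do rewrite hornerD hornerZ.
rewrite RintegralD//; last first.
  have := pint (p`_i *: 'X^i); congr (_.-integrable _ _).
  by apply/funext => t /=; rewrite hornerZ.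
congr (_ + _); rewrite RintegralZl//; congr (_ * _).
rewrite (@Rintegral_support _ m `[- c, c]%classic)//.
by apply: eq_Rintegral => t _; rewrite hornerXn.
Qed.

Lemma scalar_measure_unique a d x m m' f q : poly_limit d f q ->
  scalar_measure ip a d x m -> scalar_measure ip a d x m' ->
  \int[m]_(t in `[- d, d]) f t = \int[m']_(t in `[- d, d]) f t.
Proof.
move=> qf [_ mp] [_ mp'].
have [_ h1] := poly_limit_integrable m qf.
have [_ h2] := poly_limit_integrable m' qf.
apply: real_cvg_unique h1 _; apply: cvg_trans h2.
by apply: near_eq_cvg; apply: nearW => n; rewrite -mp -mp'.
Qed.

(* Half-lines are the only Borel sets whose spectral projections occur. *)
Definition limit_set (E : set R) := measurable E /\
  forall d, exists q, poly_limit d \1_E q.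

Lemma limit_set_le s : limit_set `]-oo, s]%classic.
Proof. by split => // d; exact: poly_limit_step. Qed.

Lemma indic_gt (s t : R) :
  \1_`]s, +oo[%classic t = 1 - \1_`]-oo, s]%classic t :> R.
Proof.
rewrite !indicE !mem_setE !in_itv/= andbT leNgt.
by case: (s < t) => /=; rewrite ?subr0 ?subrr.
Qed.

Lemma limit_set_gt s : limit_set `]s, +oo[%classic.
Proof.
split => // d; have [q qs] := poly_limit_step d s; exists (fun n => 1 - q n).
have := poly_limitC qs; congr (poly_limit _ _ _).
by apply/funext => t; rewrite indic_gt.
Qed.

(** The limit [T0] of polynomials meets the specification under [xget], so the chosen [T] meets it
    too. Their measures at [x] may differ in support, but they share all moments, hence the integral
    of [\1_E] over a common interval; [polarization] gives [T = T0]. *)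
Lemma spectral_projection_calc a d E : spectral_bound ip a d -> limit_set E ->
  calc a d \1_E (spectral_projection ip E a).
Proof.
move=> ad [mE Eq]; have [la sa am] := ad; have [q qE] := Eq d.
have [T0 calcT0] := calc_exists hn ad qE.
have T0P : [set T | bounded_op T /\ forall x, exists2 m, spectral_measure ip a x m &
    ip (T x) x = (\int[m]_t \1_E t)%:C] T0.
  split; first exact: (calc_bounded_op hn ad calcT0).
  move=> x; have [m xm] := am x; exists m; first exact: scalar_measure_spectral xm.
  rewrite (sym_real _ (calc_linear ad calcT0) (calc_sym hn ad calcT0)).
  rewrite (calc_integral hn calcT0 xm); congr (_%:C).
  by apply/esym/Rintegral_support => //; exact: xm.1.
set T := spectral_projection ip E a.
have [[lT _] TP] : [set T | bounded_op T /\ forall x,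
    exists2 m, spectral_measure ip a x m & ip (T x) x = (\int[m]_t \1_E t)%:C] T.
  exact: xgetPex (ex_intro _ T0 T0P).
suff -> : T = T0 by [].
have lT0 := calc_linear ad calcT0.
suff h : (fun x => T x - T0 x) = 0.
  apply/funext => x; apply/eqP; rewrite -subr_eq0.
  by rewrite -[X in X == _]/((fun x => T x - T0 x) x) h.
apply: (polarization hn) => [k x y|x].
  by rewrite lT lT0 scalerBr opprD addrACA.
have [m' /(spectral_measure_scalar la)[c xm'] Tx] := TP x.
have [m xm] := am x; pose D := Num.max c d.
have cD : c <= D by rewrite le_max lexx.
have dD : d <= D by rewrite le_max lexx orbT.
rewrite -scaleN1r ipDl ipZl Tx (sym_real _ lT0 (calc_sym hn ad calcT0)) mulN1r.
rewrite (calc_integral hn calcT0 xm) -(Rintegral_support _ _ xm.1)//; last first.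
have xmD := scalar_measure_widen la dD xm.
have xmD' := scalar_measure_widen la cD xm'.
have [qD qDE] := Eq D.
rewrite (Rintegral_support _ _ xmD.1)// (Rintegral_support _ _ xmD'.1)//.
by rewrite (scalar_measure_unique qDE xmD xmD') subrr.
Qed.

Definition sa_op a := [/\ linear a, sym ip a & exists C, op_bound a C].

(** [c] allows the interval to be as large as needed, as for [pop a p], whose interval has to
    contain the values of [p]. *)
Lemma sa_op_spectral_bound a c : sa_op a ->
  exists d, c <= d /\ spectral_bound ip a d.
Proof.
move=> [la sa [C [C0 aC]]]; pose D := C + `|c| + 1.
have D0 : 0 < D by rewrite ltr_wpDl// addr_ge0.
exists (D + 2); split.
  by rewrite /D (le_trans (ler_norm c))//; lra.
apply: spectral_bound_of_op_bound => //; split; first exact: ltW.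
move=> x; rewrite (le_trans (aC x))// ler_wpM2r ?rnorm_ge0// /D.
by have := normr_ge0 c; lra.
Qed.

Lemma calc_comp a d d' (r : {poly R}) f T : linear a ->
  (forall t : R, `|t| <= d -> `|r.[t]| <= d') ->
  calc (pop a r) d' f T -> calc a d (fun t => f r.[t]) T.
Proof.
move=> la rd [q [[[K qK] qf] qT]]; exists (fun n => q n \Po r); split; first split.
- by exists K => n t td; rewrite horner_comp qK// rd.
- by move=> t td; under eq_fun do rewrite horner_comp; apply: qf; exact: rd.
- by move=> x; under eq_fun do rewrite -pop_comp//; exact: qT.
Qed.

Lemma sa_op_pop a p : sa_op a -> sa_op (pop a p).
Proof.
move=> sa; have [d [_ ad]] := sa_op_spectral_bound 0 sa.
case: sa => la sa _; split; [exact: pop_linear|exact: pop_sym|].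
exact: (calc_bound hn ad (calc_poly a d p)).
Qed.

Definition Ele s a := spectral_projection ip `]-oo, s]%classic a.
Definition Egt s a := spectral_projection ip `]s, +oo[%classic a.

(** Projections of [a - s] and [s - a] become functions of [a] itself and can be compared with those
    of [a]. *)
Lemma sa_op_calc2 a (p : {poly R}) E : sa_op a -> limit_set E ->
  forall c, exists d, [/\ c <= d, spectral_bound ip a d &
    calc a d (fun t => \1_E p.[t]) (spectral_projection ip E (pop a p))].
Proof.
move=> sa Eq c; have [d [cd ad]] := sa_op_spectral_bound c sa.
have [C C0 pC] := poly_lipschitz p d.
have [d' [Cd' bd']] := sa_op_spectral_bound C (sa_op_pop p sa).
exists d; split => //; apply: (@calc_comp _ _ d'); first by case: sa.
  by move=> t td; have [h _] := pC t t td td; rewrite (le_trans h).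
exact: spectral_projection_calc.
Qed.

End spectral_projections.

(** * Order, shift, reflection and continuity of spectral projections *)

Section spectral_projection_theory.
Context {R : realType} {H : completeNormedModType R[i]}.
Variable ip : {dot H for @Num.conj R[i]}.
Hypothesis hn : hilbert_norm ip.
Implicit Types (a T S : H -> H) (x y : H) (E F : set R).

Local Notation sp E a := (spectral_projection ip E a).
Local Notation sa_op := (sa_op ip).

Lemma sp_calc a E c : sa_op a -> limit_set E ->
  exists d, [/\ c <= d, spectral_bound ip a d & calc a d \1_E (sp E a)].
Proof.
move=> sa Eq; have [d [cd ad]] := sa_op_spectral_bound hn c sa.
by exists d; split => //; exact: spectral_projection_calc.
Qed.

Lemma sp_bounded_op a E : sa_op a -> limit_set E -> bounded_op (sp E a).
Proof.
move=> sa Eq; have [d [_ ad cE]] := sp_calc 0 sa Eq.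
exact: (calc_bounded_op hn ad cE).
Qed.

Lemma sp_sym a E : sa_op a -> limit_set E -> sym ip (sp E a).
Proof.
move=> sa Eq; have [d [_ ad cE]] := sp_calc 0 sa Eq.
exact: (calc_sym hn ad cE).
Qed.

Lemma sp_commute a E S : sa_op a -> limit_set E -> bounded_op S ->
  (forall x, S (a x) = a (S x)) -> forall x, S (sp E a x) = sp E a (S x).
Proof.
move=> sa Eq bS Sa; have [d [_ ad cE]] := sp_calc 0 sa Eq.
exact: (calc_commute ad cE).
Qed.

(** [\1_E p.[t] * \1_F t = \1_F t] for all [t]. *)
Lemma sp_comp_sub a (p : {poly R}) E F : sa_op a -> limit_set E -> limit_set F ->
  (forall t, F t -> E p.[t]) -> forall x, sp E (pop a p) (sp F a x) = sp F a x.
Proof.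
move=> sa Eq Fq FE x; have [d [_ ad cE]] := sa_op_calc2 hn p sa Eq 0.
have cF := spectral_projection_calc hn ad Fq.
suff h : sp E (pop a p) \o sp F a = sp F a by exact: (congr1 (fun T => T x) h).
apply: (calc_eq hn ad (calcM hn ad cE cF) cF) => t _; rewrite !indicE.
by case: (boolP (t \in F)) => [/set_mem/FE/mem_set ->|_]; rewrite ?mulr1// mulr0.
Qed.

Lemma pop_X_id a : linear a -> pop a 'X = a.
Proof. by move=> la; apply/funext => x; rewrite popX. Qed.

Lemma sp_sub a E F : sa_op a -> limit_set E -> limit_set F ->
  F `<=` E -> forall x, sp E a (sp F a x) = sp F a x.
Proof.
move=> sa Eq Fq FE x; have [la _ _] := sa.
by rewrite -{1}(pop_X_id la) sp_comp_sub// => t /FE; rewrite hornerX.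
Qed.

Lemma sp_commC a E F x : sa_op a -> limit_set E -> limit_set F ->
  sp E a (sp F a x) = sp F a (sp E a x).
Proof.
move=> sa Eq Fq; apply: sp_commute => //; first exact: sp_bounded_op.
have [la sy [C Ca]] := sa; move=> y; apply/esym; apply: sp_commute => //.
by split => //; apply/linear_continuous_bounded => //; exists C.
Qed.

Lemma sp_idem a E x : sa_op a -> limit_set E -> sp E a (sp E a x) = sp E a x.
Proof. by move=> sa Eq; apply: sp_sub. Qed.

Lemma sp_projection a E : sa_op a -> limit_set E -> projection ip (sp E a).
Proof.
move=> sa Eq; have bE := sp_bounded_op sa Eq; split => //.
  by apply/(sym_adjoint _ bE.1); exact: sp_sym.
by apply/funext => x /=; exact: sp_idem.
Qed.

Lemma EgtE s a x : sa_op a -> Egt ip s a x = x - Ele ip s a x.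
Proof.
move=> sa; have [d [_ ad cE]] := sp_calc 0 sa (limit_set_le s).
have cF := spectral_projection_calc hn ad (limit_set_gt s).
have cB := calcB (calc_poly a d 1) cE.
have eF : Egt ip s a = (fun x => pop a 1 x - Ele ip s a x).
  by apply: (calc_eq hn ad cF cB) => t _; rewrite indic_gt hornerE.
by rewrite eF pop1.
Qed.

Lemma Ele_Egt0 s t a x : sa_op a -> s <= t -> Ele ip s a (Egt ip t a x) = 0.
Proof.
move=> sa st; rewrite EgtE// linearB_fun; last first.
  by have [] := sp_bounded_op sa (limit_set_le s).
rewrite [X in _ - X]sp_commC//; [|exact: limit_set_le|exact: limit_set_le].
rewrite [X in _ - X]sp_sub ?subrr//; [exact: limit_set_le|exact: limit_set_le|].
by move=> u /=; rewrite !in_itv/= => /le_trans; apply.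
Qed.

(** The half-lines are open on the left, so the indicators of []r, r + 1/(n + 1)]] tend to 0 at
    every point, and the squared distance is the integral of their squares. *)
Lemma Egt_right_cont a (r : R) x : sa_op a ->
  hcvg (fun n => Egt ip (r + n.+1%:R^-1) a x) (Egt ip r a x).
Proof.
move=> sa; have [d [_ ad cr]] := sp_calc 0 sa (limit_set_gt r).
have [_ _ /(_ x)[m xm]] := ad.
pose g (n : nat) (t : R) : R :=
  \1_`](r + n.+1%:R^-1), +oo[%classic t - \1_`]r, +oo[%classic t.
have cg n : calc a d (g n) (fun x => Egt ip (r + n.+1%:R^-1) a x - Egt ip r a x).
  exact: (calcB (spectral_projection_calc hn ad (limit_set_gt _)) cr).
have gE n : rnorm (Egt ip (r + n.+1%:R^-1) a x - Egt ip r a x) ^+ 2 =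
    \int[m]_(t in `[- d, d]) (g n t * g n t).
  have cgg := calcM hn ad (cg n) (cg n).
  rewrite -(calc_integral hn cgg xm) /= -(re_sqr hn).
  by rewrite [RHS](calc_sym hn ad (cg n)).
have gB n t : `|g n t| <= 1.
  rewrite /g !indicE; do 2 case: (_ \in _);
    by rewrite ?subrr ?subr0 ?sub0r ?normrN ?normr0 ?normr1.
have mg n : measurable_fun setT (g n).
  by apply: measurable_funB; apply: measurable_indic; exact: measurable_itv.
have [_] : m.-integrable `[- d, d]%classic (EFin \o fun=> 0) /\
    \int[m]_(t in `[- d, d]) (g n t * g n t) @[n --> \oo] -->
    \int[m]_(t in `[- d, d]) (0 : R).
  apply: (@bounded_convergence _ m d _ _ 1).
  - by move=> n; apply: measurable_funTS; apply: measurable_funM.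
  - by move=> n t _; rewrite normrM -[leRHS]mulr1 ler_pM.
  - move=> t _; apply: cvg_near_cst.
    case: (leP t r) => tr.
      apply: nearW => n; rewrite /g !indicE !mem_setE !in_itv/= !andbT.
      by rewrite !ltNge tr (le_trans tr) ?lerDl// subrr mulr0.
    have tr0 : 0 < t - r by rewrite subr_gt0.
    (* From this index on [1 / (n + 1) < t - r], so [t] lies in both half-lines. *)
    exists (Num.truncn (t - r)^-1) => //= n hn'.
    rewrite /g !indicE !mem_setE !in_itv/= !andbT tr -ltrBrDl.
    rewrite -[ltRHS]invrK ltf_pV2 ?posrE ?invr_gt0//.
    by rewrite (lt_le_trans (truncnS_gt _)) ?ler_nat ?ltnS// subrr mulr0.
rewrite Rintegral_cst// mul0r => /cvgrPdist_le h; apply/hcvgP => e e0.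
have [N _ hN] := h _ (exprn_gt0 2 e0); exists N => n Nn.
rewrite -(@ler_pXn2r _ 2) ?nnegrE ?rnorm_ge0 ?(ltW e0)// gE.
by have := hN n Nn; rewrite sub0r normrN; exact/le_trans/ler_norm.
Qed.

(** [calc_le] for the function [u - s] cut off to []s, t]], where it is at most [t - s]. *)
Lemma Ele_increment a (s t : R) x : sa_op a -> s <= t ->
  rnorm (a (Ele ip t a x - Ele ip s a x) - s%:C *: (Ele ip t a x - Ele ip s a x))
    <= (t - s) * rnorm (Ele ip t a x - Ele ip s a x).
Proof.
move=> sa st; have [d [_ ad cs]] := sp_calc 0 sa (limit_set_le s).
have ct := spectral_projection_calc hn ad (limit_set_le t).
have cts := calcB ct cs.
have [la _ _] := sa.
have cX := calcM hn ad (calc_poly a d ('X - s%:P)) cts.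
have ts : 0 <= t - s by rewrite subr_ge0.
have := calc_le hn ad cX cts ts _ x.
rewrite /= popB popX// popC; apply => u _.
rewrite !hornerE !indicE !mem_setE !in_itv/= normrM.
case: (leP u s) => us; first by rewrite (le_trans us st) subrr normr0 !mulr0.
case: (leP u t) => ut; last by rewrite subrr normr0 !mulr0.
rewrite (ger0_norm (_ : 0 <= u - s)) ?subr_ge0 ?(ltW us)//.
by rewrite ler_wpM2r// lerD2r.
Qed.

(** The closed half-line up to [- d] still contains a point of [[- d, d]], hence [- d - 1]. *)
Lemma Ele_extreme a : sa_op a -> exists d, 0 <= d /\
  forall x, Ele ip d a x = x /\ Ele ip (- d - 1) a x = 0.
Proof.
move=> sa; have [d [d0 ad]] := sa_op_spectral_bound hn 0 sa; exists d; split => // x.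
have c1 := spectral_projection_calc hn ad (limit_set_le d).
have c2 := spectral_projection_calc hn ad (limit_set_le (- d - 1)).
split.
  have -> : Ele ip d a = pop a 1.
    apply: (calc_eq hn ad c1 (calc_poly a d 1)) => t td.
    rewrite hornerE indicE mem_setE in_itv/=.
    by rewrite (le_trans (ler_norm t) td).
  exact: pop1.
have -> : Ele ip (- d - 1) a = pop a 0.
  apply: (calc_eq hn ad c2 (calc_poly a d 0)) => t td.
  rewrite horner0 indicE mem_setE in_itv/= leNgt (_ : - d - 1 < t)//.
  by move: td; rewrite ler_norml => /andP[td _]; lra.
exact: pop0.
Qed.

Lemma Ele_bounded_op s a : sa_op a -> bounded_op (Ele ip s a).
Proof. by move=> sa; apply: sp_bounded_op => //; exact: limit_set_le. Qed.

Lemma Egt_bounded_op s a : sa_op a -> bounded_op (Egt ip s a).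
Proof. by move=> sa; apply: sp_bounded_op => //; exact: limit_set_gt. Qed.

Lemma Ele_sym s a : sa_op a -> sym ip (Ele ip s a).
Proof. by move=> sa; apply: sp_sym => //; exact: limit_set_le. Qed.

Lemma Egt_sym s a : sa_op a -> sym ip (Egt ip s a).
Proof. by move=> sa; apply: sp_sym => //; exact: limit_set_gt. Qed.

Lemma Ele_commute s a S x : sa_op a -> bounded_op S ->
  (forall x, S (a x) = a (S x)) -> S (Ele ip s a x) = Ele ip s a (S x).
Proof. by move=> sa bS Sa; apply: sp_commute => //; exact: limit_set_le. Qed.

Lemma Egt_commute s a S x : sa_op a -> bounded_op S ->
  (forall x, S (a x) = a (S x)) -> S (Egt ip s a x) = Egt ip s a (S x).
Proof. by move=> sa bS Sa; apply: sp_commute => //; exact: limit_set_gt. Qed.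

Lemma Egt_Egt (s t : R) a x : sa_op a -> s <= t ->
  Egt ip s a (Egt ip t a x) = Egt ip t a x.
Proof.
move=> sa st; apply: sp_sub => //; [exact: limit_set_gt|exact: limit_set_gt|].
by move=> u /=; rewrite !in_itv/= !andbT; exact: le_lt_trans.
Qed.

Lemma Ele_Ele (s t : R) a x : sa_op a -> s <= t ->
  Ele ip t a (Ele ip s a x) = Ele ip s a x.
Proof.
move=> sa st; apply: sp_sub => //; [exact: limit_set_le|exact: limit_set_le|].
by move=> u /=; rewrite !in_itv/= => /le_trans; apply.
Qed.

Lemma Ele_EleC (s t : R) a x : sa_op a ->
  Ele ip t a (Ele ip s a x) = Ele ip s a (Ele ip t a x).
Proof. by move=> sa; apply: sp_commC => //; exact: limit_set_le. Qed.

Lemma sp_pop_eq a (p : {poly R}) E F : sa_op a -> limit_set E -> limit_set F ->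
  (forall t, F t <-> E p.[t]) -> sp E (pop a p) = sp F a.
Proof.
move=> sa Eq Fq EF; have [d [_ ad cE]] := sa_op_calc2 hn p sa Eq 0.
apply: (calc_eq hn ad cE (spectral_projection_calc hn ad Fq)) => t _.
rewrite !indicE; congr (_%:R); congr (nat_of_bool _).
by apply/idP/idP => /set_mem h; apply/mem_set; apply/EF.
Qed.

Lemma Ele_shift (s t : R) a : sa_op a ->
  Ele ip t (pop a ('X - s%:P)) = Ele ip (t + s) a.
Proof.
move=> sa; apply: sp_pop_eq => //; [exact: limit_set_le|exact: limit_set_le|].
by move=> u /=; rewrite !in_itv/= !hornerE lerBlDr.
Qed.

Lemma Egt_shift (s t : R) a : sa_op a ->
  Egt ip t (pop a ('X - s%:P)) = Egt ip (t + s) a.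
Proof.
move=> sa; apply: sp_pop_eq => //; [exact: limit_set_gt|exact: limit_set_gt|].
by move=> u /=; rewrite !in_itv/= !andbT !hornerE ltrBrDr.
Qed.

(** The left projection belongs to the closed half-line [[s, +oo[], so it absorbs the one of []s,
    +oo[] without being equal to it. *)
Lemma Ele_flip_Egt (s : R) a x : sa_op a ->
  Ele ip 0 (pop a (s%:P - 'X)) (Egt ip s a x) = Egt ip s a x.
Proof.
move=> sa; apply: sp_comp_sub => //; [exact: limit_set_le|exact: limit_set_gt|].
by move=> t /=; rewrite !in_itv/= andbT => /ltW; rewrite !hornerE subr_le0.
Qed.

(** Here strictness is lost: [t <= 0] only gives [s - t >= s], which exceeds [r] because of the
    margin. *)
Lemma Egt_flip_Ele (r s : R) a x : sa_op a -> r < s ->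
  Egt ip r (pop a (s%:P - 'X)) (Ele ip 0 a x) = Ele ip 0 a x.
Proof.
move=> sa rs; apply: sp_comp_sub => //; [exact: limit_set_gt|exact: limit_set_le|].
move=> t /=; rewrite !in_itv/= andbT => t0.
by rewrite !hornerE (lt_le_trans rs)// lerDl oppr_ge0.
Qed.

End spectral_projection_theory.

Global Opaque Ele Egt.

(** * Adjoints and commutants *)

Section riesz.
Context {R : realType} {H : completeNormedModType R[i]}.
Variable ip : {dot H for @Num.conj R[i]}.
Hypothesis hn : hilbert_norm ip.
Implicit Types (T S : H -> H) (x y z : H).

Lemma rnormD_sqr x y :
  rnorm (x + y) ^+ 2 = rnorm x ^+ 2 + 2 * re ip x y + rnorm y ^+ 2.
Proof. by rewrite -!(re_sqr hn) reDl !reDr (reC ip y x); ring. Qed.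

Lemma rnormB_sqr x y :
  rnorm (x - y) ^+ 2 = rnorm x ^+ 2 - 2 * re ip x y + rnorm y ^+ 2.
Proof. by rewrite rnormD_sqr reNr rnormN; ring. Qed.

(* The representing vector minimizes [|x|^2 - 2 phi x]. *)
Lemma riesz_real (phi : H -> R) (C : R) :
  (forall (k : R) x y, phi (k%:C *: x + y) = k * phi x + phi y) ->
  0 <= C -> (forall x, `|phi x| <= C * rnorm x) ->
  exists z, forall x, phi x = re ip x z.
Proof.
move=> lphi C0 phiC; pose J x := rnorm x ^+ 2 - 2 * phi x.
have phiD x y : phi (x + y) = phi x + phi y.
  by have := lphi 1 x y; rewrite scale1r mul1r.
have phi0 : phi 0 = 0.
  by have := phiD 0 0; rewrite addr0 => /(canLR (addrK _)) <-; rewrite subrr.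
have phiZ (k : R) x : phi (k%:C *: x) = k * phi x.
  by have := lphi k x 0; rewrite !addr0 phi0 addr0.
have phiB x y : phi (x - y) = phi x - phi y.
  by rewrite phiD; have := phiZ (-1) y; rewrite rmorphN1 scaleN1r mulN1r => ->.
have Jlb x : - C ^+ 2 <= J x.
  have := phiC x; rewrite ler_norml /J => /andP[_ h].
  by have := sqr_ge0 (rnorm x - C); nra.
have hasJ : has_inf (range J).
  by split; [exists (J 0), 0|exists (- C ^+ 2) => _ [x _ <-]; exact: Jlb].
pose mu := inf (range J).
have muJ x : mu <= J x by apply: ge_inf; [exact: hasJ.2|exists x].
(* The parallelogram law, with [mu <= J] at the midpoint of [x] and [y]; minimizing sequences are
   therefore Cauchy. *)
have par x y : rnorm (x - y) ^+ 2 <= 2 * (J x - mu) + 2 * (J y - mu).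
  have := muJ ((2^-1)%:C *: (x + y)); rewrite /J phiZ phiD rnormCZ ger0_norm//.
  rewrite exprMn (rnormD_sqr x y) (rnormB_sqr x y).
  have -> : (2^-1 : R) ^+ 2 = 4^-1 by rewrite exprVn -natrX.
  by lra.
have ex (n : nat) : exists x, J x < mu + n.+1%:R^-1.
  have n0 : 0 < n.+1%:R^-1 :> R by rewrite invr_gt0.
  by have [_ [x _ <-] h] := inf_adherent n0 hasJ; exists x.
have /choice[u Ju] := ex.
have [z uz] : exists z, hcvg u z.
  apply: hcomplete => e e0.
  have e4 : 0 < e ^+ 2 / 4 by rewrite divr_gt0// exprn_gt0.
  exists (Num.truncn (e ^+ 2 / 4)^-1) => n k Nn Nk.
  have small i : (Num.truncn (e ^+ 2 / 4)^-1 <= i)%N -> i.+1%:R^-1 <= e ^+ 2 / 4 :> R.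
    move=> Ni; rewrite -[leRHS]invrK lef_pV2 ?posrE ?invr_gt0//.
    by rewrite ltW// (lt_le_trans (truncnS_gt _))// ler_nat ltnS.
  rewrite -(@ler_pXn2r _ 2) ?nnegrE ?rnorm_ge0 ?(ltW e0)//.
  rewrite (le_trans (par _ _))//.
  have Jle i : (Num.truncn (e ^+ 2 / 4)^-1 <= i)%N -> J (u i) <= mu + e ^+ 2 / 4.
    by move=> Ni; rewrite (le_trans (ltW (Ju i)))// lerD2l small.
  by have := Jle n Nn; have := Jle k Nk; lra.
have cphi : phi (u n) @[n --> \oo] --> phi z.
  apply/cvgrPdist_le => e e0.
  have C1 : 0 < C + 1 by rewrite ltr_wpDl.
  have [N hN] := (hcvgP _ _).1 uz _ (divr_gt0 e0 C1); exists N => //= n Nn.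
  rewrite -phiB (le_trans (phiC _))// rnorm_distC.
  apply: (@le_trans _ _ ((C + 1) * (e / (C + 1)))).
    by rewrite ler_pM ?rnorm_ge0 ?hN// lerDl.
  by rewrite mulrC divfK// gt_eqF.
have Jz : J z <= mu.
  have cJ : J (u n) @[n --> \oo] --> J z.
    apply: cvgB; last exact: cvgMr.
    by rewrite /GRing.exp /=; apply: cvgM; exact: hcvg_rnorm.
  have cmu : mu + n.+1%:R^-1 @[n --> \oo] --> mu + 0.
    by apply: cvgD; [exact: cvg_cst|exact: cvg_harmonic].
  rewrite -[leRHS]addr0; apply: ler_cvg_to cJ cmu _.
  by apply: nearW => n; exact: ltW.
exists z => x.
have quad (t : R) : 0 <= t ^+ 2 * rnorm x ^+ 2 + 2 * t * (re ip x z - phi x).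
  have := le_trans Jz (muJ (z + t%:C *: x)).
  rewrite /J rnormD_sqr phiD phiZ rnormCZ reZr exprMn real_normK ?num_real//.
  by rewrite (reC ip z x); lra.
apply/eqP; rewrite -subr_eq0 -normr_eq0; apply/eqP.
set w := phi x - _.
have [x0|x0] := eqVneq (rnorm x ^+ 2) 0.
  have := quad w; rewrite x0 mulr0 add0r.
  rewrite (_ : re ip x z - phi x = - w); last by rewrite /w opprB.
  move=> h; have := sqr_ge0 w => h2.
  have : w ^+ 2 = 0 by rewrite expr2 in h2 *; lra.
  by move=> /eqP; rewrite sqrf_eq0 => /eqP ->; rewrite normr0.
have xp : 0 < rnorm x ^+ 2 by rewrite lt_def x0 sqr_ge0.
(* The point where the quadratic polynomial in [t] is minimal. *)
have := quad (w / rnorm x ^+ 2).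
rewrite (_ : re ip x z - phi x = - w); last by rewrite /w opprB.
have -> : (w / rnorm x ^+ 2) ^+ 2 * rnorm x ^+ 2 + 2 * (w / rnorm x ^+ 2) * - w =
  - (w ^+ 2 / rnorm x ^+ 2) by field; move: x0; rewrite sqrf_eq0.
rewrite oppr_ge0 pmulr_lle0 ?invr_gt0// => h.
have : w ^+ 2 = 0 by apply/eqP; rewrite eq_le h sqr_ge0.
by move=> /eqP; rewrite sqrf_eq0 => /eqP ->; rewrite normr0.
Qed.

(** Riesz representation of [x |-> re ip (T x) y]; replacing [x] by ['i *: x] upgrades the real
    identity to [ip], and the bound follows by testing at [T' x]. *)
Lemma adjoint_exists T : bounded_op T -> exists T', bounded_op T' /\ is_adjoint ip T T'.
Proof.
move=> [lT /(linear_continuous_bounded lT)[C [C0 TC]]].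
have ex y : exists z, forall x, re ip (T x) y = re ip x z.
  apply: (@riesz_real _ (C * rnorm y)); last 2 first.
  - by rewrite mulr_ge0 ?rnorm_ge0.
  - move=> x; rewrite (le_trans (re_norm_le hn _ _))// mulrAC.
    by rewrite ler_wpM2r ?rnorm_ge0.
  by move=> k x x'; rewrite lT reDl reZl.
have /choice[T' hT'] := ex.
have aT x y : ip (T x) y = ip x (T' y).
  rewrite !ip_re hT'; congr (_ +i* _).
  rewrite -[LHS]opprK -re_i -(linearZ_fun _ _ lT) hT'.
  by rewrite re_i opprK.
exists T'; split => //.
have lT' : linear T'.
  move=> k x y; apply: (re_inj hn) => z; rewrite reC [RHS]reC /re.
  by congr complex.Re; rewrite -aT ipDr ipZr ipDr ipZr !aT.
split => //; apply/(linear_continuous_bounded lT'); exists C; split => // x.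
have [->|x0] := eqVneq (rnorm (T' x)) 0; first by rewrite mulr_ge0 ?rnorm_ge0.
have xp : 0 < rnorm (T' x) by rewrite lt_def x0 rnorm_ge0.
rewrite -(ler_pM2l xp) -expr2 -(re_sqr hn) -hT'.
rewrite (le_trans (re_le hn _ _))// mulrA [X in _ <= X * _]mulrC.
by rewrite ler_wpM2r ?rnorm_ge0.
Qed.

Lemma adjoint_sym T T' : is_adjoint ip T T' -> is_adjoint ip T' T.
Proof. by move=> aT x y; rewrite ipC -aT -ipC. Qed.

End riesz.

Section bounded_operators.
Context {R : realType} {H : completeNormedModType R[i]}.
Variable ip : {dot H for @Num.conj R[i]}.
Hypothesis hn : hilbert_norm ip.
Implicit Types (T S : H -> H) (x y : H).

Lemma bounded_opP T : bounded_op T <-> linear T /\ exists C, op_bound T C.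
Proof.
by split=> -[lT] /(linear_continuous_bounded lT) h; split.
Qed.

Lemma bounded_op_comp T S : bounded_op T -> bounded_op S -> bounded_op (T \o S).
Proof.
move=> /bounded_opP[lT [C [C0 TC]]] /bounded_opP[lS [D [D0 SD]]].
apply/bounded_opP; split; first by move=> k x y; rewrite /= lS lT.
exists (C * D); split; first exact: mulr_ge0.
by move=> x; rewrite /= (le_trans (TC _))// -mulrA ler_wpM2l.
Qed.

Lemma bounded_op_id : bounded_op (idfun : H -> H).
Proof.
apply/bounded_opP; split; first by [].
by exists 1; split => // x; rewrite mul1r.
Qed.

Lemma bounded_op0 : bounded_op (0 : H -> H).
Proof.
apply/bounded_opP; split; first by move=> k x y; rewrite /= scaler0 addr0.
by exists 0; split => // x; rewrite /= rnorm0 mul0r.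
Qed.

Lemma bounded_op_lin (k : R[i]) T S : bounded_op T -> bounded_op S ->
  bounded_op (k *: T + S).
Proof.
move=> /bounded_opP[lT [C [C0 TC]]] /bounded_opP[lS [D [D0 SD]]].
apply/bounded_opP; split.
  move=> l x y; rewrite !fctE /= lT lS !scalerDr addrACA; congr (_ + _ + _).
  by rewrite !scalerA mulrC.
exists (rnorm k * C + D); split; first by rewrite addr_ge0 ?mulr_ge0 ?rnorm_ge0.
move=> x; rewrite !fctE (le_trans (rnormD _ _))// mulrDl lerD// rnormZ -mulrA.
by rewrite ler_wpM2l ?rnorm_ge0.
Qed.

Lemma hcvg_bounded_op T (u : nat -> H) l : bounded_op T -> hcvg u l ->
  hcvg (fun n => T (u n)) (T l).
Proof.
move=> /bounded_opP[lT [C [C0 TC]]] ul.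
apply: (@hcvg_le _ _ _ _ (fun n => C * rnorm (u n - l))).
  by rewrite -[X in _ --> X](mulr0 C); apply: cvgMr.
by move=> n; rewrite -(linearB_fun lT).
Qed.

(** The two sequences are supported at index 0. *)
Lemma predual_ip x y : predual ip (fun T => ip (T x) y).
Proof.
pose at0 z n : H := if n is 0%N then z else 0.
have sumE (U : zmodType) (f : nat -> U) : (forall n, f n.+1 = 0) ->
    forall n, series f n.+1 = f 0%N.
  move=> f0 n; rewrite /series /= big_nat_recl// big1 => [|i _]; last exact: f0.
  by rewrite addr0.
have ss z : square_summable (at0 z).
  apply/cvg_ex; exists (rnorm z ^+ 2); apply: cvg_near_cst; exists 1%N => //.
  by move=> [|k] // _; rewrite sumE// => i; rewrite /at0 rnorm0 expr0n.
exists (at0 x), (at0 y); split => //; apply/funext => T; apply/esym.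
apply: (cvg_lim (norm_hausdorff (V := R[i] : normedModType R[i]))).
apply: cvg_near_cst; exists 1%N => //.
by move=> [|n] // _; rewrite sumE// => k; rewrite /at0 linear0r.
Qed.

(** Two matrix coefficients at a time are enough: a commutation relation compares two of them, and a
    vanishing condition involves one. *)
Lemma weak_star_closedI (V : set (H -> H)) : V `<=` @bounded_op R H ->
  (forall T, bounded_op T ->
    (forall x y x' y' (e : R), 0 < e -> exists2 S, V S &
      rnorm (ip (T x) y - ip (S x) y) < e /\
      rnorm (ip (T x') y' - ip (S x') y') < e) -> V T) ->
  weak_star_closed ip V.
Proof.
move=> Vb h; split => // T bT hT; apply: h => // x y x' y' e e0.
pose w (i : 'I_2) := if i == 0 then fun S : H -> H => ip (S x) y
  else fun S : H -> H => ip (S x') y'.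
have wp i : predual ip (w i) by rewrite /w; case: ifP => _; exact: predual_ip.
have [S VS Sw] := hT 2%N w e wp e0; exists S => //.
by split; [exact: (Sw 0)|exact: (Sw 1)].
Qed.

Section commutant.
Variable W : set (H -> H).
Hypothesis W_bounded : W `<=` @bounded_op R H.
Hypothesis W_adjoint : forall S, W S -> exists2 S', W S' & is_adjoint ip S S'.

Lemma commutant_self_adjoint : op_self_adjoint ip (commutant W).
Proof.
move=> T T' [bT Tc] bT' aT; split => // S WS; apply/funext => x /=.
have [S' WS' aS] := W_adjoint WS; apply: (re_inj hn) => y.
have aT' := adjoint_sym aT; congr complex.Re.
rewrite aT' aS aS aT'; congr (ip x _).
by have /(congr1 (fun f => f y)) := Tc S' WS'.
Qed.

Lemma commutant_adjoint S : commutant W S ->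
  exists2 S', commutant W S' & is_adjoint ip S S'.
Proof.
move=> cS; have [S' [bS' aS]] := adjoint_exists hn cS.1; exists S' => //.
exact: commutant_self_adjoint aS.
Qed.

Lemma commutant_von_neumann : von_neumann_algebra ip (commutant W).
Proof.
split.
- split.
    split; first exact: bounded_op0.
    move=> S /W_bounded[lS _]; apply/funext => x /=.
    by rewrite [RHS](linear0_fun lS).
  move=> l S T [bS Sc] [bT Tc]; split; first exact: bounded_op_lin.
  move=> Q WQ; have [lQ _] := W_bounded WQ; apply/funext => x /=.
  rewrite !fctE (linearD_fun lQ) (linearZ_fun _ _ lQ).
  have /(congr1 (fun f => f x))/= -> := Sc Q WQ.
  by have /(congr1 (fun f => f x))/= -> := Tc Q WQ.
- exact: commutant_self_adjoint.
- by split; [exact: bounded_op_id|].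
- move=> S T [bS Sc] [bT Tc]; split; first exact: bounded_op_comp.
  by move=> Q WQ; rewrite -compA Tc// compA Sc.
- apply: weak_star_closedI => [T []//|T bT hT].
  split => // S WS; apply/funext => x /=.
  have [S' WS' aS] := W_adjoint WS; apply: (re_inj hn) => y; congr complex.Re.
  apply/eqP; rewrite -subr_eq0; apply/eqP.
  apply: (@rnorm_small_eq0 _ _ _ 2) => e e0.
  (* One [S0] in the commutant approximates both coefficients, and for it they coincide. *)
  have [S0 [_ S0c] [h1 h2]] := hT (S x) y x (S' y) e e0.
  rewrite aS.
  have e1 : ip (S0 (S x)) y = ip (S0 x) (S' y).
    by rewrite -aS; have /(congr1 (fun f => f x))/= -> := S0c S WS.
  rewrite -(subrKA (ip (S0 (S x)) y)) (le_trans (rnormD _ _))// mulr_natl mulr2n.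
  by rewrite lerD ?(ltW h1)// e1 rnorm_distC ltW.
Qed.

End commutant.

(** Identifies the commutant of a bicommutant with the first commutant. *)
Lemma commutantK3 (W : set (H -> H)) : W `<=` @bounded_op R H ->
  commutant (commutant (commutant W)) = commutant W.
Proof.
move=> Wb; apply/seteqP; split=> T [bT Tc]; split => // S WS.
  by apply: Tc; split; [exact: Wb|move=> Q [_ Qc]; rewrite Qc].
by case: WS => _ Sc; rewrite Sc.
Qed.

End bounded_operators.

(** * Operators of bounded propagation *)

Section filtration.
Context {R : realType} {H : completeNormedModType R[i]}.
Variable ip : {dot H for @Num.conj R[i]}.
Hypothesis hn : hilbert_norm ip.
Variable D : set (H -> H).
Hypothesis D_sa : forall a, D a -> sa_op ip a.
Hypothesis D_shift : forall a (s : R), D a -> D (pop a ('X - s%:P)).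
Hypothesis D_flip : forall a (s : R), D a -> D (pop a (s%:P - 'X)).
Implicit Types (a T S : H -> H) (x y : H) (r s t : R).

(** [D] abstracts the image of the Lipschitz unit ball: self-adjoint operators, stable under [a - s]
    and [s - a]. *)
Definition propagation_le r : set (H -> H) :=
  [set T | bounded_op T /\ forall a, D a -> Ele ip 0 a \o T \o Egt ip r a = 0].

Local Notation V := propagation_le.

Lemma propagation_leP r T : bounded_op T ->
  V r T <-> forall a x, D a -> Ele ip 0 a (T (Egt ip r a x)) = 0.
Proof.
move=> bT; split=> [[_ h] a x Da|h].
  by have /(congr1 (fun f => f x)) := h a Da.
by split => // a Da; apply/funext => x; exact: h.
Qed.

Let bE s a : D a -> bounded_op (Ele ip s a).
Proof. by move/D_sa; exact: Ele_bounded_op. Qed.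

Let sE s a : D a -> sym ip (Ele ip s a).
Proof. by move/D_sa; exact: Ele_sym. Qed.

Let sF s a : D a -> sym ip (Egt ip s a).
Proof. by move/D_sa; exact: Egt_sym. Qed.

(** The relation is tested by the coefficients of [T] at [Egt r a x] and [Ele 0 a y]. *)
Lemma propagation_le_weak_star_closed r : weak_star_closed ip (V r).
Proof.
apply: (weak_star_closedI (ip := ip)) => [T []//|T bT hT].
apply/propagation_leP => // a x Da; apply: (re_eq0 hn) => y.
rewrite /re -[RHS]/(complex.Re (0 : R[i])); congr complex.Re.
apply: (@rnorm_small_eq0 _ _ _ 1) => e e0; rewrite mul1r.
have aE := (sym_adjoint ip (bE 0 Da).1).1 (sE 0 Da).
have [S VS [h _]] := hT (Egt ip r a x) (Ele ip 0 a y) 0 0 e e0.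
have /(propagation_leP _ VS.1)/(_ a x Da) S0 := VS.
have Sy : ip (S (Egt ip r a x)) (Ele ip 0 a y) = 0.
  by rewrite -[LHS](aE _ y) S0 linear0l.
by move: h; rewrite Sy subr0 -[ip (T _) _](aE _ y) => /ltW.
Qed.

Lemma propagation_le_subspace r : op_subspace (V r).
Proof.
split.
  apply/propagation_leP; first exact: bounded_op0.
  by move=> a x Da; rewrite /= (linear0_fun (bE 0 Da).1).
move=> l S T VS VT; apply/propagation_leP; first exact: bounded_op_lin VS.1 VT.1.
move=> a x Da; have [lE _] := bE 0 Da.
rewrite !fctE (linearD_fun lE) (linearZ_fun _ _ lE).
have /(propagation_leP _ VS.1)/(_ a x Da) -> := VS.
by have /(propagation_leP _ VT.1)/(_ a x Da) -> := VT; rewrite scaler0 addr0.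
Qed.

Lemma propagation_le_id r : 0 <= r -> V r idfun.
Proof.
move=> r0; apply/propagation_leP; first exact: bounded_op_id.
by move=> a x Da; apply: Ele_Egt0 => //; exact: D_sa.
Qed.

Lemma propagation_le_comp r s S T : V r S -> V s T -> V (r + s) (S \o T).
Proof.
move=> VS VT; apply/propagation_leP; first exact: bounded_op_comp VS.1 VT.1.
move=> a x Da /=; set y := T _.
have [lS _] := VS.1; have [lE _] := bE 0 Da.
have -> : y = Ele ip r a y + Egt ip r a y.
  by rewrite (EgtE hn)//; [rewrite addrC subrK|exact: D_sa].
rewrite (linearD_fun lS) (linearD_fun lE).
have /(propagation_leP _ VS.1)/(_ a y Da) -> := VS; rewrite addr0.
(* The condition on [T] is used for [a - r], where it reads [E_r T (1 - E_(r + s)) = 0]. *)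
have /(propagation_leP _ VT.1)/(_ _ x (D_shift r Da)) := VT.
rewrite (Ele_shift hn _ _ (D_sa Da)) (Egt_shift hn _ _ (D_sa Da)).
rewrite add0r (addrC s) -/y => ->.
by rewrite (linear0_fun lS) (linear0_fun lE).
Qed.

(** The defining relation for [s - a], whose two projections absorb [Egt s a] and [Ele 0 a]; the
    second absorption needs [r < s]. *)
Lemma propagation_le_Egt_Ele r s T a x : D a -> r < s -> V r T ->
  Egt ip s a (T (Ele ip 0 a x)) = 0.
Proof.
move=> Da rs VT; pose b := pop a (s%:P - 'X).
have Db : D b by exact: D_flip.
(* The adjoint of the absorption rule [Ele_flip_Egt]. *)
have h3 y : Egt ip s a y = Egt ip s a (Ele ip 0 b y).
  apply: (re_inj hn) => z; rewrite (sF _ Da) [RHS](sF _ Da) (sE _ Db).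
  by rewrite (Ele_flip_Egt hn _ _ (D_sa Da)).
rewrite h3 -(Egt_flip_Ele hn x (D_sa Da) rs).
have /(propagation_leP _ VT.1)/(_ b (Ele ip 0 a x) Db) -> := VT.
by rewrite (linear0_fun (Egt_bounded_op hn s (D_sa Da)).1).
Qed.

(** The adjoint of [E_0 T' (1 - E_r) = 0] is [(1 - E_r) T E_0 = 0]; it holds with every [s > r] in
    place of [r], hence in the limit. *)
Lemma propagation_le_self_adjoint r : op_self_adjoint ip (V r).
Proof.
move=> T T' VT bT' aT; apply/propagation_leP => // a x Da.
apply: (re_inj hn) => y; rewrite re0l (sE _ Da) reC /re -aT -/(re ip _ _) -(sF _ Da).
suff -> : Egt ip r a (T (Ele ip 0 a y)) = 0 by rewrite re0l.
apply: (hcvg_unique (Egt_right_cont hn r (T (Ele ip 0 a y)) (D_sa Da))).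
rewrite (_ : (fun n => _) = fun=> 0); first exact: hcvg_cst.
by apply/funext => n; rewrite (@propagation_le_Egt_Ele r)// ltrDl.
Qed.

(** Increasing [r] shrinks the right projection; conversely the relations at [r + 1 / (n + 1)] pass
    to the limit. *)
Lemma propagation_le_bigcap r : V r = \bigcap_(s in [set s | r < s]) V s.
Proof.
apply/seteqP; split=> [T VT s /= rs|T hT].
  apply/propagation_leP; first exact: VT.1.
  move=> a x Da; rewrite -(Egt_Egt hn x (D_sa Da) (ltW rs)).
  by have /(propagation_leP _ VT.1)/(_ a (Egt ip s a x) Da) := VT.
have bT : bounded_op T by have [] := hT (r + 1) (ltr_pwDr ltr01 (lexx r)).
apply/propagation_leP => // a x Da.
have h := hcvg_bounded_op (bE 0 Da)
  (hcvg_bounded_op bT (Egt_right_cont hn r x (D_sa Da))).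
apply: (hcvg_unique h).
have rn (n : nat) : r < r + n.+1%:R^-1 by rewrite ltrDl.
rewrite (_ : (fun n => _) = fun=> 0); first exact: hcvg_cst.
by apply/funext => n; exact: ((propagation_leP _ bT).1 (hT _ (rn n))).
Qed.

Lemma propagation_le_filtration : wstar_filtration ip V.
Proof.
split.
- move=> r r0; split.
  + exact: propagation_le_weak_star_closed.
  + exact: propagation_le_self_adjoint.
  + exact: propagation_le_id.
  + exact: propagation_le_subspace.
- by move=> r s S T _ _; exact: propagation_le_comp.
- by move=> r _; exact: propagation_le_bigcap.
Qed.

Lemma propagation_0_Ele T a s x : D a -> V 0 T ->
  T (Ele ip s a x) = Ele ip s a (T x).
Proof.
move=> Da VT; have bT := VT.1.
have upper S y : V 0 S -> Ele ip s a (S (Egt ip s a y)) = 0.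
  move=> VS; have /(propagation_leP _ VS.1)/(_ _ y (D_shift s Da)) := VS.
  by rewrite (Ele_shift hn _ _ (D_sa Da)) (Egt_shift hn _ _ (D_sa Da)) add0r.
have [T' [bT' aT]] := adjoint_exists hn bT.
have VT' := propagation_le_self_adjoint VT bT' aT.
have aT' := adjoint_sym aT.
have lower y : Egt ip s a (T (Ele ip s a y)) = 0.
  apply: (re_inj hn) => z; rewrite re0l (sF _ Da) /re aT -/(re ip _ _) (sE _ Da).
  by rewrite upper// reC re0l.
have := lower x; rewrite (EgtE hn _ _ (D_sa Da)).
move=> /eqP; rewrite subr_eq0 => /eqP ->.
have := upper T x VT; rewrite (EgtE hn _ _ (D_sa Da)).
rewrite (linearB_fun bT.1) (linearB_fun (bE s Da).1).
by move=> /eqP; rewrite subr_eq0 => /eqP ->.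
Qed.

Lemma AGM_scaled (c p q : R) : 0 <= c ->
  2 * c * p * q <= c * (p ^+ 2 + q ^+ 2).
Proof. by move=> /mulr_ge0/(_ (sqr_ge0 (p - q))); lra. Qed.

(* With [K = T a - a T] and [E = E_t - E_s], the operator [K E = E K E] has norm
   at most [2 C (t - s)], since [a] is close to [s] on the range of [E]; so the
   increments of [t |-> <K E_t x, y>] are of second order. *)
Lemma propagation_0_commute T a x : D a -> V 0 T -> T (a x) = a (T x).
Proof.
move=> Da VT; have [lT [C [C0 TC]]] := (bounded_opP T).1 VT.1.
have saa := D_sa Da; have [la _ [Ca aC]] := saa.
have ba : bounded_op a by apply/bounded_opP; split => //; exists Ca.
apply/eqP; rewrite -subr_eq0; apply/eqP; apply: (re_eq0 hn) => y.
pose K z := T (a z) - a (T z).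
have lK : linear K.
  move=> k u v; rewrite /K la lT lT la scalerBr opprD !addrA; congr (_ - _).
  by rewrite addrAC.
(* [2 * rnorm (e x) * rnorm (e y)] is at most the sum of the squares, which are the increments of
   [<E_t x, x>] and [<E_t y, y>]. *)
pose G t := C * (re ip (Ele ip t a x) x + re ip (Ele ip t a y) y).
pose F t := re ip (K (Ele ip t a x)) y.
have [d [d0 dE]] := Ele_extreme hn saa.
suff : F d = F (- d - 1).
  have [_ xd] := dE x; have [xd' _] := dE x.
  by rewrite /F xd xd' (linear0_fun lK) re0l.
apply: (@increment_le_const _ _ G 1); first lra.
move=> s t _ st _; pose e z := Ele ip t a z - Ele ip s a z.
have le : linear e.
  move=> k u v; rewrite /e (bE t Da).1 (bE s Da).1 scalerBr opprD.
  by rewrite addrACA.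
have comm S z : bounded_op S -> (forall u, S (Ele ip t a u) = Ele ip t a (S u)) ->
  (forall u, S (Ele ip s a u) = Ele ip s a (S u)) -> S (e z) = e (S z).
  by move=> [lS _] h1 h2; rewrite /e (linearB_fun lS) h1 h2.
have Te z : T (e z) = e (T z) by apply: comm VT.1 _ _ => u; exact: propagation_0_Ele.
have ae z : a (e z) = e (a z).
  by apply: comm => // u; exact: Ele_commute.
have Ets z : Ele ip t a (Ele ip s a z) = Ele ip s a z by exact: Ele_Ele.
have Est z : Ele ip s a (Ele ip t a z) = Ele ip s a z.
  by rewrite -Ele_EleC// Ets.
have idE u z : Ele ip u a (Ele ip u a z) = Ele ip u a z by exact: Ele_Ele.
have ee z : e (e z) = e z.
  have ete u : Ele ip t a (e u) = e u.
    by rewrite (linearB_fun (bE t Da).1) (idE t u) (Ets u).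
  have ese u : Ele ip s a (e u) = 0.
    by rewrite (linearB_fun (bE s Da).1) (Est u) (idE s u) subrr.
  by rewrite [LHS](_ : _ = Ele ip t a (e z) - Ele ip s a (e z))// ete ese subr0.
have se u v : re ip (e u) v = re ip u (e v) by rewrite /e reBl reBr (sE t Da) (sE s Da).
have Ke z : K (e z) = e (K z) by rewrite /K ae Te Te ae -(linearB_fun le).
have -> : F t - F s = re ip (K (e x)) (e y).
  by rewrite /F -reBl -(linearB_fun lK) -/(e x) -{1}ee Ke se.
have eN z : rnorm (e z) ^+ 2 = re ip (Ele ip t a z) z - re ip (Ele ip s a z) z.
  by rewrite -(re_sqr hn) -se ee reBl.
have inc z : rnorm (a (e z) - s%:C *: e z) <= (t - s) * rnorm (e z).
  exact: Ele_increment.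
have KB : rnorm (K (e x)) <= 2 * C * (t - s) * rnorm (e x).
  (* Replacing [a] by [a - s] does not change its commutator with [T]. *)
  have -> : K (e x) = T (a (e x) - s%:C *: e x) - (a (e (T x)) - s%:C *: e (T x)).
    rewrite (linearB_fun lT) (linearZ_fun _ _ lT) /K Te opprB.
    by rewrite subrKA.
  rewrite (le_trans (rnormB _ _))//.
  have h1 := le_trans (TC _) (ler_wpM2l C0 (inc x)).
  have ts : 0 <= t - s by rewrite subr_ge0.
  have h2 := le_trans (inc (T x)) (ler_wpM2l ts (_ : _ <= C * rnorm (e x))).
  have {}h2 : rnorm (a (e (T x)) - s%:C *: e (T x)) <= (t - s) * (C * rnorm (e x)).
    by apply: h2; rewrite -Te.
  by move: h1 h2; lra.
rewrite (le_trans (re_norm_le hn _ _))//.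
apply: (le_trans (ler_wpM2r (rnorm_ge0 _) KB)).
have -> : 1 * (t - s) * (G t - G s) =
    C * (t - s) * (rnorm (e x) ^+ 2 + rnorm (e y) ^+ 2).
  by rewrite /G mul1r -mulrBr opprD addrACA -(eN x) -(eN y) mulrA (mulrC C).
rewrite -(mulrA 2); apply: AGM_scaled.
by rewrite mulr_ge0 ?subr_ge0.
Qed.

Lemma propagation_0 :
  V 0 = [set T | bounded_op T /\ forall a x, D a -> T (a x) = a (T x)].
Proof.
apply/seteqP; split=> T.
  move=> VT; split=> [|a x Da]; first exact: VT.1.
  exact: (propagation_0_commute x Da VT).
move=> [bT Ta]; apply/propagation_leP => // a x Da.
have saa := D_sa Da; rewrite (Egt_commute hn 0 _ saa bT (fun x => Ta a x Da)).
exact: Ele_Egt0.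
Qed.

Lemma propagation_le_reflexive (N : set (H -> H)) :
  (forall a E, D a -> limit_set E -> N (spectral_projection ip E a)) ->
  reflexive_filtration ip N V.
Proof.
move=> ND r r0; apply/seteqP; split=> [T VT|T [bT h]].
  by split=> [|P Q _ _ _ _]; [exact: VT.1|apply].
split => // a Da; apply: h.
- exact: (ND _ _ Da (limit_set_le _)).
- exact: (ND _ _ Da (limit_set_gt _)).
- exact: (sp_projection hn (D_sa Da) (limit_set_le _)).
- exact: (sp_projection hn (D_sa Da) (limit_set_gt _)).
- by move=> S [_]; exact.
Qed.

End filtration.

(** * Representations of the unitization *)

Lemma linear_scaleB (K : pzRingType) (V W : lmodType K) (f : V -> W) :
  linear f -> forall (k : K) u v, f (k *: u - v) = k *: f u - f v.
Proof.
move=> lf k u v; rewrite lf; congr (_ + _).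
have f0 : f 0 = 0 by have := lf (-1) 0 0; rewrite scaler0 addr0 scaleN1r addNr.
by have := lf (-1) v 0; rewrite !scaleN1r f0 !addr0.
Qed.

Lemma linear_scale (K : pzRingType) (V W : lmodType K) (f : V -> W) :
  linear f -> forall (k : K) u, f (k *: u) = k *: f u.
Proof.
move=> lf k u; have := linear_scaleB lf k u 0.
have := linear_scaleB lf 1 0 0.
by rewrite !scale1r !subrr => ->; rewrite !subr0.
Qed.

(** * Left inverses by Neumann series *)

Section cstar_algebra.
Context {R : realType} {U : cstarAlgType R}.
Implicit Types g h k u v : U.

Lemma cmulBl u v h : cmul (u - v) h = cmul u h - cmul v h.
Proof. by rewrite cmulDl -scaleN1r cmulZl scaleN1r. Qed.

Lemma cmulBr u v h : cmul h (u - v) = cmul h u - cmul h v.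
Proof. by rewrite cmulDr -scaleN1r cmulZr scaleN1r. Qed.

Lemma rnorm_cmul u v : rnorm (cmul u v) <= rnorm u * rnorm v.
Proof. by rewrite -lecR rmorphM /= -!rnormE norm_cmul. Qed.

Lemma star_unit one : @is_unit_elt R U one -> star one = one.
Proof.
move=> one1; have [_ so] := one1 (star one).
by rewrite -so -{2}(starK one) -starM (one1 (star one)).2 starK.
Qed.

Lemma starB u v : star (u - v) = star u - star v.
Proof. by rewrite starD -scaleN1r starZ rmorphN1 scaleN1r. Qed.

Lemma self_adjointZ (t : R) u : self_adjoint u -> self_adjoint (t%:C *: u).
Proof.
rewrite /self_adjoint /= => su; rewrite starZ su; congr (_ *: _).
exact: conjc_real.
Qed.

(* The left inverse is the limit of the Neumann series, whose partial sums
   satisfy [w n.+1 = one + cmul (w n) g]. *)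
Lemma left_inverse_one_sub one g : is_unit_elt one -> rnorm g < 1 ->
  exists k, cmul k (one - g) = one.
Proof.
move=> one1 g1; set q := rnorm g in g1; have q0 : 0 <= q := rnorm_ge0 g.
pose f u := one + cmul u g; pose w n := iter n f 0.
(* The fixed point of [c |-> rnorm one + c * q], hence a bound for all partial sums. *)
pose c := rnorm one / (1 - q).
have q1 : 0 < 1 - q by rewrite subr_gt0.
have c0 : 0 <= c by rewrite divr_ge0 ?rnorm_ge0 ?ltW.
have wc n : rnorm (w n) <= c.
  elim: n => [|n IH]; first by rewrite rnorm0.
  rewrite (le_trans (rnormD _ _))//.
  have -> : c = rnorm one + c * q by rewrite /c; field; rewrite gt_eqF.
  by rewrite lerD2l (le_trans (rnorm_cmul _ _))// ler_wpM2r.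
have wB n m : rnorm (w (n + m)%N - w n) <= c * q ^+ n.
  elim: n => [|n IH]; first by rewrite expr0 mulr1 subr0.
  rewrite addSn /= /f opprD addrACA subrr add0r -cmulBl.
  by rewrite (le_trans (rnorm_cmul _ _))// exprSr mulrA ler_wpM2r.
have wcvg : c * q ^+ n @[n --> \oo] --> (0 : R).
  rewrite -[X in _ --> X](mulr0 c); apply: cvgMr.
  by apply: cvg_expr; rewrite ger0_norm.
have [k wk] : exists k, hcvg w k.
  apply: hcomplete => e e0.
  have e2 : 0 < e / 2 by rewrite divr_gt0.
  have /cvgrPdist_le/(_ _ e2)[N _ hN] := wcvg.
  have {}hN : c * q ^+ N <= e / 2.
    by have := hN N (leqnn _); rewrite sub0r normrN ger0_norm// mulr_ge0// exprn_ge0.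
  have hw n : (N <= n)%N -> rnorm (w n - w N) <= e / 2.
    by move=> Nn; rewrite -(subnKC Nn) (le_trans (wB _ _)).
  exists N => n m /hw hn /hw hm; rewrite -(subrKA (w N)).
  by rewrite (le_trans (rnormD _ _))// (rnorm_distC (w N)); lra.
exists k; rewrite cmulBr (one1 k).2.
suff {1}-> : k = one + cmul k g by rewrite addrK.
apply: (hcvg_unique (u := fun n => w n.+1)).
  by have := hcvg_shift 1 wk; congr hcvg; apply/funext => n; rewrite addn1.
apply: (@hcvg_le _ _ _ _ (fun n => rnorm (w n - k) * q)).
  by rewrite -[X in _ --> X](mul0r q); apply: cvgMl.
by move=> n; rewrite /= opprD addrACA subrr add0r -cmulBl rnorm_cmul.
Qed.

Lemma left_inverse_scalar_sub one h (s : R) : is_unit_elt one -> rnorm h < s ->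
  exists k, cmul k (s%:C *: one - h) = one.
Proof.
move=> one1 hs; have s0 : 0 < s := le_lt_trans (rnorm_ge0 h) hs.
have sC : s%:C * s^-1%:C = 1 :> R[i] by rewrite -rmorphM /= divff ?gt_eqF.
have [|k hk] := @left_inverse_one_sub one (s^-1%:C *: h) one1.
  by rewrite rnormCZ ger0_norm ?invr_ge0 ?ltW// mulrC ltr_pdivrMr ?mul1r.
exists (s^-1%:C *: k); rewrite -[RHS]hk cmulZl -cmulZr scalerBr !scalerA.
by rewrite (mulrC _ s%:C) sC scale1r.
Qed.

End cstar_algebra.

(** * Contractivity of representations on self-adjoint elements *)

Section contractive.
Context {R : realType} {U : cstarAlgType R} {H : completeNormedModType R[i]}.
Variable ip : {dot H for @Num.conj R[i]}.
Hypothesis hn : hilbert_norm ip.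

(* Cauchy-Schwarz for the form [re ip (P x) y], in the form obtained from its
   value at [x - C^-1 P x]. *)
Lemma positive_op_norm (P : H -> H) (C : R) x : linear P -> sym ip P ->
  (forall y, 0 <= re ip (P y) y) -> 0 < C -> op_bound P C ->
  rnorm (P x) ^+ 2 <= C * re ip (P x) x.
Proof.
move=> lP sP P0 C0 [_ PC].
have := P0 (x - C^-1%:C *: P x).
rewrite (linearB_fun lP) (linearZ_fun _ _ lP) !reBl !reBr !reZl !reZr.
rewrite (sP (P x) x) (re_sqr hn).
have := re_le hn (P (P x)) (P x).
have := ler_wpM2r (rnorm_ge0 (P x)) (PC (P x)).
set a := re _ (P x) x; set b := re _ (P (P x)) _; set n := rnorm (P x).
move: (rnorm (P (P x)) * n) => w h1 h2 h3.
have Cb : C^-1 * (C^-1 * b) <= C^-1 * n ^+ 2.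
  rewrite ler_wpM2l ?invr_ge0 ?(ltW C0)// ler_pdivrMl// expr2 mulrA.
  exact: le_trans h2 h1.
rewrite -ler_pdivrMl//.
by move: Cb h3; lra.
Qed.

Variable pi : U -> H -> H.
Hypothesis pi_rep : representation ip pi.
Variable one : U.
Hypothesis one1 : is_unit_elt one.
Hypothesis pi1 : pi one = idfun.

Lemma rep_bound u : exists2 C : R, 0 < C & op_bound (pi u) C.
Proof.
have [bpi _ _ _] := pi_rep; have /bounded_opP[_ [C [C0 h]]] := bpi u.
exists (C + 1); first by rewrite ltr_wpDl.
split; first by rewrite addr_ge0.
by move=> x; rewrite (le_trans (h x))// ler_wpM2r ?rnorm_ge0// lerDl.
Qed.

Lemma rep_sa u : self_adjoint u -> sa_op ip (pi u).
Proof.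
move=> su; have [bpi _ _ pistar] := pi_rep; have [lpi _] := bpi u.
split => //; last by have [C _ h] := rep_bound u; exists C.
by apply/(sym_adjoint _ lpi); have := pistar u; rewrite su.
Qed.

(* Otherwise the supremum [s] of the form on the unit ball would exceed
   [rnorm h]; then [s one - h] is left invertible, so the positive form of
   [s - pi h] is bounded below and the supremum could be lowered. *)
Lemma rep_form_le h x : self_adjoint h ->
  re ip (pi h x) x <= rnorm h * rnorm x ^+ 2.
Proof.
move=> sh; set B := pi h; set m := rnorm h.
have m0 : 0 <= m := rnorm_ge0 h.
have [bpi lpi pim _] := pi_rep.
have [lB sB _] : sa_op ip B := rep_sa sh.
have [C C0 [_ BC]] : exists2 C : R, 0 < C & op_bound B C := rep_bound h.
pose W := [set r : R | exists2 y, rnorm y <= 1 & r = re ip (B y) y].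
have W_ub : has_sup W.
  split; first by exists (re ip (B 0) 0), 0 => //; rewrite rnorm0.
  exists C => _ [y y1 ->]; rewrite (le_trans (re_le hn _ _))//.
  have := BC y; have := rnorm_ge0 y; have := rnorm_ge0 (B y); nra.
set s := sup W.
have Bs y : re ip (B y) y <= s * rnorm y ^+ 2.
  have [->|y0] := eqVneq y 0; first by rewrite reC re0l rnorm0 expr0n mulr0.
  have n0 : 0 < rnorm y.
    by rewrite lt_def rnorm_ge0 andbT; apply: contra_neq y0; exact: rnorm_eq0.
  have /(sup_upper_bound W_ub) :
      W (re ip (B ((rnorm y)^-1%:C *: y)) ((rnorm y)^-1%:C *: y)).
    exists ((rnorm y)^-1%:C *: y) => //.
    by rewrite rnormCZ ger0_norm ?invr_ge0 ?(ltW n0)// mulVf// gt_eqF.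
  rewrite (linearZ_fun _ _ lB) reZl reZr mulrA -expr2 exprVn.
  by rewrite ler_pdivrMl ?exprn_gt0// mulrC.
suff sm : s <= m by rewrite (le_trans (Bs x))// ler_wpM2r ?sqr_ge0.
rewrite leNgt; apply/negP => ms.
have [k hk] := left_inverse_scalar_sub one1 ms.
pose P y := s%:C *: y - B y.
have PE : pi (s%:C *: one - h) = P.
  by rewrite (linear_scaleB lpi) pi1.
have KP y : pi k (P y) = y.
  by rewrite -PE -[LHS]/((pi k \o pi _) y) -pim hk pi1.
have [c c0 [_ Kc]] := rep_bound k.
have [C' C'0 PC'] := rep_bound (s%:C *: one - h); rewrite PE in PC'.
have sP : sym ip P by move=> y z; rewrite /P reBl reBr reZl reZr sB.
have lP : linear P by rewrite -PE; have [] := bpi (s%:C *: one - h).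
have Pre y : re ip (P y) y = s * rnorm y ^+ 2 - re ip (B y) y.
  by rewrite /P reBl reZl (re_sqr hn).
have P0 y : 0 <= re ip (P y) y by rewrite Pre subr_ge0.
(* From [rnorm y <= c * rnorm (P y)] and [rnorm (P y) ^+ 2 <= C' * re ip (P y) y]. *)
pose d := (c ^+ 2 * C')^-1.
have d0 : 0 < d by rewrite invr_gt0 mulr_gt0// exprn_gt0.
have key y : re ip (B y) y <= (s - d) * rnorm y ^+ 2.
  have h1 : rnorm y ^+ 2 <= c ^+ 2 * rnorm (P y) ^+ 2.
    rewrite -exprMn lerXn2r ?nnegrE ?rnorm_ge0 ?mulr_ge0 ?rnorm_ge0 ?(ltW c0)//.
    by have := Kc (P y); rewrite KP.
  have h2 := positive_op_norm y lP sP P0 C'0 PC'.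
  have : d * rnorm y ^+ 2 <= re ip (P y) y.
    rewrite /d ler_pdivrMl ?mulr_gt0 ?exprn_gt0// (le_trans h1)// -(mulrA (c ^+ 2)).
    by rewrite ler_wpM2l ?sqr_ge0.
  by rewrite Pre; lra.
(* The maximum with [m] keeps the bound nonnegative, as is needed for vectors of norm less than
   1. *)
pose s1 := Num.max m (s - d).
have s1s : s1 < s by rewrite gt_max ms gtrBl.
move: s1s; rewrite ltNge => /negP; apply; apply: sup_le_ub; first exact: W_ub.1.
move=> _ [y y1 ->]; rewrite (le_trans (key y))//.
have s10 : 0 <= s1 by rewrite le_max m0.
have sds : s - d <= s1 by rewrite le_max lexx orbT.
have y2 : rnorm y ^+ 2 <= 1 by rewrite expr_le1 ?rnorm_ge0.
by rewrite (le_trans (ler_wpM2r (sqr_ge0 _) sds))// ler_piMr.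
Qed.

(** [|pi(h) x|^2 = <pi(h h) x, x>], to which the form bound applies, as [h h] is self-adjoint. *)
Lemma rep_contractive h x : self_adjoint h ->
  rnorm (pi h x) <= rnorm h * rnorm x.
Proof.
move=> sh; have [_ _ pim _] := pi_rep; have [_ sB _] := rep_sa sh.
rewrite -(@ler_pXn2r _ 2) ?nnegrE ?mulr_ge0 ?rnorm_ge0//.
rewrite -(re_sqr hn) -sB -[pi h (pi h x)]/((pi h \o pi h) x) -pim.
rewrite (le_trans (rep_form_le _ _))//; last first.
  by rewrite exprMn ler_wpM2r ?sqr_ge0// expr2 rnorm_cmul.
by rewrite /self_adjoint /= starM sh.
Qed.

End contractive.

Lemma dense_bounded_eq0 (R : realType) (H : completeNormedModType R[i])
    (S : set H) (T : H -> H) :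
  dense S -> bounded_op T -> (forall x, S x -> T x = 0) -> T = 0.
Proof.
move=> dS /bounded_opP[lT [C [C0 TC]]] ST; apply/funext => x.
apply: (@rnorm_small_eq0 _ _ _ C) => e e0.
have eC : 0 < e%:C :> R[i] by rewrite ltcR.
have [z [xz Sz]] : ball x e%:C `&` S !=set0.
  by apply: dS; [exists x; exact: ballxx|exact: ball_open].
rewrite -[T x]subr0 -(ST z Sz) -(linearB_fun lT) (le_trans (TC _))//.
rewrite ler_wpM2l// -lecR -rnormE ltW//.
by move: xz; rewrite -ball_normE.
Qed.

(** * Extension of a representation to the unitization *)

Section unitization.
Context {R : realType} {A U : cstarAlgType R} {H : completeNormedModType R[i]}.
Variables (ip : {dot H for @Num.conj R[i]}) (iota : A -> U) (one : U).
Variable rho : A -> H -> H.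
Hypothesis unit1 : is_unitization iota one.
Hypothesis rep : representation ip rho.
Hypothesis nondeg : nondegenerate_rep rho.

Local Notation ext := (unital_ext iota one rho idfun).

Lemma nondegenerate_unit e : is_unit_elt e -> rho e = idfun.
Proof.
move=> e1; have [brho _ rhoM _] := rep; have [le _] := brho e.
have : -1 *: idfun + rho e = 0.
  apply: (dense_bounded_eq0 nondeg).
    by apply: bounded_op_lin; [exact: bounded_op_id|].
  move=> _ [n [a [x ->]]]; rewrite !fctE /= scaleN1r addrC.
  apply/eqP; rewrite subr_eq0; apply/eqP.
  elim/big_rec: _ => [|i y _ IH]; first exact: linear0_fun.
  rewrite (linearD_fun le) IH -[rho e (rho _ _)]/((rho e \o rho (a i)) (x i)).
  by rewrite -rhoM (e1 _).1.
move=> /(congr1 (fun f => f + idfun)); rewrite scaleN1r add0r => <-.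
by rewrite addrAC addNr add0r.
Qed.

(** Two decompositions with different scalars would put [one] into the image of [iota]; then [A] has
    a unit [e], and [rho e = idfun] makes both values agree. *)
Lemma extE a (l : R[i]) : ext (iota a + l *: one) = rho a + l *: idfun.
Proof.
have [[li iM _] inj one1 _ _] := unit1; have [_ lrho _ _] := rep.
apply: xget_unique; first by exists a, l.
move=> _ [a' [l' [E ->]]]; have [ll|ll] := eqVneq l l'.
  by move: E; rewrite ll => /addIr/inj ->.
pose e := (l' - l)^-1 *: (a - a').
have ll' : l' - l != 0 by rewrite subr_eq0 eq_sym.
have aE : a = (l' - l) *: e + a' by rewrite /e scalerA mulfV// scale1r subrK.
have ie : iota e = one.
  have h : (l' - l) *: iota e = (l' - l) *: one.
    apply: (addIr (iota a')); rewrite -li -aE; apply: (addIr (l *: one)).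
    by rewrite E addrAC -scalerDl subrK addrC.
  by rewrite -[LHS]scale1r -[RHS]scale1r -(mulVf ll') -!scalerA h.
have e1 : is_unit_elt e.
  by move=> b; split; apply: inj; rewrite iM ie; have [] := one1 (iota b).
rewrite aE lrho (nondegenerate_unit e1) addrAC -scalerDl subrK.
exact: addrC.
Qed.

Let lin_combine (V : lmodType R[i]) (k l m : R[i]) (x x' y : V) :
  k *: (x + l *: y) + (x' + m *: y) = (k *: x + x') + (k * l + m) *: y.
Proof. by rewrite scalerDr scalerA addrACA -scalerDl. Qed.

Lemma ext_linear : linear ext.
Proof.
have [[li _ _] _ _ dec _] := unit1; have [_ lrho _ _] := rep.
move=> k u v; have [a [l ->]] := dec u; have [b [m ->]] := dec v.
by rewrite lin_combine -li !extE lrho lin_combine.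
Qed.

Lemma ext_iota a : ext (iota a) = rho a.
Proof. by have := extE a 0; rewrite !scale0r !addr0. Qed.

Lemma ext_one : ext one = idfun.
Proof.
have [[li _ _] _ _ _ _] := unit1; have [_ lrho _ _] := rep.
have rho0 : rho 0 = 0.
  by have := linear_scaleB lrho 1 0 0; rewrite !scale1r !subrr.
by have := extE 0 1; rewrite !scale1r (linear0_fun li) rho0 !add0r.
Qed.

Lemma ext_representation : representation ip ext.
Proof.
have [[li iM istar] _ one1 dec _] := unit1; have [brho lrho rhoM rhostar] := rep.
split.
- move=> u; have [a [l ->]] := dec u; rewrite extE addrC.
  by apply: bounded_op_lin; [exact: bounded_op_id|].
- exact: ext_linear.
- move=> u v; have [a [l ->]] := dec u; have [b [m ->]] := dec v.
  have -> : cmul (iota a + l *: one) (iota b + m *: one) =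
      iota (m *: a + (l *: b + cmul a b)) + (l * m) *: one.
    rewrite cmulDl !cmulDr !cmulZl !cmulZr (one1 (iota a)).2 (one1 (iota b)).1.
    rewrite (one1 one).1 scalerA !li iM [LHS]addrA; congr (_ + _).
    by rewrite -addrA addrC -addrA.
  rewrite !extE !lrho rhoM; apply/funext => x.
  have [la _] := brho a; rewrite !fctE /= (linearD_fun la) (linearZ_fun _ _ la).
  rewrite scalerDr scalerA !addrA; congr (_ + _).
  by rewrite addrAC [X in _ = X + _]addrC.
- move=> u x y; have [a [l ->]] := dec u.
  have -> : star (iota a + l *: one) = iota (star a) + l^* *: one.
    by rewrite starD starZ istar (star_unit one1).
  rewrite !extE !fctE /= ipDl ipDr ipZl ipZr rhostar.
  by congr (_ + _ * _); exact: (esym (conjcK l)).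
Qed.

End unitization.

(** * The filtration of a Lipschitz pair *)

Section quantum_metric.
Context {R : realType} {A U : cstarAlgType R} {H : completeNormedModType R[i]}.
Variables (ip : {dot H for @Num.conj R[i]}) (iota : A -> U) (one : U).
Variables (L : U -> \bar R) (rho : A -> H -> H).
Hypothesis hn : hilbert_norm ip.
Hypothesis lip : lipschitz_pair iota one L.
Hypothesis rep : representation ip rho.
Hypothesis nondeg : nondegenerate_rep rho.

Local Notation ext := (unital_ext iota one rho idfun).

Definition lipschitz_ball : set (H -> H) :=
  [set a | exists2 u, self_adjoint u /\ (L u <= 1)%E & a = ext u].

Local Notation D := lipschitz_ball.

Let unit1 : is_unitization iota one. Proof. by case: lip. Qed.
Let one1 : is_unit_elt one. Proof. by case: unit1. Qed.
Let erep : representation ip ext. Proof. exact: ext_representation. Qed.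
Let elin : linear ext. Proof. by case: erep. Qed.
Let eone : ext one = idfun. Proof. exact: (ext_one unit1 rep nondeg). Qed.

Lemma lipschitz_ball_sa a : D a -> sa_op ip a.
Proof. by move=> [u [su _] ->]; exact: (rep_sa erep). Qed.

Let L_scalar (t : R) : L (t%:C *: one) = 0%E.
Proof.
have [_ _ _ _ ker] := lip.
suff : [set u | L u = 0%E] (t%:C *: one) by [].
by rewrite ker; exists t.
Qed.

Let scalar_sa (t : R) : self_adjoint (t%:C *: one).
Proof. by apply: self_adjointZ; exact: star_unit. Qed.

Let selfadjD (u v : U) : self_adjoint u -> self_adjoint v -> self_adjoint (u + v).
Proof. by rewrite /self_adjoint /= starD => -> ->. Qed.

Let dom1 u : (L u <= 1)%E -> (L u < +oo)%E.
Proof. by move=> u1; exact: le_lt_trans u1 (ltry 1). Qed.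

Let L_add_scalar (t : R) u : (L u <= 1)%E -> (L (t%:C *: one + u)%R <= 1)%E.
Proof.
have [_ _ _ [_ LD] _] := lip; move=> u1.
have t0 : (L (t%:C *: one) < +oo)%E by rewrite L_scalar ltry.
by rewrite (le_trans (LD _ _ t0 (dom1 u1)))// L_scalar add0e.
Qed.

Let L_opp u : (L u <= 1)%E -> (L ((-1)%:C *: u) <= 1)%E.
Proof.
have [_ _ _ [LZ _] _] := lip; move=> u1.
by rewrite (LZ _ _ (dom1 u1)) normrN1 mul1e.
Qed.

Lemma lipschitz_ball_shift a s : D a -> D (pop a ('X - s%:P)).
Proof.
move=> Da; have [la _ _] := lipschitz_ball_sa Da; case: Da => u [su u1] aE.
exists ((- s)%:C *: one + u).
  by split; [exact: selfadjD|exact: L_add_scalar].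
rewrite elin eone -aE; apply/funext => x.
by rewrite (popB a) (popX la) (popC a) !fctE addrC rmorphN scaleNr.
Qed.

Lemma lipschitz_ball_flip a s : D a -> D (pop a (s%:P - 'X)).
Proof.
move=> Da; have [la _ _] := lipschitz_ball_sa Da; case: Da => u [su u1] aE.
exists (s%:C *: one + (-1)%:C *: u).
  by split; [apply: selfadjD => //; exact: self_adjointZ|apply/L_add_scalar/L_opp].
rewrite rmorphN1 scaleN1r (linear_scaleB elin) eone -aE; apply/funext => x.
by rewrite (popB a) (popX la) (popC a).
Qed.

Local Transparent Ele Egt.
Lemma BstarE : Bstar ip iota one L rho = propagation_le ip D.
Proof.
apply/funext => r; apply/seteqP; split=> T [bT h]; split => //.
  by move=> _ [u [su u1] ->]; exact: h.
by move=> u su u1; apply: h; exists u.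
Qed.
Local Opaque Ele Egt.

(** Commutation with the ball spreads by homogeneity to the domain of [L], by density and
    contractivity to all self-adjoint elements, and by real and imaginary parts to everything. *)
Lemma lipschitz_ball_commutant :
  commutant (range rho) =
  [set T | bounded_op T /\ forall a x, D a -> T (a x) = a (T x)].
Proof.
have [[li _ istar] _ _ dec _] := unit1.
have [_ lrho _ _] := rep; have [ebd _ _ _] := erep.
apply/seteqP; split=> T [bT Tc]; split => //;
  have [lT [C [C0 TC]]] := (bounded_opP T).1 bT.
  move=> _ x [u _ ->]; have [b [l ->]] := dec u.
  rewrite (extE unit1 rep nondeg) !fctE /= (linearD_fun lT) (linearZ_fun _ _ lT).
  by have /(congr1 (fun f => f x))/= -> := Tc (rho b) (ex_intro2 _ _ b I erefl).
pose com u := forall x, T (ext u x) = ext u (T x).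
have comL (k : R[i]) u v : com u -> com v -> com (k *: u + v).
  move=> cu cv x; rewrite elin !fctE.
  by rewrite (linearD_fun lT) (linearZ_fun _ _ lT) cu cv.
have com_dom u : self_adjoint u -> (L u < +oo)%E -> com u.
  move=> su Lu x; have [_ _ L0 [LZ _] _] := lip.
  have Lf : L u = (fine (L u))%:E by rewrite fineK// ge0_fin_numE.
  set r := fine (L u) in Lf.
  have r0 : 0 <= r by rewrite fine_ge0.
  (* The summand 1 covers the case [L u = 0]. *)
  pose t := (r + 1)^-1.
  have r1 : 0 < r + 1 by rewrite ltr_wpDl.
  have t0 : t%:C != 0 :> R[i].
    by rewrite (_ : 0 = 0%:C)// (inj_eq (@complexI _)) invr_eq0 gt_eqF.
  have tu : ext (t%:C *: u) = t%:C *: ext u.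
    exact: linear_scale.
  have : T (ext (t%:C *: u) x) = ext (t%:C *: u) (T x).
    apply: Tc; exists (t%:C *: u) => //; split; first exact: self_adjointZ.
    rewrite (LZ _ _ Lu) Lf -EFinM lee_fin ger0_norm ?invr_ge0 ?(ltW r1)//.
    by rewrite ler_pdivrMl// mulr1 lerDl.
  by rewrite tu !fctE (linearZ_fun _ _ lT) => /(scalerI t0).
have com_sa v : self_adjoint v -> com v.
  move=> sv x; have [_ [dsa sacl] _ _ _] := lip.
  apply/eqP; rewrite -subr_eq0; apply/eqP.
  apply: (@rnorm_small_eq0 _ _ _ (2 * C * rnorm x)) => e e0.
  have eC : 0 < e%:C :> R[i] by rewrite ltcR.
  have [u [Lu vu]] := sacl v sv _ (nbhsx_ballx v _ eC).
  have su := dsa u Lu.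
  have {}vu : rnorm (v - u) <= e.
    by move: vu; rewrite -ball_normE /= rnormE ltcR => /ltW.
  have svu : self_adjoint (v - u) by rewrite /self_adjoint /= starB sv su.
  have evu y : ext v y = ext (v - u) y + ext u y.
    by rewrite -{2}[v]scale1r (linear_scaleB elin) scale1r !fctE subrK.
  have eB y : rnorm (ext (v - u) y) <= e * rnorm y.
    rewrite (le_trans (rep_contractive hn erep one1 eone _ svu))//.
    by rewrite ler_wpM2r ?rnorm_ge0.
  rewrite !evu (linearD_fun lT) (com_dom u su Lu) opprD addrACA subrr addr0.
  rewrite (le_trans (rnormB _ _))//.
  have h1 := le_trans (TC _) (ler_wpM2l C0 (eB x)).
  have h2 := le_trans (eB (T x)) (ler_wpM2l (ltW e0) (TC x)).
  by move: h1 h2; lra.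
move=> _ [b _ <-]; apply/funext => x /=.
rewrite -(ext_iota unit1 rep nondeg).
suff : com (iota b) by exact.
(* [p] is the real part of [b] and [q] is twice its imaginary part. *)
pose p := 2^-1%:C *: (b + star b); pose q := 'i%C *: (star b - b).
have sp : self_adjoint p.
  by apply: self_adjointZ; rewrite /self_adjoint /= starD starK addrC.
have sq : self_adjoint q.
  rewrite /self_adjoint /q /= starZ starB starK -(opprB _ b) scalerN -scaleNr.
  by congr (_ *: _); apply/eqP; rewrite eq_complex /= opprK oppr0 !eqxx.
have -> : b = (2^-1%:C * 'i%C) *: q + p.
  rewrite /p /q scalerA -mulrA (_ : 'i%C * 'i%C = -1); last first.
    by rewrite -expr2 sqr_i.
  rewrite mulrN1 scaleNr addrC -scalerBr opprB addrACA subrr addr0.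
  by rewrite -(mulr2n b) -(scaler_nat 2 b) scalerA fmorphV rmorph_nat mulVf ?scale1r//.
by rewrite li; apply: comL; apply: com_sa; rewrite /self_adjoint /= -istar ?sp ?sq.
Qed.

End quantum_metric.

Theorem theorem3p5 (R : realType) (A U M : cstarAlgType R)
    (iota : A -> U) (one : U) (j : M -> A) (L : U -> \bar R)
    (H : completeNormedModType R[i]) (ip : {dot H for @Num.conj R[i]})
    (rho : A -> H -> H) :
  locally_compact_qms iota one j L ->
  separable_space A ->
  hilbert_norm ip ->
  representation ip rho -> injective rho -> nondegenerate_rep rho ->
  let N := commutant (commutant (range rho)) in
  let V := Bstar ip iota one L rho in
  wstar_quantum_metric ip N V /\ reflexive_filtration ip N V.
Proof.
move=> [[lip _ _ _] _] _ hn rep _ nondeg N V.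
have VE : V = propagation_le ip (lipschitz_ball iota one L rho).
  exact: BstarE.
have sa := lipschitz_ball_sa lip rep nondeg.
have shift := lipschitz_ball_shift lip rep nondeg.
have flip := lipschitz_ball_flip lip rep nondeg.
have CE := lipschitz_ball_commutant hn lip rep nondeg.
have [brho _ _ rhostar] := rep.
have bW : range rho `<=` @bounded_op R H by move=> _ [b _ <-].
have aW S : range rho S -> exists2 S', range rho S' & is_adjoint ip S S'.
  by move=> [b _ <-]; exists (rho (star b)); [exists (star b)|exact: rhostar].
rewrite VE; split; last first.
  apply: (propagation_le_reflexive hn sa) => a E Da Eq.
  (* What commutes with [rho A] commutes with the ball, hence with its spectral projections; these
     therefore lie in the bicommutant. *)
  split; first exact: (sp_bounded_op hn (sa _ Da) Eq).
  rewrite CE => S [bS Sc]; apply/funext => x /=; apply/esym.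
  by apply: (sp_commute hn (sa _ Da) Eq bS) => y; exact: Sc.
split.
- apply: (commutant_von_neumann hn) => [S []//|].
  by move=> S; exact: commutant_adjoint.
- exact: propagation_le_filtration.
- by rewrite (propagation_0 hn sa shift flip) commutantK3.
Qed.
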